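(* The hyperfinite II$_1$ factor $\mathcal R$ is the enforceable model of its universal theory $\mathrm{Th}_\forall(\mathcal R)$ (in the language of tracial von Neumann algebras).
   Context: Tracial von Neumann algebras $(M,\tau)$ ($\tau$ a faithful normal tracial state) are regarded as structures in a many-sorted continuous language $L$: for each $k\ge 1$ there is a sort for the closed operator-norm ball of radius $k$, with metric $\|x-y\|_2$ where $\|x\|_2=\tau(x^*x)^{1/2}$; there are function symbols for the $*$-algebra operations (addition, multiplication, adjoint, multiplication by scalars in $\mathbb Q(i)$), constants $0,1$, inclusion maps between balls, and predicates for the real and imaginary parts of $\tau$. $\mathrm{Th}_\forall(\mathcal R)$ is the set of closed conditions $\sigma=0$ with $\sigma$ a universal $L$-sentence and $\sigma^{\mathcal R}=0$ (its models are the tracial von Neumann algebras embeddable into ultrapowers of $\mathcal R$). Game with respect to an $L$-theory $T$ (here $T=\mathrm{Th}_\forall(\mathcal R)$). Fix a countable set $C$ of new constant symbols, infinitely many of each sort, and set $L(C)=L\cup C$. A restricted formula is one built using a fixed countable family of continuous connectives whose compositions are uniformly dense among all continuous connectives. A condition is a finite set $p$ of expressions $\varphi<r$, with $\varphi$ a quantifier-free restricted $L(C)$-sentence and $r\in\mathbb R$, such that $T\cup p$ is satisfiable. Two players $\forall$ and $\exists$ alternately play conditions $p_0\subseteq p_1\subseteq p_2\subseteq\cdots$ ($\forall$ moves first; each move contains the previous one) for $\omega$ steps; let $\bar p=\bigcup_i p_i$. The play is definitive if for every atomic $L(C)$-sentence $\varphi$ there is a unique real $r$ with $T\cup\bar p\models\varphi=r$;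 then $\bar p$ determines a prestructure on the algebra of closed $L(C)$-terms, whose completion is the compiled structure. A property $P$ is enforceable (with respect to $T$) if $\exists$ has a strategy guaranteeing, whatever $\forall$ plays, that the play is definitive and the compiled structure has $P$. A structure $A$ is enforceable (the enforceable model of $T$) if the property ''the $L$-reduct of the compiled structure is isomorphic to $A$'' is enforceable. *)

(* Defs.v *)
From HB Require Import structures.
From Stdlib Require Import BinPos Pnat.
From mathcomp Require Import all_boot all_order all_algebra.
From mathcomp Require Import complex ring.
From mathcomp Require Import all_classical all_reals all_analysis.

Set Implicit Arguments.
Unset Strict Implicit.
Unset Printing Implicit Defensive.

Import Order.TTheory GRing.Theory Num.Theory.
Import numFieldNormedType.Exports.

Local Open Scope classical_set_scope.
Local Open Scope ring_scope.

(* [dot] is linear in its first argument. *)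
Record hilbert (K : realType) := Hilbert {
  hcar :> completeNormedModType K[i];
  dot : hcar -> hcar -> K[i];
  dotDl : forall u v w, dot (u + v) w = dot u w + dot v w;
  dotZl : forall a u v, dot (a *: u) v = a * dot u v;
  dotC : forall u v, dot u v = Num.conj (dot v u);
  dot_norm : forall v, dot v v = `|v| ^+ 2 }.

Section Operators.
Variables (K : realType) (H : hilbert K).
Implicit Types x y : H -> H.

Definition bounded_by (c : K[i]) x := forall v, `|x v| <= c * `|v|.

Definition bounded_op x := linear x /\ exists c, bounded_by c x.

Definition adjoint_of x y := forall u v, dot (x u) v = dot u (y v).

Definition commutant (S : set (H -> H)) : set (H -> H) :=
  [set y | bounded_op y /\ forall x, S x -> y \o x = x \o y].

(* sigma-weak continuity on [M], in the form
   x |-> \sum_n <x (xi n), eta n> with xi and eta square-summable *)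
Definition normal_on (M : set (H -> H)) (tau : (H -> H) -> K[i]) :=
  exists xi eta : nat -> H,
    [/\ cvgn (series (fun n => `|xi n| ^+ 2 : K[i]^o)),
        cvgn (series (fun n => `|eta n| ^+ 2 : K[i]^o)) &
        forall x, M x ->
          series (fun n => dot (x (xi n)) (eta n) : K[i]^o) @ \oo
            --> (tau x : K[i]^o)].

End Operators.

(* The values of [tau] outside [vN] are irrelevant. *)
Record tracial_vNa (K : realType) := TracialvNa {
  vH :> hilbert K;
  vN : set (vH -> vH);
  vN_bounded : forall x, vN x -> bounded_op x;
  vN_id : vN id;
  vN_add : forall x y, vN x -> vN y -> vN (x + y);
  vN_scale : forall a x, vN x -> vN (a *: x);
  vN_mul : forall x y, vN x -> vN y -> vN (x \o y);
  vN_adj : forall x, vN x -> exists2 y, vN y & adjoint_of x y;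
  vN_bicommutant : commutant (commutant vN) = vN;
  tau : (vH -> vH) -> K[i];
  tau_linear : forall a x y, vN x -> vN y ->
    tau (a *: x + y) = a * tau x + tau y;
  tau_state : tau id = 1;
  tau_ge0 : forall x y, vN x -> vN y -> adjoint_of x y -> 0 <= tau (y \o x);
  tau_faithful : forall x y, vN x -> vN y -> adjoint_of x y ->
    tau (y \o x) = 0 -> x = 0;
  tau_trace : forall x y, vN x -> vN y -> tau (x \o y) = tau (y \o x);
  tau_normal : normal_on vN tau }.

Definition unital_star_hom (K : realType) (H : hilbert K)
    (pi : 'M[K[i]]_2 -> (H -> H)) :=
  [/\ forall x, bounded_op (pi x),
      forall a x y, pi (a *: x + y) = a *: pi x + pi y,
      pi 1 = id,
      forall x y, pi (x * y) = pi x \o pi y &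
      forall x, adjoint_of (pi x) (pi (map_mx Num.conj x^T))].

(* R is constructed as the weak closure of the algebraic infinite tensor power
   of M_2(C), that is, of the union of M_2(C) < M_4(C) < M_8(C) < ..., in the
   GNS representation of its trace.  A representation of the tensor power is a
   sequence [pi] of unital representations of M_2(C) with commuting ranges, and
   the GNS representation of a state is the one with a cyclic vector inducing
   that state.  The tensor power has only one tracial state (the normalized
   trace on each M_{2^n}(C)), so that [tau] being a trace determines the state
   and hence, up to unitary equivalence, the pair (R, tau). *)
Definition is_hyperfinite_R (K : realType) (R : tracial_vNa K) :=
  exists (pi : nat -> 'M[K[i]]_2 -> (R -> R)) (xi : R),
    [/\ forall n, unital_star_hom (pi n),
        forall m n a b, m != n -> pi m a \o pi n b = pi n b \o pi m a,
        @vN K R = commutant (commutant [set x | exists n a, x = pi n a]),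
        forall x, vN x -> tau x = dot (x xi) xi &
        closure [set x xi | x in @vN K R] = setT].

(* The sort [k] is the ball of radius [k]. *)
Definition radius (k : positive) : nat := Pos.to_nat k.

(* [(a, b)] stands for a + i b. *)
Definition gauss := (rat * rat)%type.
Definition gauss_norm2 (q : gauss) : rat := q.1 ^+ 2 + q.2 ^+ 2.
Definition gaussC (K : realType) (q : gauss) : K[i] :=
  (ratr q.1 +i* ratr q.2)%C.

(* |q| k <= m *)
Definition scal_dom (q : gauss) (k m : positive) : bool :=
  gauss_norm2 q * (radius k)%:R ^+ 2 <= (radius m)%:R ^+ 2.

Record prestructure (K : realType) := Prestructure {
  scar :> positive -> Type;
  sdist : forall k, scar k -> scar k -> K;
  szero : scar 1%positive;
  sone : scar 1%positive;
  sadd : forall k l, scar k -> scar l -> scar (Pos.add k l);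
  smul : forall k l, scar k -> scar l -> scar (Pos.mul k l);
  sadj : forall k, scar k -> scar k;
  sscal : forall (q : gauss) k m, scal_dom q k m -> scar k -> scar m;
  sincl : forall k l, (radius k <= radius l)%N -> scar k -> scar l;
  sretr : forall k, scar k -> K;
  simtr : forall k, scar k -> K }.

Arguments sdist {K} p {k}.
Arguments szero {K} p.
Arguments sone {K} p.
Arguments sadd {K} p {k l}.
Arguments smul {K} p {k l}.
Arguments sadj {K} p {k}.
Arguments sscal {K} p q {k m}.
Arguments sincl {K} p {k l}.
Arguments sretr {K} p {k}.
Arguments simtr {K} p {k}.

Section Structures.
Variable K : realType.
Implicit Types M N : prestructure K.

Definition metric_complete M :=
  forall k (u : nat -> M k),
    (forall e : K, 0 < e -> exists n0 : nat, forall m n,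
       (n0 <= m)%N -> (n0 <= n)%N -> sdist M (u m) (u n) < e) ->
    exists x : M k, forall e : K, 0 < e -> exists n0 : nat, forall n,
       (n0 <= n)%N -> sdist M (u n) x < e.

(* The moduli of uniform continuity are the Lipschitz constants that hold for
   the operations of a tracial von Neumann algebra on balls. *)
Record is_structure M : Prop := IsStructure {
  st_dist0 : forall k (x y : M k), sdist M x y = 0 <-> x = y;
  st_dist_sym : forall k (x y : M k), sdist M x y = sdist M y x;
  st_dist_triangle : forall k (x y z : M k),
    sdist M x z <= sdist M x y + sdist M y z;
  st_dist_bound : forall k (x y : M k), sdist M x y <= 2 * (radius k)%:R;
  st_complete : metric_complete M;
  st_add : forall k l (x x' : M k) (y y' : M l),
    sdist M (sadd M x y) (sadd M x' y') <= sdist M x x' + sdist M y y';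
  st_mul : forall k l (x x' : M k) (y y' : M l),
    sdist M (smul M x y) (smul M x' y')
      <= (radius l)%:R * sdist M x x' + (radius k)%:R * sdist M y y';
  st_adj : forall k (x x' : M k),
    sdist M (sadj M x) (sadj M x') <= sdist M x x';
  st_scal : forall q k m (h : scal_dom q k m) (x x' : M k),
    sdist M (sscal M q h x) (sscal M q h x')
      <= Num.sqrt (ratr (gauss_norm2 q)) * sdist M x x';
  st_incl : forall k l (h : (radius k <= radius l)%N) (x x' : M k),
    sdist M (sincl M h x) (sincl M h x') <= sdist M x x';
  st_retr_bound : forall k (x : M k), `|sretr M x| <= (radius k)%:R;
  st_imtr_bound : forall k (x : M k), `|simtr M x| <= (radius k)%:R;
  st_retr : forall k (x x' : M k),
    `|sretr M x - sretr M x'| <= sdist M x x';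
  st_imtr : forall k (x x' : M k),
    `|simtr M x - simtr M x'| <= sdist M x x' }.

Definition isomorphic M N :=
  exists f : forall k, M k -> N k,
    (forall k, bijective (f k)) /\
    (forall k (x y : M k), sdist N (f k x) (f k y) = sdist M x y) /\
    f _ (szero M) = szero N /\
    f _ (sone M) = sone N /\
    (forall k l (x : M k) (y : M l),
       f _ (sadd M x y) = sadd N (f k x) (f l y)) /\
    (forall k l (x : M k) (y : M l),
       f _ (smul M x y) = smul N (f k x) (f l y)) /\
    (forall k (x : M k), f _ (sadj M x) = sadj N (f k x)) /\
    (forall q k m (h : scal_dom q k m) (x : M k),
       f _ (sscal M q h x) = sscal N q h (f k x)) /\
    (forall k l (h : (radius k <= radius l)%N) (x : M k),
       f _ (sincl M h x) = sincl N h (f k x)) /\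
    (forall k (x : M k), sretr N (f k x) = sretr M x) /\
    (forall k (x : M k), simtr N (f k x) = simtr M x).

End Structures.

Section AlgebraStructure.
Variables (K : realType) (A : tracial_vNa K).
Implicit Types (k l m : positive) (x y : A -> A).

Let rad k : K[i] := (radius k)%:R.

Definition opball k : Type := {x : A -> A | vN x /\ bounded_by (rad k) x}.

Lemma rad_ge0 k : 0 <= rad k. Proof. exact: ler0n. Qed.

Lemma linear_vN x : vN x -> linear x.
Proof. by move=> /vN_bounded []. Qed.

Lemma dotBl (H : hilbert K) (u v w : H) : dot (u - v) w = dot u w - dot v w.
Proof. by rewrite dotDl -scaleN1r dotZl mulN1r. Qed.

Lemma CauchySchwarz_dot (H : hilbert K) (u v : H) :
  `|dot u v| <= `|u| * `|v|.
Proof.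
have [->|v0] := eqVneq v 0.
  rewrite normr0 mulr0 dotC -(scale0r 0) dotZl mul0r.
  by rewrite rmorph0 normr0.
have dotZr a (x y : H) : dot x (a *: y) = Num.conj a * dot x y.
  by rewrite dotC dotZl rmorphM /= -dotC.
have dotBr (x y z : H) : dot x (y - z) = dot x y - dot x z.
  by rewrite dotC dotBl rmorphB /= -!dotC.
have nv : 0 < `|v| by rewrite normr_gt0.
have nv2 : 0 < `|v| ^+ 2 by rewrite exprn_gt0.
rewrite -(@ler_pXn2r _ 2) ?nnegrE ?mulr_ge0 // exprMn.
have : 0 <= dot (`|v| ^+ 2 *: u - dot u v *: v) (`|v| ^+ 2 *: u - dot u v *: v).
  by rewrite dot_norm exprn_ge0.
rewrite !(dotBl, dotBr, dotZl, dotZr) !dot_norm (dotC v u).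
have -> : Num.conj (`|v| ^+ 2) = `|v| ^+ 2 :> K[i].
  by apply: CrealP; rewrite rpredX // normr_real.
set w := dot u v; set a := `|v| ^+ 2; set b := `|u| ^+ 2.
have -> : a * (a * b) - a * (Num.conj w * w)
    - (w * (a * Num.conj w) - w * (Num.conj w * a))
  = a * (b * a - w * Num.conj w) by ring.
by rewrite -normCK pmulr_rge0 // subr_ge0.
Qed.

Lemma ball_zero_proof : vN (0 : A -> A) /\ bounded_by (rad 1%positive) (0 : A -> A).
Proof.
split; first by rewrite -(scale0r (id : A -> A)); apply/vN_scale/vN_id.
by move=> v; rewrite /= normr0 mulr_ge0 ?rad_ge0.
Qed.

Lemma ball_one_proof : vN (@id A) /\ bounded_by (rad 1%positive) (@id A).
Proof. by split; [exact: vN_id | move=> v; rewrite /rad mul1r]. Qed.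

Lemma ball_add_proof k l (x : opball k) (y : opball l) :
  vN (sval x + sval y) /\ bounded_by (rad (Pos.add k l)) (sval x + sval y).
Proof.
case: x y => [x [Mx bx]] [y [My by_]] /=; split; first exact: vN_add.
move=> v; rewrite /rad /radius Pos2Nat.inj_add natrD mulrDl.
by apply: le_trans (ler_normD _ _) _; apply: lerD.
Qed.

Lemma ball_mul_proof k l (x : opball k) (y : opball l) :
  vN (sval x \o sval y) /\ bounded_by (rad (Pos.mul k l)) (sval x \o sval y).
Proof.
case: x y => [x [Mx bx]] [y [My by_]] /=; split; first exact: vN_mul.
move=> v; rewrite /rad /radius Pos2Nat.inj_mul natrM -mulrA /=.
by apply: le_trans (bx _) _; apply: ler_wpM2l (by_ v); apply: rad_ge0.
Qed.

Lemma ball_scal_proof q k m (h : scal_dom q k m) (x : opball k) :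
  vN (gaussC K q *: sval x) /\ bounded_by (rad m) (gaussC K q *: sval x).
Proof.
case: x => [x [Mx bx]] /=; split; first exact: vN_scale.
have qk : `|gaussC K q| * rad k <= rad m.
  rewrite -(@ler_pXn2r _ 2) ?nnegrE ?mulr_ge0 ?rad_ge0 // exprMn.
  rewrite -add_Re2_Im2 /=.
  have radE n : rad n = ((radius n)%:R)%:C%C :> K[i] by rewrite rmorph_nat.
  rewrite !radE -!(rmorphXn (real_complex K)) -rmorphM /= lecR.
  move: h; rewrite /scal_dom /gauss_norm2 -(ler_rat K) rmorphM rmorphD /=.
  by rewrite 4!(rmorphXn (ratr : rat -> K)) /= !ratr_nat.
move=> v; rewrite [X in `|X|](_ : _ = gaussC K q *: x v) // normrZ; apply: le_trans (ler_wpM2r (normr_ge0 _) qk).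
by rewrite -mulrA; apply: ler_wpM2l.
Qed.

Lemma ball_incl_proof k l (h : (radius k <= radius l)%N) (x : opball k) :
  vN (sval x) /\ bounded_by (rad l) (sval x).
Proof.
case: x => [x [Mx bx]] /=; split=> // v.
by apply: le_trans (bx v) _; apply: ler_wpM2r; rewrite // ler_nat.
Qed.

Lemma adj_exists x : vN x -> exists y, vN y /\ adjoint_of x y.
Proof. by move=> /vN_adj [y My xy]; exists y. Qed.

Definition star x (Mx : vN x) : A -> A := sval (cid (adj_exists Mx)).

Lemma ball_adj_proof k (x : opball k) :
  vN (star (svalP x).1) /\ bounded_by (rad k) (star (svalP x).1).
Proof.
case: x => [x [Mx bx]] /=; rewrite /star; case: cid => y [My xy] /=.
split=> // v; have [->|yv0] := eqVneq (y v) 0.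
  by rewrite normr0 mulr_ge0 ?rad_ge0.
have nyv : 0 < `|y v| by rewrite normr_gt0.
rewrite -(ler_pM2l nyv) -expr2 -(dot_norm (y v)) -xy.
rewrite -[dot _ _]ger0_norm; last by rewrite xy dot_norm exprn_ge0.
apply: le_trans (CauchySchwarz_dot _ _) _.
by rewrite mulrA (mulrC _ (rad k)); apply: ler_wpM2r.
Qed.

Lemma opball_sub_proof k (x y : opball k) : vN (sval x - sval y).
Proof.
rewrite -scaleN1r; apply: vN_add; first by case: x => x [].
by apply: vN_scale; case: y => y [].
Qed.

(* [norm2 z] is tau(z^* z)^(1/2). *)
Definition norm2 x (Mx : vN x) : K :=
  Num.sqrt (complex.Re (tau (star Mx \o x))).

Definition structure_of : prestructure K := {|
  scar := opball;
  sdist := fun k (x y : opball k) => norm2 (opball_sub_proof x y);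
  szero := exist _ _ ball_zero_proof;
  sone := exist _ _ ball_one_proof;
  sadd := fun k l (x : opball k) (y : opball l) => exist _ _ (ball_add_proof x y);
  smul := fun k l (x : opball k) (y : opball l) => exist _ _ (ball_mul_proof x y);
  sadj := fun k (x : opball k) => exist _ _ (ball_adj_proof x);
  sscal := fun q k m h (x : opball k) => exist _ _ (ball_scal_proof h x);
  sincl := fun k l h (x : opball k) => exist _ _ (ball_incl_proof h x);
  sretr := fun k (x : opball k) => complex.Re (tau (sval x));
  simtr := fun k (x : opball k) => complex.Im (tau (sval x)) |}.

End AlgebraStructure.

(* Terms over a family of symbols (variables or constants) indexed by [I], the
   symbol [i] being of sort [s i]. *)
Inductive term (I : Type) (s : I -> positive) : positive -> Type :=
| TVar i : term s (s i)
| TZero : term s 1%positive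
| TOne : term s 1%positive
| TAdd k l : term s k -> term s l -> term s (Pos.add k l)
| TMul k l : term s k -> term s l -> term s (Pos.mul k l)
| TAdj k : term s k -> term s k
| TScal q k m : scal_dom q k m -> term s k -> term s m
| TIncl k l : (radius k <= radius l)%N -> term s k -> term s l.

Inductive atomic (I : Type) (s : I -> positive) : Type :=
| ADist k : term s k -> term s k -> atomic s
| AReTr k : term s k -> atomic s
| AImTr k : term s k -> atomic s.

Record connectives (K : realType) := Connectives {
  cidx : Type;
  carity : cidx -> nat;
  cfun : forall c, 'rV[K]_(carity c) -> K;
  cfun_continuous : forall c, continuous (@cfun c) }.

Inductive qf_formula (K : realType) (S : connectives K)
    (I : Type) (s : I -> positive) : Type :=
| QAtom : atomic s -> qf_formula S s
| QConn (c : cidx S) : ('I_(carity c) -> qf_formula S s) -> qf_formula S s.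

Section Semantics.
Variables (K : realType) (S : connectives K) (M : prestructure K).
Variables (I : Type) (s : I -> positive) (a : forall i, M (s i)).

Fixpoint term_val k (t : term s k) : M k :=
  match t in term _ k return M k with
  | TVar i => a i
  | TZero => szero M
  | TOne => sone M
  | TAdd _ _ t u => sadd M (term_val t) (term_val u)
  | TMul _ _ t u => smul M (term_val t) (term_val u)
  | TAdj _ t => sadj M (term_val t)
  | TScal q _ _ h t => sscal M q h (term_val t)
  | TIncl _ _ h t => sincl M h (term_val t)
  end.

Definition atomic_val (phi : atomic s) : K :=
  match phi with
  | ADist _ t u => sdist M (term_val t) (term_val u)
  | AReTr _ t => sretr M (term_val t)
  | AImTr _ t => simtr M (term_val t)
  end.

Fixpoint qf_val (phi : qf_formula S s) : K :=
  match phi with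
  | QAtom phi => atomic_val phi
  | QConn c args => cfun (\row_i qf_val (args i))
  end.

End Semantics.

Definition all_connectives (K : realType) : connectives K := {|
  cidx := {n : nat & {f : 'rV[K]_n -> K | continuous f}};
  carity := fun c => projT1 c;
  cfun := fun c => sval (projT2 c);
  cfun_continuous := fun c => svalP (projT2 c) |}.

Inductive composition (K : realType) (S : connectives K) (n : nat) : Type :=
| CProj : 'I_n -> composition S n
| CComp (c : cidx S) : ('I_(carity c) -> composition S n) -> composition S n.

Fixpoint comp_val (K : realType) (S : connectives K) n (g : composition S n)
    (x : 'rV[K]_n) : K :=
  match g with
  | CProj i => x 0 i
  | CComp c args => cfun (\row_i comp_val (args i) x)
  end.

(* The connectives are functions on R^n, so density is uniform on compacts. *)
Definition countable_dense (K : realType) (S : connectives K) :=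
  countable [set: cidx S] /\
  forall n (f : 'rV[K]_n.+1 -> K), continuous f ->
  forall A : set 'rV[K]_n.+1, compact A ->
  forall e : K, 0 < e ->
  exists g : composition S n.+1, forall x, A x -> `|comp_val g x - f x| < e.

(* The sentence sup_x phi(x).  As usual for closed conditions sigma = 0, the
   formula is nonnegative: without this, sup_x (- phi(x)) = 0 would be the
   existential condition inf_x phi(x) = 0. *)
Record universal_sentence (K : realType) := UniversalSentence {
  uvars : nat;
  usort : 'I_uvars -> positive;
  umatrix : qf_formula (all_connectives K) usort;
  umatrix_ge0 : forall M : prestructure K, is_structure M ->
    forall a : (forall i, M (usort i)), 0 <= qf_val a umatrix }.

Definition universal_val (K : realType) (M : prestructure K)
    (sigma : universal_sentence K) : K :=
  sup [set r | exists a : (forall i, M (usort (u := sigma) i)),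
                 r = qf_val a (umatrix sigma)].

(* A sentence sigma in the set stands for the condition sigma = 0. *)
Definition universal_theory (K : realType) := set (universal_sentence K).

Definition Th_forall (K : realType) (M : prestructure K) : universal_theory K :=
  [set sigma | universal_val M sigma = 0].

(* the constants of [C], [(k, i)] being of sort [k] *)
Definition const := (positive * nat)%type.
Definition const_sort (c : const) : positive := c.1.

Record LC_structure (K : realType) := LCStructure {
  reduct :> prestructure K;
  cst : forall c : const, reduct (const_sort c) }.

Section Game.
Variables (K : realType) (S : connectives K) (T : universal_theory K).

(* [(phi, r)] stands for phi < r. *)
Definition expr := (qf_formula S const_sort * K)%type.

Implicit Types (p : set expr) (N : LC_structure K).

Definition models N p :=
  [/\ is_structure N,
      forall sigma, T sigma -> universal_val N sigma = 0 &
      forall phi r, p (phi, r) -> qf_val (@cst K N) phi < r].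

Definition condition p := finite_set p /\ exists N, models N p.

Definition entails p (phi : atomic const_sort) (r : K) :=
  forall N, models N p -> atomic_val (@cst K N) phi = r.

Definition definitive p :=
  forall phi : atomic const_sort, exists! r : K, entails p phi r.

(* [N] is the completion of the prestructure on closed terms determined by
   [p]; such an [N] is unique up to isomorphism when [p] is definitive. *)
Definition compiled p N :=
  [/\ is_structure N,
      forall phi r, entails p phi r -> atomic_val (@cst K N) phi = r &
      forall k (x : N k) (e : K), 0 < e ->
        exists t : term const_sort k, sdist N (term_val (@cst K N) t) x < e].

Definition position (h : seq (set expr)) :=
  (forall i, (i < size h)%N -> condition (nth set0 h i)) /\
  (forall i, (i.+1 < size h)%N -> nth set0 h i `<=` nth set0 h i.+1).

(* The second player moves at the positions of odd length. *)
Definition strategy (f : seq (set expr) -> set expr) :=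
  forall h, position h -> odd (size h) ->
    condition (f h) /\ last set0 h `<=` f h.

Definition play_following (f : seq (set expr) -> set expr)
    (p : nat -> set expr) :=
  [/\ forall n, condition (p n),
      forall n, p n `<=` p n.+1 &
      forall n, p n.*2.+1 = f (mkseq p n.*2.+1)].

(* [P] is meant to be invariant under isomorphism. *)
Definition enforceable (P : LC_structure K -> Prop) :=
  exists2 f, strategy f &
    forall p : nat -> set expr, play_following f p ->
      definitive (\bigcup_n p n) /\
      exists2 N, compiled (\bigcup_n p n) N & P N.

Definition enforceable_model (A : prestructure K) :=
  enforceable (fun N => isomorphic (reduct N) A).

End Game.

(* Main.v *)
(* The second player answers so that the compiled structure is R itself, with
   constants interpreted by limits.  Along the play she maintains an interpretation a_n of
   the constants in R satisfying the current condition; one exists because a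
   finite set of open quantifier-free conditions that holds in some model of the
   universal theory of R already holds in R.  When the first player moves, the
   new interpretation b may be unrelated to a_n.  To control it she has named, by
   fresh constants, the first row f_j of a system of matrix units of some
   M_{2^l} < R, and has included in her move the relations of f_j up to delta and
   approximations of finitely many constants by combinations of f_i^* f_j.  Any b
   satisfying these has its constants conjugate, by one unitary of R, to elements
   close to those of a_n: the b(f_j) are close to contractions in some larger
   matrix algebra (by the conditional expectation), in which the spectral theorem
   and the polar decomposition provide the unitary.  After conjugation b extends
   a_n up to 2^-n, so that the a_n converge.  Naming elements of a countable dense
   set makes the constants dense in the limit. *)
From HB Require Import structures.
From Stdlib Require Import BinPos Pnat.
From mathcomp Require Import all_boot all_order all_algebra fingroup perm.
From mathcomp Require Import complex ring lra spectral sesquilinear.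
From mathcomp Require Import all_classical all_reals all_analysis.
Require Import Defs.

Set Implicit Arguments.
Unset Strict Implicit.
Unset Printing Implicit Defensive.

Import Order.TTheory GRing.Theory Num.Theory.
Import numFieldNormedType.Exports.

Local Open Scope classical_set_scope.
Local Open Scope ring_scope.
Local Open Scope complex_scope.
Local Open Scope sesquilinear_scope.

(** * The 2-norm of a tracial von Neumann algebra *)

(** Quantifier-free values are invariant under inner automorphisms, so a finite condition can pin a
    tuple of R down at best up to a unitary. The row f_j suffices because the other matrix units are
    the products f_i^* f_j; conjugating two rows then only requires matching the projections f_0 and
    e_0 by some w, and sum_i e_i^* w f_i carries the rest along. After compression to a finite
    level, diagonalization and comparison of projections by their traces are needed for matrices
    only; but that level depends on b, so every estimate there must be free of its dimension, which
    is why all of them are in the normalized Hilbert-Schmidt norm. Two further demands shape a move.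
    Strict inequalities do not survive limits, so every phi < r already played is repeated as phi <
    r' with r' < r. And the play has to be definitive: each atomic sentence is confined, again and
    again, to intervals whose lengths tend to 0, where the lower bound needs a formula approximating
    the negation; this is where the density of the connectives enters. *)

Section HilbertNorm.
Variables (K : realType).

(** The norms of [K[i]] and of [H] take their values in [K[i]]. Real-valued versions move all
    estimates to the ordered field [K], where [lra] and [nra] apply. *)
Definition cabs (z : K[i]) : K := complex.Re `|z|.

Lemma cabsE z : `|z| = (cabs z)%:C.
Proof. by rewrite /cabs RRe_real ?normr_real. Qed.

Lemma cabs_ge0 z : 0 <= cabs z.
Proof. by rewrite -ler0c -cabsE. Qed.

Lemma cabsM z w : cabs (z * w) = cabs z * cabs w.
Proof. by apply: complexI; rewrite rmorphM /= -!cabsE normrM. Qed.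

Lemma Re_le_cabs z : complex.Re z <= cabs z.
Proof.
rewrite /cabs normc_def /=; apply: le_trans (ler_norm _) _.
by rewrite -sqrtr_sqr ler_sqrt ?addr_ge0 ?sqr_ge0 // lerDl sqr_ge0.
Qed.

Lemma Re_real_eq (z : K[i]) : 0 <= z -> (complex.Re z)%:C = z.
Proof. by move=> z0; rewrite RRe_real // realE z0. Qed.

Lemma ReJ (z : K[i]) : complex.Re (Num.conj z) = complex.Re z.
Proof. by case: z. Qed.

Lemma cabsN z : cabs (- z) = cabs z.
Proof. by rewrite /cabs normrN. Qed.

Lemma cabsD z w : cabs (z + w) <= cabs z + cabs w.
Proof. by rewrite -lecR rmorphD /= -!cabsE ler_normD. Qed.

Lemma cabs_real (t : K) : cabs t%:C = `|t|.
Proof. by rewrite /cabs normc_def /= expr0n addr0 sqrtr_sqr. Qed.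

Lemma Im_le_cabs z : complex.Im z <= cabs z.
Proof.
rewrite /cabs normc_def /=; apply: le_trans (ler_norm _) _.
by rewrite -sqrtr_sqr ler_sqrt ?addr_ge0 ?sqr_ge0 // lerDr sqr_ge0.
Qed.

Lemma normr_Re_le z : `|complex.Re z| <= cabs z.
Proof.
rewrite ler_norml Re_le_cabs andbT lerNl -raddfN -cabsN; exact: Re_le_cabs.
Qed.

Lemma normr_Im_le z : `|complex.Im z| <= cabs z.
Proof.
rewrite ler_norml Im_le_cabs andbT lerNl -raddfN -cabsN; exact: Im_le_cabs.
Qed.

Variable H : hilbert K.
Implicit Types u v w : H.

Definition hnorm v : K := complex.Re `|v|.

Lemma hnormE v : `|v| = (hnorm v)%:C.
Proof. by rewrite /hnorm RRe_real ?normr_real. Qed.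

Lemma hnorm_ge0 v : 0 <= hnorm v.
Proof. by rewrite -ler0c -hnormE. Qed.

Lemma hnorm0 : hnorm 0 = 0.
Proof. by rewrite /hnorm normr0. Qed.

Lemma hnorm_eq0 v : hnorm v = 0 -> v = 0.
Proof. by move=> v0; apply/eqP; rewrite -normr_eq0 hnormE v0. Qed.

Lemma hnormD u v : hnorm (u + v) <= hnorm u + hnorm v.
Proof. by rewrite -lecR rmorphD /= -!hnormE ler_normD. Qed.

Lemma hnormN v : hnorm (- v) = hnorm v.
Proof. by rewrite /hnorm normrN. Qed.

Lemma hnormBC u v : hnorm (u - v) = hnorm (v - u).
Proof. by rewrite -hnormN opprB. Qed.

Lemma hnormZ a v : hnorm (a *: v) = cabs a * hnorm v.
Proof. by apply: complexI; rewrite rmorphM /= -cabsE -!hnormE normrZ. Qed.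

Lemma dot_hnorm v : dot v v = (hnorm v ^+ 2)%:C.
Proof. by rewrite dot_norm hnormE rmorphXn. Qed.

Lemma hnorm_sqr v : hnorm v ^+ 2 = complex.Re (dot v v).
Proof. by rewrite dot_hnorm. Qed.

Lemma dotDr u v w : dot u (v + w) = dot u v + dot u w.
Proof. by rewrite dotC dotDl rmorphD /= -!dotC. Qed.

Lemma dotZr a u v : dot u (a *: v) = Num.conj a * dot u v.
Proof. by rewrite dotC dotZl rmorphM /= -dotC. Qed.

Lemma dot0l v : dot 0 v = 0.
Proof. by rewrite -(scale0r 0) dotZl mul0r. Qed.

Lemma dot0r v : dot v 0 = 0.
Proof. by rewrite dotC dot0l rmorph0. Qed.

Lemma dot_suml (I : Type) (r : seq I) (P : pred I) (F : I -> H) v :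
  dot (\sum_(i <- r | P i) F i) v = \sum_(i <- r | P i) dot (F i) v.
Proof.
by apply: (big_morph (fun u => dot u v)) => [u w|]; rewrite ?dotDl ?dot0l.
Qed.

Lemma dot_sumr (I : Type) (r : seq I) (P : pred I) (F : I -> H) v :
  dot v (\sum_(i <- r | P i) F i) = \sum_(i <- r | P i) dot v (F i).
Proof.
by apply: (big_morph (dot v)) => [u w|]; rewrite ?dotDr ?dot0r.
Qed.

Lemma cabs_dot u v : cabs (dot u v) <= hnorm u * hnorm v.
Proof. by rewrite -lecR rmorphM /= -cabsE -!hnormE CauchySchwarz_dot. Qed.

Lemma dot_ext u v : (forall w, dot u w = dot v w) -> u = v.
Proof.
move=> uv; apply/eqP; rewrite -subr_eq0; apply/eqP/hnorm_eq0/eqP.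
by rewrite -sqrf_eq0 hnorm_sqr dotBl uv subrr.
Qed.

Lemma hnormD_sqr u v :
  hnorm (u + v) ^+ 2 = hnorm u ^+ 2 + hnorm v ^+ 2 + 2 * complex.Re (dot u v).
Proof.
rewrite !hnorm_sqr !dotDl !dotDr (dotC v u) !raddfD /= ReJ.
by ring.
Qed.

Lemma hnormD_orth u v : dot u v = 0 ->
  hnorm (u + v) ^+ 2 = hnorm u ^+ 2 + hnorm v ^+ 2.
Proof. by move=> uv; rewrite hnormD_sqr uv mulr0 addr0. Qed.

Lemma hnorm_complete (u : nat -> H) :
  (forall e, 0 < e -> exists n0 : nat, forall m n,
     (n0 <= m)%N -> (n0 <= n)%N -> hnorm (u m - u n) < e) ->
  exists v, forall e, 0 < e -> exists n0 : nat, forall n,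
     (n0 <= n)%N -> hnorm (u n - v) < e.
Proof.
move=> cu; have : cvgn u.
  apply: cauchy_cvg; apply/cauchy_ballP => e e0.
  have e0' : 0 < complex.Re e by move: e0; rewrite ltcE /= => /andP[].
  have [n0 n0P] := cu _ e0'.
  exists (u @` [set n | (n0 <= n)%N], u @` [set n | (n0 <= n)%N]).
    by split; exists n0 => // n /= n0n; exists n.
  move=> [_ _] [/= [m m0 <-] [n n0' <-]].
  rewrite -ball_normE /= hnormE -(Re_real_eq (ltW e0)) ltcR.
  exact: n0P.
move=> /cvg_ex[/= v /cvgrPdist_lt uv]; exists v => e e0.
have e0' : (0 : K[i]) < e%:C by rewrite ltcR.
have [n0 _ n0P] := uv _ e0'; exists n0 => n n0n.
by rewrite -ltcR -hnormE distrC; apply: n0P.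
Qed.

Lemma hnorm_lim_unique (u : nat -> H) v w :
  (forall e, 0 < e -> exists n0 : nat, forall n,
     (n0 <= n)%N -> hnorm (u n - v) < e) ->
  (forall e, 0 < e -> exists n0 : nat, forall n,
     (n0 <= n)%N -> hnorm (u n - w) < e) -> v = w.
Proof.
move=> uv uw; apply/eqP; rewrite -subr_eq0; apply/eqP/hnorm_eq0/eqP.
rewrite eq_le hnorm_ge0 andbT; apply/ler_addgt0Pr => e e0; rewrite add0r.
have e2 : 0 < e / 2 by lra.
have [n nP] := uv _ e2; have [m mP] := uw _ e2.
have := nP (maxn n m) (leq_maxl _ _); have := mP (maxn n m) (leq_maxr _ _).
set z := u _ => zw zv.
have -> : v - w = (v - z) + (z - w) by rewrite addrA subrK.
by have := hnormD (v - z) (z - w); rewrite (hnormBC v z); lra.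
Qed.

End HilbertNorm.

(** * The operators as a ring with involution *)

Definition vn (K : realType) (A : tracial_vNa K) : Type := {x : A -> A | vN x}.

Section VnRing.
Variables (K : realType) (A : tracial_vNa K).
Implicit Types x y z : vn A.

Lemma vn_inj x y : sval x = sval y -> x = y.
Proof.
by case: x y => [x px] [y py] /= xy; subst y; congr exist;
  apply: Prop_irrelevance.
Qed.

HB.instance Definition _ := gen_eqMixin (vn A).
HB.instance Definition _ := gen_choiceMixin (vn A).

Definition vn_zero : vn A := exist _ _ (ball_zero_proof A).1.
Definition vn_one : vn A := exist _ _ (vN_id A).
Definition vn_add x y : vn A := exist _ _ (vN_add (svalP x) (svalP y)).
Definition vn_scale (a : K[i]) x : vn A := exist _ _ (vN_scale a (svalP x)).
Definition vn_opp x : vn A := vn_scale (-1) x.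
Definition vn_mul x y : vn A := exist _ _ (vN_mul (svalP x) (svalP y)).
Definition vn_adj x : vn A :=
  exist _ (star (svalP x)) (svalP (cid (adj_exists (svalP x)))).1.

Lemma vn_addA : associative vn_add.
Proof. by move=> x y z; apply/vn_inj/addrA. Qed.
Lemma vn_addC : commutative vn_add.
Proof. by move=> x y; apply/vn_inj/addrC. Qed.
Lemma vn_add0 : left_id vn_zero vn_add.
Proof. by move=> x; apply/vn_inj/add0r. Qed.
Lemma vn_addN : left_inverse vn_zero vn_opp vn_add.
Proof. by move=> x; apply/vn_inj; rewrite /= scaleN1r addNr. Qed.

HB.instance Definition _ :=
  GRing.isZmodule.Build (vn A) vn_addA vn_addC vn_add0 vn_addN.

Lemma vn_linearP x a (u v : A) : sval x (a *: u + v) = a *: sval x u + sval x v.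
Proof. exact: (linear_vN (svalP x)). Qed.

Lemma vnaD x u v : sval x (u + v) = sval x u + sval x v.
Proof. by have := vn_linearP x 1 u v; rewrite !scale1r. Qed.

Lemma vna0 x : sval x 0 = 0.
Proof. by apply: (addrI (sval x 0)); rewrite -vnaD !addr0. Qed.

Lemma vnaZ x a u : sval x (a *: u) = a *: sval x u.
Proof. by have := vn_linearP x a u 0; rewrite vna0 !addr0. Qed.

Lemma vnaN x u : sval x (- u) = - sval x u.
Proof. by rewrite -scaleN1r vnaZ scaleN1r. Qed.

Lemma vnaB x u v : sval x (u - v) = sval x u - sval x v.
Proof. by rewrite vnaD vnaN. Qed.

Lemma vn_mulA : associative vn_mul.
Proof. by move=> x y z; apply/vn_inj. Qed.
Lemma vn_mul1l : left_id vn_one vn_mul.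
Proof. by move=> x; apply/vn_inj. Qed.
Lemma vn_mul1r : right_id vn_one vn_mul.
Proof. by move=> x; apply/vn_inj. Qed.
Lemma vn_mulDl : left_distributive vn_mul vn_add.
Proof. by move=> x y z; apply/vn_inj. Qed.
Lemma vn_mulDr : right_distributive vn_mul vn_add.
Proof. by move=> x y z; apply/vn_inj/funext => v; apply: vnaD. Qed.
(** [tau] is 1 at the identity and 0 at 0. *)
Lemma vn_one_neq0 : vn_one != vn_zero.
Proof.
apply/eqP => e; have /eqP := tau_state A.
have -> : id = 0 :> (A -> A) by have := congr1 sval e.
rewrite -(scale0r (id : A -> A)) -[_ *: _]addr0.
have t0 : tau (0 : A -> A) = 0.
  have := tau_linear (-1) (ball_zero_proof A).1 (ball_zero_proof A).1.
  by rewrite scaleN1r addNr mulN1r addNr.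
rewrite tau_linear ?t0 ?addr0 ?mul0r; last 2 first.
- exact: vN_id.
- exact: (ball_zero_proof A).1.
by rewrite eq_sym oner_eq0.
Qed.

HB.instance Definition _ := GRing.Zmodule_isNzRing.Build (vn A)
  vn_mulA vn_mul1l vn_mul1r vn_mulDl vn_mulDr vn_one_neq0.

Lemma vn_scaleA a b x : vn_scale a (vn_scale b x) = vn_scale (a * b) x.
Proof. by apply/vn_inj/scalerA. Qed.
Lemma vn_scale1 : left_id 1 vn_scale.
Proof. by move=> x; apply/vn_inj/scale1r. Qed.
Lemma vn_scaleDr : right_distributive vn_scale +%R.
Proof. by move=> a x y; apply/vn_inj/scalerDr. Qed.
Lemma vn_scaleDl x : {morph vn_scale^~ x : a b / a + b}.
Proof. by move=> a b; apply/vn_inj/scalerDl. Qed.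

HB.instance Definition _ := GRing.Zmodule_isLmodule.Build K[i] (vn A)
  vn_scaleA vn_scale1 vn_scaleDr vn_scaleDl.

Lemma vn_scaleAl (a : K[i]) x y : a *: (x * y) = a *: x * y.
Proof. exact/vn_inj. Qed.
HB.instance Definition _ := GRing.Lmodule_isLalgebra.Build K[i] (vn A) vn_scaleAl.
Lemma vn_scaleAr (a : K[i]) x y : a *: (x * y) = x * (a *: y).
Proof. by apply/vn_inj/funext => v; symmetry; apply: (vnaZ x). Qed.
HB.instance Definition _ := GRing.Lalgebra_isAlgebra.Build K[i] (vn A) vn_scaleAr.

Lemma svalD x y v : sval (x + y) v = sval x v + sval y v. Proof. by []. Qed.
Lemma svalM x y v : sval (x * y) v = sval x (sval y v). Proof. by []. Qed.
Lemma svalZ (a : K[i]) x v : sval (a *: x) v = a *: sval x v. Proof. by []. Qed.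
Lemma sval1 v : sval (1 : vn A) v = v. Proof. by []. Qed.
Lemma sval0 v : sval (0 : vn A) v = 0. Proof. by []. Qed.
Lemma svalN x v : sval (- x) v = - sval x v.
Proof. by rewrite -scaleN1r svalZ scaleN1r. Qed.
Lemma svalB x y v : sval (x - y) v = sval x v - sval y v.
Proof. by rewrite svalD svalN. Qed.
Lemma sval_sum (I : Type) (r : seq I) (P : pred I) (F : I -> vn A) v :
  sval (\sum_(i <- r | P i) F i) v = \sum_(i <- r | P i) sval (F i) v.
Proof. by apply: (big_morph (fun x : vn A => sval x v)). Qed.

Lemma vn_ext x y : (forall v, sval x v = sval y v) -> x = y.
Proof. by move=> xy; apply/vn_inj/funext. Qed.

Lemma adjE x (u v : A) : dot (sval x u) v = dot u (sval (vn_adj x) v).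
Proof. exact: (svalP (cid (adj_exists (svalP x)))).2. Qed.

Lemma adj_uniq x y : adjoint_of (sval x) (sval y) -> vn_adj x = y.
Proof.
move=> xy; apply: vn_ext => v; apply: dot_ext => w.
by rewrite dotC -adjE xy -dotC.
Qed.

Lemma adjK x : vn_adj (vn_adj x) = x.
Proof. by apply: adj_uniq => u v; rewrite dotC -adjE -dotC. Qed.

Lemma adjD x y : vn_adj (x + y) = vn_adj x + vn_adj y.
Proof. by apply: adj_uniq => u v; rewrite !svalD dotDl dotDr !adjE. Qed.

Lemma adjZ (a : K[i]) x : vn_adj (a *: x) = Num.conj a *: vn_adj x.
Proof. by apply: adj_uniq => u v; rewrite !svalZ dotZl dotZr conjCK adjE. Qed.

Lemma adjN x : vn_adj (- x) = - vn_adj x.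
Proof. by rewrite -scaleN1r adjZ rmorphN rmorph1 scaleN1r. Qed.

Lemma adjB x y : vn_adj (x - y) = vn_adj x - vn_adj y.
Proof. by rewrite adjD adjN. Qed.

Lemma adjM x y : vn_adj (x * y) = vn_adj y * vn_adj x.
Proof. by apply: adj_uniq => u v; rewrite !svalM !adjE. Qed.

Lemma adj1 : vn_adj 1 = 1.
Proof. exact: adj_uniq. Qed.

Lemma adj0 : vn_adj 0 = 0.
Proof. by rewrite -(subrr 1) adjB !subrr. Qed.

Lemma adj_sum (I : Type) (r : seq I) (P : pred I) (F : I -> vn A) :
  vn_adj (\sum_(i <- r | P i) F i) = \sum_(i <- r | P i) vn_adj (F i).
Proof. by apply: (big_morph vn_adj); [exact: adjD | exact: adj0]. Qed.

Definition vn_tau x : K[i] := tau (sval x).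

Lemma vn_tau_scalar : scalar vn_tau.
Proof. by move=> a x y; apply: tau_linear; apply: svalP. Qed.

HB.instance Definition _ := GRing.isLinear.Build K[i] (vn A) K[i] _ vn_tau
  vn_tau_scalar.

Lemma vn_tau1 : vn_tau 1 = 1. Proof. exact: tau_state. Qed.

Lemma vn_tauC x y : vn_tau (x * y) = vn_tau (y * x).
Proof. by apply: tau_trace; apply: svalP. Qed.

Definition op_le (c : K) x := forall v, hnorm (sval x v) <= c * hnorm v.

Lemma op_leP (k : nat) x : bounded_by k%:R (sval x) <-> op_le k%:R x.
Proof.
have e v : (`|sval x v| <= k%:R * `|v|) = (hnorm (sval x v) <= k%:R * hnorm v).
  by rewrite !hnormE -(rmorph_nat (real_complex K)) -rmorphM lecR.
by split=> xk v; have := xk v; rewrite e.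
Qed.

Lemma op_leM c d x y : 0 <= c -> op_le c x -> op_le d y -> op_le (c * d) (x * y).
Proof.
move=> c0 xc yd v; rewrite svalM; apply: le_trans (xc _) _.
by rewrite -mulrA; apply: ler_wpM2l.
Qed.

Lemma op_le_adj c x : 0 <= c -> op_le c x -> op_le c (vn_adj x).
Proof.
move=> c0 xc v; have [->|v0] := eqVneq (hnorm (sval (vn_adj x) v)) 0.
  by rewrite mulr_ge0 ?hnorm_ge0.
have {}v0 : 0 < hnorm (sval (vn_adj x) v)
  by rewrite lt_neqAle eq_sym v0 hnorm_ge0.
rewrite -(ler_pM2l v0) -expr2 hnorm_sqr -adjE.
apply: le_trans (Re_le_cabs _) _; apply: le_trans (cabs_dot _ _) _.
by rewrite mulrA ler_wpM2r ?hnorm_ge0 // mulrC.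
Qed.

Lemma op_bounded x : exists2 c, 0 <= c & op_le c x.
Proof.
have [_ [c cP]] := vN_bounded (svalP x); exists (cabs c); first exact: cabs_ge0.
move=> v; rewrite -lecR rmorphM /= -hnormE -cabsE.
apply: le_trans (cP v) _; rewrite -hnormE.
have [->|v0] := eqVneq v 0; first by rewrite normr0 !mulr0.
have nv : 0 < `|v| by rewrite normr_gt0.
(* [c] is given as a complex number only, but [c * |v|] dominates a norm, so [c] is a nonnegative
   real. *)
rewrite ler_pM2r //; apply: real_ler_norm; rewrite realE.
have : 0 <= c * `|v| by apply: le_trans (cP v); rewrite normr_ge0.
by rewrite pmulr_lge0 // => ->.
Qed.

Definition unitary x := x * vn_adj x = 1 /\ vn_adj x * x = 1.

Lemma unitary_adj x : unitary x -> unitary (vn_adj x).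
Proof. by case=> xx x'x; split; rewrite adjK. Qed.

Lemma unitary_op_le x : unitary x -> op_le 1 x.
Proof.
move=> [_ xx] v; rewrite mul1r -(@ler_pXn2r _ 2) ?nnegrE ?hnorm_ge0 //.
by rewrite !hnorm_sqr adjE -svalM xx.
Qed.

End VnRing.

Lemma subrr4 (V : zmodType) (p q r s : V) :
  p - q = (r - s) + ((p - r) - (q - s)).
Proof.
rewrite opprB [s - q]addrC [p - r + _]addrACA [- r + s]addrC -[s - r]opprB.
by rewrite [RHS]addrC subrK.
Qed.

(** No absolute value is taken: the sequences in question are distances or absolute values, for
    which this is convergence to 0. *)
Definition lim_to (K : realType) (d : nat -> K) :=
  forall e, 0 < e -> exists n0 : nat, forall n, (n0 <= n)%N -> d n < e.

Lemma lim_toD (K : realType) (d d' : nat -> K) :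
  lim_to d -> lim_to d' -> lim_to (fun n => d n + d' n).
Proof.
move=> dl dl' e e0; have e2 : 0 < e / 2 by lra.
have [n nP] := dl _ e2; have [m mP] := dl' _ e2.
exists (maxn n m) => i; rewrite geq_max => /andP[ni mi].
by have := nP _ ni; have := mP _ mi; lra.
Qed.

Lemma lim_toM (K : realType) (c : K) (d : nat -> K) : 0 <= c ->
  lim_to d -> lim_to (fun n => c * d n).
Proof.
move=> c0 dl e e0; have c1 : 0 < c + 1 by lra.
have [n nP] := dl _ (divr_gt0 e0 c1); exists n => m /nP.
rewrite ltr_pdivlMr // => dm.
have [d0|d0] := lerP (d m) 0.
  by apply: le_lt_trans e0; rewrite mulr_ge0_le0.
by apply: lt_trans dm; rewrite mulrDr mulr1 mulrC ltrDl.
Qed.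

Lemma lim_to_le (K : realType) (d d' : nat -> K) :
  (forall n, d n <= d' n) -> lim_to d' -> lim_to d.
Proof.
by move=> dd' dl e /dl[n nP]; exists n => m /nP; apply: le_lt_trans.
Qed.

Lemma lim_to_const (K : realType) (c : K) : 0 <= c -> lim_to (fun=> c) -> c = 0.
Proof.
move=> c0 cl; apply/eqP; rewrite eq_le c0 andbT.
apply/ler_addgt0Pr => e /cl[n /(_ _ (leqnn _))]; rewrite add0r; exact: ltW.
Qed.

(** * The 2-norm as a vector norm, and completeness of balls *)

Section VectorState.
Variables (K : realType) (A : tracial_vNa K) (xi : A).
Hypothesis tauE : forall x, @vN K A x -> tau x = dot (x xi) xi.
Implicit Types x y z : vn A.

Definition n2 x : K := norm2 (svalP x).

Lemma vn_tau_dot x y : vn_tau (vn_adj y * x) = dot (sval x xi) (sval y xi).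
Proof. by rewrite /vn_tau tauE ?svalM ?adjE ?adjK //; apply: svalP. Qed.

Lemma n2E x : n2 x = hnorm (sval x xi).
Proof.
rewrite /n2 /norm2 -[tau _]/(vn_tau (vn_adj x * x)) vn_tau_dot dot_hnorm /=.
by rewrite sqrtr_sqr ger0_norm ?hnorm_ge0.
Qed.

Lemma n2_sqr x : n2 x ^+ 2 = complex.Re (vn_tau (vn_adj x * x)).
Proof. by rewrite vn_tau_dot n2E hnorm_sqr. Qed.

Lemma n2_ge0 x : 0 <= n2 x.
Proof. by rewrite n2E hnorm_ge0. Qed.

Lemma n2D x y : n2 (x + y) <= n2 x + n2 y.
Proof. by rewrite !n2E svalD hnormD. Qed.

Lemma n2N x : n2 (- x) = n2 x.
Proof. by rewrite !n2E svalN hnormN. Qed.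

Lemma n2BC x y : n2 (x - y) = n2 (y - x).
Proof. by rewrite -n2N opprB. Qed.

Lemma n2B_tri y x z : n2 (x - z) <= n2 (x - y) + n2 (y - z).
Proof. by rewrite -[x - z](subrKA y) n2D. Qed.

Lemma n2Z (a : K[i]) x : n2 (a *: x) = cabs a * n2 x.
Proof. by rewrite !n2E svalZ hnormZ. Qed.

Lemma n20 : n2 0 = 0.
Proof. by rewrite n2E sval0 hnorm0. Qed.

Lemma n2_sum (I : Type) (r : seq I) (P : pred I) (F : I -> vn A) :
  n2 (\sum_(i <- r | P i) F i) <= \sum_(i <- r | P i) n2 (F i).
Proof.
elim/big_ind2: _ => [|x c y d xc yd|//]; first by rewrite n20.
by apply: le_trans (n2D _ _) (lerD xc yd).
Qed.

Lemma n2_eq0 x : n2 x = 0 -> x = 0.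
Proof.
move=> x0; apply: vn_inj.
apply: (@tau_faithful K A (sval x) (sval (vn_adj x)) (svalP _) (svalP _)).
  by move=> u v; apply: adjE.
rewrite -[LHS]/(vn_tau (vn_adj x * x)) vn_tau_dot dot_hnorm -n2E x0.
by rewrite expr0n.
Qed.

Lemma n2_adj x : n2 (vn_adj x) = n2 x.
Proof.
apply/eqP; rewrite -(@eqrXn2 _ 2) ?n2_ge0 //.
by rewrite !n2_sqr adjK vn_tauC.
Qed.

Lemma n2Ml c x y : op_le c x -> n2 (x * y) <= c * n2 y.
Proof. by move=> xc; rewrite !n2E svalM. Qed.

(* [|x y|_2 = |y^* x^*|_2] because the state is tracial. *)
Lemma n2Mr c x y : 0 <= c -> op_le c y -> n2 (x * y) <= c * n2 x.
Proof.
move=> c0 yc; rewrite -n2_adj adjM -(n2_adj x).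
by apply: n2Ml; apply: op_le_adj.
Qed.

Lemma n2_unitaryl u x : unitary u -> n2 (u * x) = n2 x.
Proof.
move=> uu; apply/eqP; rewrite eq_le; apply/andP; split.
  by have := n2Ml x (unitary_op_le uu); rewrite mul1r.
have := n2Ml (u * x) (unitary_op_le (unitary_adj uu)).
by rewrite mul1r mulrA uu.2 mul1r.
Qed.

Lemma n2_unitaryr u x : unitary u -> n2 (x * u) = n2 x.
Proof.
by move=> uu; rewrite -n2_adj adjM n2_unitaryl ?n2_adj //; apply: unitary_adj.
Qed.

Lemma n21 : n2 1 = 1.
Proof.
apply/eqP; rewrite -(@eqrXn2 _ 2) ?n2_ge0 //.
by rewrite n2_sqr adj1 mulr1 vn_tau1 expr1n.
Qed.

Lemma cabs_tau x : cabs (vn_tau x) <= n2 x.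
Proof.
have := vn_tau_dot x 1; rewrite adj1 mul1r => ->.
by apply: le_trans (cabs_dot _ _) _; rewrite -!n2E n21 mulr1.
Qed.

Hypothesis cyclic : closure [set x xi | x in @vN K A] = setT.

Lemma cyclic_approx (v : A) (e : K) : 0 < e ->
  exists x, hnorm (v - sval x xi) < e.
Proof.
move=> e0; have : closure [set x xi | x in @vN K A] v by rewrite cyclic.
move=> /(_ (ball v e%:C)) [|_ [[x Mx <-]]].
  by apply: nbhsx_ballx; rewrite ltcR.
rewrite -ball_normE /= => h; exists (exist _ _ Mx).
by rewrite -ltcR -hnormE.
Qed.

(** Right multiplication by [a] is bounded for the 2-norm because of the trace, so [u n] converges
    on every vector [a xi]; as these are dense and the [u n] are uniformly bounded, they converge
    strongly. The limit commutes with the commutant and thus lies in the algebra. *)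
Lemma ball_complete (u : nat -> vn A) (c : K) : 0 <= c ->
  (forall n, op_le c (u n)) ->
  (forall e, 0 < e -> exists n0 : nat, forall m n,
     (n0 <= m)%N -> (n0 <= n)%N -> n2 (u m - u n) < e) ->
  exists2 x, op_le c x & lim_to (fun n => n2 (u n - x)).
Proof.
move=> c0 uc cu.
have [f fP] : exists f : A -> A, forall v, lim_to (fun n =>
  hnorm (sval (u n) v - f v)).
  suff fv v : exists w : A, lim_to (fun n => hnorm (sval (u n) v - w)).
    by have [f fP] := choice fv; exists f.
  apply: hnorm_complete => e e0.
  have e1 : 0 < e / (4 * (c + 1)) by rewrite divr_gt0 //; lra.
  have [a aP] := cyclic_approx v e1.
  have [d d0 ad] := op_bounded a.
  have e2 : 0 < e / (2 * (d + 1)) by rewrite divr_gt0 //; lra.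
  have [n0 n0P] := cu _ e2; exists n0 => m n mn nn.
  have {n0P} := n0P m n mn nn; rewrite ltr_pdivlMr; last by lra.
  move=> mnP.
  have {}aP : c * hnorm (v - sval a xi) <= e / 4.
    have : hnorm (v - sval a xi) * (4 * (c + 1)) < e
      by rewrite -ltr_pdivlMr //; lra.
    by have := hnorm_ge0 (v - sval a xi); lra.
  (* On [a xi] the 2-norm estimate applies, on [v - a xi] the uniform bound [c]. *)
  have -> : sval (u m) v - sval (u n) v = sval (u m - u n) (sval a xi)
     + (sval (u m) (v - sval a xi) - sval (u n) (v - sval a xi)).
    by rewrite svalB !vnaB; apply: subrr4.
  have h1 := uc m (v - sval a xi); have h2 := uc n (v - sval a xi).
  have h3 := n2Mr (u m - u n) d0 ad; rewrite n2E svalM in h3.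
  have := hnormD (sval (u m - u n) (sval a xi)) (sval (u m) (v - sval a xi) -
    sval (u n) (v - sval a xi)).
  have := hnormD (sval (u m) (v - sval a xi)) (- sval (u n) (v - sval a xi)).
  rewrite hnormN; have := n2_ge0 (u m - u n); nra.
have fu v w : lim_to (fun n => hnorm (sval (u n) v - w)) -> f v = w.
  by apply: hnorm_lim_unique (fP v).
have flin : linear f.
  move=> a v w; apply: fu.
  have := lim_toD (lim_toM (cabs_ge0 a) (fP v)) (fP w).
  apply: lim_to_le => n; rewrite vn_linearP -hnormZ.
  apply: le_trans (hnormD _ _); rewrite scalerBr opprD addrACA. exact: lexx.
have fc v : hnorm (f v) <= c * hnorm v.
  apply/ler_addgt0Pr => e e0; have [n /(_ _ (leqnn _)) nP] := fP v e e0.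
  have := uc n v; have := hnormD (f v - sval (u n) v) (sval (u n) v).
  by rewrite subrK hnormBC; lra.
have fb : bounded_op f.
  split=> //; exists c%:C => v.
  by rewrite !hnormE -rmorphM lecR.
have Mf : vN f.
  rewrite -vN_bicommutant; split=> // y [yb yM].
  apply/funext => v /=; apply: fu.
  have [ylin [d yd]] := yb.
  have yB (a b : A) : y a - y b = y (a - b).
    by have := ylin (-1) b a;
      rewrite !scaleN1r [- b + a]addrC [- y b + _]addrC => <-.
  have yd' w : hnorm (y w) <= cabs d * hnorm w.
    rewrite -lecR rmorphM /= -hnormE -cabsE.
    apply: le_trans (yd w) _; rewrite -hnormE.
    have [->|w0] := eqVneq w 0; first by rewrite normr0 !mulr0.
    have nw : 0 < `|w| by rewrite normr_gt0.
    rewrite ler_pM2r //; apply: real_ler_norm; rewrite realE.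
    have : 0 <= d * `|w| by apply: le_trans (yd w); rewrite normr_ge0.
    by rewrite pmulr_lge0 // => ->.
  apply: lim_to_le (lim_toM (cabs_ge0 d) (fP v)) => n.
  have -> : sval (u n) (y v) = y (sval (u n) v).
    by have /(congr1 (fun g => g v)) /= := yM _ (svalP (u n)).
  by rewrite yB.
exists (exist _ f Mf) => //.
by apply: lim_to_le (fP xi) => n; rewrite n2E svalB.
Qed.

End VectorState.

(** * The sorts of the structure inside the algebra *)

Section BallStructure.
Variables (K : realType) (A : tracial_vNa K).
Local Notation M := (structure_of A).

Definition vn_of k (x : M k) : vn A := exist _ (sval x) (svalP x).1.

Lemma vn_of_op k (x : M k) : op_le (radius k)%:R (vn_of x).
Proof. by apply/op_leP; exact: (svalP x).2. Qed.

Lemma vn_of_inj k : injective (@vn_of k).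
Proof.
case=> [x px] [y py] /(congr1 sval) /= xy; subst y; congr exist.
exact: Prop_irrelevance.
Qed.

Definition ball_of k (x : vn A) (xk : op_le (radius k)%:R x) : M k :=
  exist _ (sval x) (conj (svalP x) (proj2 (op_leP (radius k) x) xk)).

Lemma vn_of_ball k x (xk : op_le (radius k)%:R x) : vn_of (ball_of xk) = x.
Proof. exact: vn_inj. Qed.

(** [norm2] depends on a proof of membership in [vN]; proof irrelevance identifies the two that
    occur here. *)
Lemma sdistE k (x y : M k) : sdist M x y = n2 (vn_of x - vn_of y).
Proof.
rewrite /n2; set z := vn_of x - vn_of y.
have e : sval x - sval y = sval z.
  by apply/funext => v; rewrite svalB.
have irr (f g : A -> A) (Mf : vN f) (Mg : vN g) : f = g -> norm2 Mf = norm2 Mg.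
  by move=> fg; subst g; congr norm2; apply: Prop_irrelevance.
exact: irr.
Qed.

Lemma vn_of_zero : vn_of (szero M) = 0. Proof. exact: vn_inj. Qed.
Lemma vn_of_one : vn_of (sone M) = 1. Proof. exact: vn_inj. Qed.
Lemma vn_of_add k l (x : M k) (y : M l) :
  vn_of (sadd M x y) = vn_of x + vn_of y.
Proof. exact: vn_inj. Qed.
Lemma vn_of_mul k l (x : M k) (y : M l) :
  vn_of (smul M x y) = vn_of x * vn_of y.
Proof. exact: vn_inj. Qed.
Lemma vn_of_adj k (x : M k) : vn_of (sadj M x) = vn_adj (vn_of x).
Proof.
by symmetry; apply: adj_uniq; exact: (svalP (cid (adj_exists (svalP x).1))).2.
Qed.
Lemma vn_of_scal q k m (h : scal_dom q k m) (x : M k) :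
  vn_of (sscal M q h x) = gaussC K q *: vn_of x.
Proof. exact: vn_inj. Qed.
Lemma vn_of_incl k l (h : (radius k <= radius l)%N) (x : M k) :
  vn_of (sincl M h x) = vn_of x.
Proof. exact: vn_inj. Qed.
Lemma sretrE k (x : M k) : sretr M x = complex.Re (vn_tau (vn_of x)).
Proof. by []. Qed.
Lemma simtrE k (x : M k) : simtr M x = complex.Im (vn_tau (vn_of x)).
Proof. by []. Qed.

Definition vn_ofE := (vn_of_zero, vn_of_one, vn_of_add, vn_of_mul, vn_of_adj,
  vn_of_scal, vn_of_incl).

Variable xi : A.
Hypothesis tauE : forall x, @vN K A x -> tau x = dot (x xi) xi.
Hypothesis cyclic : closure [set x xi | x in @vN K A] = setT.

Lemma cabs_gaussC q : cabs (gaussC K q) = Num.sqrt (ratr (gauss_norm2 q)).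
Proof.
by rewrite /cabs normc_def /= /gauss_norm2 rmorphD /= !rmorphXn.
Qed.

Lemma n2_op_le c (x : vn A) : op_le c x -> n2 x <= c.
Proof.
by move=> xc; have := n2Ml tauE 1 xc; rewrite (n21 tauE) !mulr1.
Qed.

Lemma structure_of_is_structure : is_structure M.
Proof.
have rad0 k : (0 : K) <= (radius k)%:R by apply: ler0n.
have tB (T U : vn A) : vn_tau (T - U) = vn_tau T - vn_tau U by rewrite raddfB.
split.
- move=> k x y; rewrite sdistE; split=> [/(n2_eq0 tauE)/eqP|->].
    by rewrite subr_eq0 => /eqP/vn_of_inj.
  by rewrite subrr (n20 tauE).
- by move=> k x y; rewrite !sdistE (n2BC tauE).
- by move=> k x y z; rewrite !sdistE (n2B_tri tauE).
- move=> k x y; rewrite sdistE; apply: le_trans (n2D tauE _ _) _.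
  rewrite (n2N tauE) mulr_natl mulr2n; apply: lerD; apply: n2_op_le;
    exact: vn_of_op.
- move=> k u cu.
  have [e e0|x xk xl] := ball_complete tauE cyclic (rad0 k)
      (fun n => vn_of_op (u n)).
    by have [n0 nP] := cu e e0; exists n0 => m n mn nn; rewrite -sdistE;
      apply: nP.
  exists (ball_of xk) => e /xl[n0 nP]; exists n0 => n /nP.
  by rewrite sdistE vn_of_ball.
- move=> k l x x' y y'; rewrite !sdistE !vn_ofE opprD addrACA.
  exact: (n2D tauE).
- move=> k l x x' y y'; rewrite !sdistE !vn_ofE.
  have -> : vn_of x * vn_of y - vn_of x' * vn_of y' =
    (vn_of x - vn_of x') * vn_of y + vn_of x' * (vn_of y - vn_of y').
    by rewrite mulrBl mulrBr addrA subrK.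
  apply: le_trans (n2D tauE _ _) _; apply: lerD.
    exact: (n2Mr tauE _ (rad0 l) (vn_of_op y)).
  exact: (n2Ml tauE _ (vn_of_op x')).
- by move=> k x x'; rewrite !sdistE !vn_ofE -adjB (n2_adj tauE).
- move=> q k m h x x'.
  by rewrite !sdistE !vn_ofE -scalerBr (n2Z tauE) cabs_gaussC.
- by move=> k l h x x'; rewrite !sdistE !vn_ofE.
- move=> k x; rewrite sretrE; apply: le_trans (normr_Re_le _) _.
  by apply: le_trans (cabs_tau tauE _) (n2_op_le (vn_of_op x)).
- move=> k x; rewrite simtrE; apply: le_trans (normr_Im_le _) _.
  by apply: le_trans (cabs_tau tauE _) (n2_op_le (vn_of_op x)).
- move=> k x x'; rewrite !sretrE sdistE -raddfB -tB.
  by apply: le_trans (normr_Re_le _) (cabs_tau tauE _).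
- move=> k x x'; rewrite !simtrE sdistE -raddfB -tB.
  by apply: le_trans (normr_Im_le _) (cabs_tau tauE _).
Qed.

End BallStructure.

(** * Matrix algebras and conditional expectations *)

Lemma sum_ord2 (V : nmodType) (F : 'I_2 -> V) : \sum_i F i = F 0 + F 1.
Proof.
rewrite !big_ord_recl big_ord0 addr0; congr (_ + F _); exact: val_inj.
Qed.

Definition is_mxrep (K : realType) (A : tracial_vNa K) n
    (phi : 'M[K[i]]_n -> vn A) :=
  [/\ forall a X Y, phi (a *: X + Y) = a *: phi X + phi Y,
      phi 1%:M = 1,
      forall X Y, phi (X *m Y) = phi X * phi Y &
      forall X, phi (X ^t*) = vn_adj (phi X)].

Section MxRep.
Variables (K : realType) (A : tracial_vNa K) (n : nat).
Variables (phi : 'M[K[i]]_n -> vn A) (phiP : is_mxrep phi).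
Implicit Types X Y : 'M[K[i]]_n.

Lemma mxrepD X Y : phi (X + Y) = phi X + phi Y.
Proof. by case: phiP => h _ _ _; rewrite -{1}[X]scale1r h scale1r. Qed.
Lemma mxrep0 : phi 0 = 0.
Proof. by apply: (addrI (phi 0)); rewrite -mxrepD !addr0. Qed.
Lemma mxrepZ a X : phi (a *: X) = a *: phi X.
Proof. by case: phiP => h _ _ _; rewrite -{1}[a *: X]addr0 h mxrep0 addr0. Qed.
Lemma mxrepN X : phi (- X) = - phi X.
Proof. by rewrite -scaleN1r mxrepZ scaleN1r. Qed.
Lemma mxrepB X Y : phi (X - Y) = phi X - phi Y.
Proof. by rewrite mxrepD mxrepN. Qed.
Lemma mxrep_sum (I : Type) (r : seq I) (P : pred I) (F : I -> 'M[K[i]]_n) :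
  phi (\sum_(i <- r | P i) F i) = \sum_(i <- r | P i) phi (F i).
Proof. by apply: (big_morph phi); [exact: mxrepD | exact: mxrep0]. Qed.
Lemma mxrep1 : phi 1%:M = 1. Proof. by case: phiP. Qed.
Lemma mxrep_scalar a : phi a%:M = a *: 1.
Proof. by rewrite -scalemx1 mxrepZ mxrep1. Qed.
Lemma mxrepM X Y : phi (X *m Y) = phi X * phi Y. Proof. by case: phiP. Qed.
Lemma mxrep_adj X : phi (X ^t*) = vn_adj (phi X). Proof. by case: phiP. Qed.

Lemma mxrep_delta X :
  phi X = \sum_i \sum_j X i j *: phi (delta_mx i j).
Proof.
rewrite {1}[X]matrix_sum_delta mxrep_sum; apply: eq_bigr => i _.
by rewrite mxrep_sum; apply: eq_bigr => j _; rewrite mxrepZ.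
Qed.

Lemma mxrep_deltaM i j k l :
  phi (delta_mx i j) * phi (delta_mx k l) = phi (delta_mx i l) *+ (j == k).
Proof.
by rewrite -mxrepM mul_delta_mx_cond; case: eqP; rewrite ?mulr1n ?mulr0n ?mxrep0.
Qed.

Lemma mxrep_delta_adj i j :
  vn_adj (phi (delta_mx i j)) = phi (delta_mx j i).
Proof. by rewrite -mxrep_adj trmx_delta map_delta_mx. Qed.

(* [M_n] has only one tracial state. *)
Lemma mxrep_tau_delta i j :
  vn_tau (phi (delta_mx i j)) = (i == j)%:R / n%:R.
Proof.
have e k : vn_tau (phi (delta_mx i j)) = (i == j)%:R * vn_tau (phi (delta_mx k
  k)).
  have -> : phi (delta_mx i j) = phi (delta_mx i k) * phi (delta_mx k j).
    by rewrite mxrep_deltaM eqxx.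
  rewrite vn_tauC mxrep_deltaM eq_sym; case: eqP => _.
    by rewrite mul1r.
  by rewrite mulr0n raddf0 mul0r.
have n0 : n%:R != 0 :> K[i]
  by rewrite pnatr_eq0 -lt0n (leq_ltn_trans _ (ltn_ord i)).
apply: (mulIf n0); rewrite divfK //.
have : \sum_k vn_tau (phi (delta_mx k k)) = 1.
  rewrite -raddf_sum /= -mxrep_sum -(vn_tau1 A) -mxrep1; congr (vn_tau (phi _)).
  by rewrite mx1_sum_delta.
move=> t1; rewrite mulr_natr -[X in _ *+ X]card_ord -sumr_const.
by rewrite (eq_bigr _ (fun k _ => e k)) -mulr_sumr t1 mulr1.
Qed.

Lemma mxrep_tau X : vn_tau (phi X) = \tr X / n%:R.
Proof.
rewrite mxrep_delta raddf_sum /= mulr_suml; apply: eq_bigr => i _.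
rewrite raddf_sum (bigD1 i) //= linearZ /= mxrep_tau_delta eqxx mul1r.
rewrite big1 ?addr0 // => j ji.
by rewrite linearZ /= mxrep_tau_delta eq_sym (negPf ji) mul0r mulr0.
Qed.

End MxRep.

Section Double.
Variables (K : realType) (A : tracial_vNa K) (n : nat).
Variables (f : 'M[K[i]]_n -> vn A) (g : 'M[K[i]]_2 -> vn A).
Hypotheses (fP : is_mxrep f) (gP : is_mxrep g).
Hypothesis fgC : forall X a, f X * g a = g a * f X.

(** The representation [f] tensor [g] of M_n tensor M_2: the position of a block in [X] gives the
    matrix unit of M_2. *)
Definition double_mxrep (X : 'M[K[i]]_(n + n)) : vn A :=
  f (ulsubmx X) * g (delta_mx 0 0) + f (ursubmx X) * g (delta_mx 0 1)
  + (f (dlsubmx X) * g (delta_mx 1 0) + f (drsubmx X) * g (delta_mx 1 1)).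

Lemma double_mxrep_block a b c d : double_mxrep (block_mx a b c d) =
  f a * g (delta_mx 0 0) + f b * g (delta_mx 0 1)
  + (f c * g (delta_mx 1 0) + f d * g (delta_mx 1 1)).
Proof. by rewrite /double_mxrep block_mxKul block_mxKur block_mxKdl
  block_mxKdr. Qed.

Lemma mxrep_double : is_mxrep double_mxrep.
Proof.
split.
- move=> a X Y; rewrite -(submxK X) -(submxK Y) scale_block_mx add_block_mx.
  rewrite !double_mxrep_block; case: fP => lin _ _ _.
  rewrite !lin !mulrDl -!scalerAl !scalerDr.
  by rewrite [RHS]addrACA; congr (_ + _); rewrite addrACA.
- rewrite (scalar_mx_block _ _ 1) double_mxrep_block (mxrep1 fP) (mxrep0 fP).
  rewrite !mul0r !mul1r addr0 add0r -(mxrepD gP) -(mxrep1 gP); congr (g _).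
  by rewrite mx1_sum_delta sum_ord2.
- move=> X Y; rewrite -(submxK X) -(submxK Y) mulmx_block !double_mxrep_block.
  have e (Z W : 'M[K[i]]_n) i j k m :
     f Z * g (delta_mx i j) * (f W * g (delta_mx k m)) =
     f (Z *m W) * g (delta_mx i m) *+ (j == k).
    rewrite mulrA -(mulrA (f Z)) -fgC mulrA -(mxrepM fP) -mulrA.
    by rewrite (mxrep_deltaM gP) mulrnAr.
  have o01 : (0 == 1 :> 'I_2) = false by [].
  have o10 : (1 == 0 :> 'I_2) = false by [].
  rewrite !mulrDl !mulrDr !e !eqxx o01 o10 !mulr1n !mulr0n !addr0 !add0r.
  rewrite !(mxrepD fP) !mulrDl.
  by congr (_ + _); rewrite addrACA.
- move=> X; rewrite -(submxK X) tr_block_mx map_block_mx !double_mxrep_block.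
  rewrite !adjD !adjM -!(mxrep_adj fP) !(mxrep_delta_adj gP) !fgC.
  by rewrite [LHS]addrACA.
Qed.

End Double.

(** * The tower of matrix algebras *)

Section Tower.
Variables (K : realType) (A : tracial_vNa K) (pi : nat -> 'M[K[i]]_2 -> (A -> A)).
Hypothesis piP : forall n, unital_star_hom (pi n).
Hypothesis piC : forall m n a b, m != n -> pi m a \o pi n b = pi n b \o pi m a.
Hypothesis vN_gen :
  @vN K A = commutant (commutant [set x | exists n a, x = pi n a]).

Lemma vN_pi n a : vN (pi n a).
Proof.
rewrite vN_gen; split; first by case: (piP n).
by move=> y [_ yc]; rewrite yc //; exists n, a.
Qed.

Definition piv n a : vn A := exist _ (pi n a) (vN_pi n a).

Lemma piv_mxrep n : is_mxrep (piv n).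
Proof.
case: (piP n) => _ lin e1 mul adj; split.
- by move=> a X Y; apply: vn_inj => /=; rewrite lin.
- exact: vn_inj.
- by move=> X Y; apply: vn_inj; rewrite /= -mul.
- by move=> X; symmetry; apply: adj_uniq; apply: adj.
Qed.

Lemma pivC m n a b : m != n -> piv m a * piv n b = piv n b * piv m a.
Proof. by move=> mn; apply: vn_inj; apply: piC. Qed.

(** This is 2^l, written so that ['M_(dim l.+1)] is by computation a type of 2 by 2 block
    matrices. *)
Fixpoint dim l := if l is l'.+1 then (dim l' + dim l')%N else 1%N.

Lemma dim_gt0 l : (0 < dim l)%N.
Proof. by elim: l => //= l IH; rewrite addn_gt0 IH. Qed.

Local Notation C := K[i].

Fixpoint mrep l : 'M[C]_(dim l) -> vn A :=
  match l return 'M[C]_(dim l) -> vn A with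
  | 0%N => fun X => X 0 0 *: 1
  | l'.+1 => double_mxrep (@mrep l') (piv l')
  end.
Arguments mrep : clear implicits.

Lemma mrepC l k X a : (l <= k)%N -> mrep l X * piv k a = piv k a * mrep l X.
Proof.
elim: l k X a => [|l IH] k X a lk.
  by rewrite /= -scalerAl mul1r -scalerAr mulr1.
rewrite /= /double_mxrep !mulrDl !mulrDr.
have e (Y : 'M[C]_(dim l)) b :
    mrep l Y * piv l b * piv k a = piv k a * (mrep l Y * piv l b).
  by rewrite -mulrA pivC ?(ltn_eqF lk) // mulrA IH ?mulrA // ltnW.
by rewrite !e.
Qed.

Lemma mrep_mxrep l : is_mxrep (mrep l).
Proof.
elim: l => [|l IH].
  split=> [a X Y||X Y|X] /=.
  - by rewrite !mxE scalerDl scalerA.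
  - by rewrite !mxE scale1r.
  - by rewrite mxE big_ord1 -scalerAl mul1r scalerA.
  - by rewrite !mxE adjZ adj1.
by apply: mxrep_double => //; [exact: piv_mxrep | move=> X a; apply: mrepC].
Qed.

(** The inclusion of levels is X |-> X tensor 1, a block diagonal matrix. *)
Lemma mrep_nest l (X : 'M[C]_(dim l)) :
  exists Y, mrep l.+1 Y = mrep l X.
Proof.
exists (block_mx X 0 0 X); have P := piv_mxrep l; have IH := mrep_mxrep l.
rewrite /= double_mxrep_block (mxrep0 IH) !mul0r addr0 add0r -mulrDr -(mxrepD P).
rewrite -[RHS]mulr1 -(mxrep1 P); congr (_ * piv l _); rewrite mx1_sum_delta.
by rewrite sum_ord2.
Qed.

Lemma mrep_nestW l m (X : 'M[C]_(dim l)) : (l <= m)%N ->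
  exists Y, mrep m Y = mrep l X.
Proof.
elim: m => [|m IH]; first by case: l X => // X _; exists X.
rewrite leq_eqVlt => /orP[/eqP lm|/IH[Y <-]]; last exact: mrep_nest.
by subst l; exists X.
Qed.

Lemma mrep_piv l k a : (k < l)%N -> exists Y, mrep l Y = piv k a.
Proof.
move=> kl; suff [Y <-] : exists Y, mrep k.+1 Y = piv k a by apply: mrep_nestW.
have P := piv_mxrep k; have IH := mrep_mxrep k.
(* This is 1 tensor [a]: the blocks are scalar matrices. *)
exists (block_mx (a 0 0)%:M (a 0 1)%:M (a 1 0)%:M (a 1 1)%:M).
rewrite /= double_mxrep_block !(mxrep_scalar IH) -!scalerAl !mul1r.
by rewrite [RHS](mxrep_delta P) !sum_ord2.
Qed.

End Tower.
Arguments mrep {K A pi} piP vN_gen l X.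

(** * Spectral theorem, square roots and polar decomposition of matrices *)

Section ComplexMatrix.
Variables (C : numClosedFieldType) (n : nat).
Implicit Types X Y P Q W H : 'M[C]_n.

(** The squared Hilbert-Schmidt norm, not normalized; dividing it by [n] gives the squared 2-norm in
    a representation. *)
Definition hs X : C := \tr (X ^t* *m X).

Lemma adjmx_delta i j : (delta_mx i j : 'M[C]_n) ^t* = delta_mx j i.
Proof. by rewrite trmx_delta map_delta_mx. Qed.

Lemma mxtrace_delta_mul i j Y : \tr (delta_mx i j *m Y) = Y j i.
Proof.
rewrite mxtrace_mulC /mxtrace (bigD1 j) //= mxE (bigD1 i) //= !mxE !eqxx mulr1.
rewrite !big1 ?addr0 // => k ki.
  by rewrite mxE big1 // => l _; rewrite mxE (negPf ki) andbF mulr0.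
by rewrite mxE (negPf ki) mulr0.
Qed.

(** Writes an eigenvalue as a quantity whose sign can be read off from vectors of the Hilbert
    space. *)
Lemma tr_conj_diag (P : 'M[C]_n) (d : 'rV[C]_n) i : P \is unitarymx ->
  let Z := P ^t* *m delta_mx i i in
  \tr (Z ^t* *m (P ^t* *m diag_mx d *m P) *m Z) = d 0 i.
Proof.
move=> /unitarymxP PP Z; rewrite /Z trmx_mul map_mxM adjmx_delta trmxCK.
rewrite !mulmxA -(mulmxA _ P (P ^t*)) PP mulmx1 -(mulmxA _ P (P ^t*)) PP mulmx1.
rewrite mxtrace_mulC !mulmxA mul_delta_mx mxtrace_delta_mul !mxE eqxx.
by rewrite mulr1n.
Qed.

Lemma hermitian_diagE (X : 'M[C]_n) : X ^t* = X ->
  exists P : 'M[C]_n, exists2 d : 'rV[C]_n, P \is unitarymx &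
    X = P ^t* *m diag_mx d *m P /\ forall i, d 0 i \is Num.real.
Proof.
move=> XX; have hX : X \is hermsymmx.
  by apply/is_hermitianmxP; rewrite expr0 scale1r XX.
exists (spectralmx X), (spectral_diag X); first exact: spectral_unitarymx.
split; last by move=> i; have /mxOverP := hermitian_spectral_diag_real hX; exact.
by rewrite -invmx_unitary ?spectral_unitarymx //;
  apply/orthomx_spectralP/hermitian_normalmx.
Qed.

Lemma adjmxM X Y : (X *m Y) ^t* = Y ^t* *m X ^t*.
Proof. by rewrite trmx_mul map_mxM. Qed.

Lemma adjmx_diag (d : 'rV[C]_n) : (forall i, d 0 i \is Num.real) ->
  (diag_mx d) ^t* = diag_mx d.
Proof.
move=> dr; rewrite tr_diag_mx map_diag_mx; congr diag_mx.
by apply/rowP => i; rewrite mxE; apply: CrealP.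
Qed.

Lemma unitarymxK P : P \is unitarymx -> P ^t* *m P = 1%:M.
Proof. by move=> /[dup] /unitarymx_unit u /invmx_unitary <-; rewrite mulVmx. Qed.

Lemma hs_unitaryl P X : P \is unitarymx -> hs (P *m X) = hs X.
Proof.
by move=> Pu; rewrite /hs adjmxM -mulmxA (mulmxA (P ^t*)) unitarymxK // mul1mx.
Qed.

Lemma hs_unitaryr P X : P \is unitarymx -> hs (X *m P) = hs X.
Proof.
move=> /unitarymxP Pu; rewrite /hs adjmxM mxtrace_mulC !mulmxA.
by rewrite -(mulmxA X) Pu mulmx1 mxtrace_mulC.
Qed.

Lemma hs_diag (d : 'rV[C]_n) : hs (diag_mx d) = \sum_i `|d 0 i| ^+ 2.
Proof.
rewrite /hs tr_diag_mx map_diag_mx mulmx_diag mxtrace_diag.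
by apply: eq_bigr => i _; rewrite !mxE mulrC -normCK.
Qed.

Lemma mulmx_unitary3 P X Y : P \is unitarymx ->
  (P ^t* *m X *m P) *m (P ^t* *m Y *m P) = P ^t* *m (X *m Y) *m P.
Proof.
move=> /unitarymxP Pu; rewrite !mulmxA -(mulmxA (P ^t* *m X)) Pu mulmx1.
by [].
Qed.

Lemma hs_conj P X : P \is unitarymx -> hs (P ^t* *m X *m P) = hs X.
Proof. by move=> Pu; rewrite hs_unitaryr // hs_unitaryl ?trmxC_unitary. Qed.

Lemma diag_mxB (d e : 'rV[C]_n) : diag_mx d - diag_mx e = diag_mx (d - e).
Proof. by rewrite linearB. Qed.

Lemma diag_mx_const1 : 1%:M = diag_mx (const_mx 1) :> 'M[C]_n.
Proof. by rewrite diag_const_mx. Qed.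

Lemma mulmx_diagE (d e : 'rV[C]_n) :
  diag_mx d *m diag_mx e = diag_mx (\row_i (d 0 i * e 0 i)).
Proof. exact: mulmx_diag. Qed.

Lemma unitarymx_conj1 P : P \is unitarymx -> P ^t* *m 1%:M *m P = 1%:M.
Proof. by move=> Pu; rewrite mulmx1 unitarymxK. Qed.

Lemma diag_of_conj P (d : 'rV[C]_n) i : P \is unitarymx ->
  (P *m (P ^t* *m diag_mx d *m P) *m P ^t*) i i = d 0 i.
Proof.
move=> /unitarymxP Pu; rewrite !mulmxA Pu mul1mx -mulmxA Pu mulmx1.
by rewrite !mxE eqxx mulr1n.
Qed.

Lemma gram_diag_ge0 X i : 0 <= (X *m X ^t*) i i.
Proof.
by rewrite mxE sumr_ge0 // => j _; rewrite !mxE -normCK exprn_ge0.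
Qed.

Lemma conj_diagM P (d e : 'rV[C]_n) : P \is unitarymx ->
  (P ^t* *m diag_mx d *m P) *m (P ^t* *m diag_mx e *m P) =
  P ^t* *m diag_mx (\row_i (d 0 i * e 0 i)) *m P.
Proof. by move=> Pu; rewrite mulmx_unitary3 // mulmx_diagE. Qed.

Lemma conj_diag1 P (d : 'rV[C]_n) : P \is unitarymx -> (forall i, d 0 i = 1) ->
  P ^t* *m diag_mx d *m P = 1%:M.
Proof.
move=> Pu d1; have -> : d = const_mx 1 by apply/rowP => i; rewrite d1 mxE.
by rewrite -diag_mx_const1 unitarymx_conj1.
Qed.

Lemma conj_diag_adj P (d : 'rV[C]_n) : (forall i, d 0 i \is Num.real) ->
  (P ^t* *m diag_mx d *m P) ^t* = P ^t* *m diag_mx d *m P.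
Proof. by move=> dr; rewrite !adjmxM trmxCK adjmx_diag // mulmxA. Qed.

Lemma hs_conj_diagB P (d e : 'rV[C]_n) : P \is unitarymx ->
  hs (P ^t* *m diag_mx d *m P - P ^t* *m diag_mx e *m P) =
  \sum_i `|d 0 i - e 0 i| ^+ 2.
Proof.
move=> Pu; rewrite -mulmxBl -mulmxBr hs_conj // diag_mxB hs_diag.
by apply: eq_bigr => i _; rewrite !mxE.
Qed.

(** The root is taken in an eigenbasis. For an eigenvalue s^2 with s > 0 one has |s - 1| <= |s - 1|
    (s + 1) = |s^2 - 1|, so [S] is at least as close to 1 as [H]; invertibility of [H] provides the
    inverse [S'] of [S]. *)
Lemma sqrt_unit H : H ^t* = H -> (forall P i, 0 <= (P *m H *m P ^t*) i i) ->
  H \in unitmx -> exists S S',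
  [/\ S *m S = H, S' *m S = 1%:M, S' ^t* = S' & hs (S - 1%:M) <= hs (H - 1%:M)].
Proof.
move=> HH Hpos Hu; have [P [d Pu [HE dr]]] := hermitian_diagE HH.
have d0 i : 0 < d 0 i.
  rewrite lt_neqAle; apply/andP; split; last first.
    by rewrite -(diag_of_conj d i Pu) -HE.
  rewrite eq_sym; apply/negP => /eqP di0.
  move: Hu; rewrite HE unitmxE !det_mulmx det_diag (bigD1 i) //= di0 mul0r.
  by rewrite mulr0 mul0r unitr0.
pose s i := sqrtC (d 0 i).
have s0 i : 0 < s i by rewrite sqrtC_gt0.
have ss i : s i * s i = d 0 i by rewrite -expr2 sqrtCK.
exists (P ^t* *m diag_mx (\row_i s i) *m P).
exists (P ^t* *m diag_mx (\row_i (s i)^-1) *m P); split.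
- rewrite conj_diagM // HE.
  by congr (_ *m diag_mx _ *m _); apply/rowP => i; rewrite !mxE ss.
- rewrite conj_diagM //; apply: conj_diag1 => // i.
  by rewrite !mxE mulVf // lt0r_neq0.
- by apply: conj_diag_adj => i; rewrite mxE realE invr_ge0 (ltW (s0 i)).
rewrite HE -(@conj_diag1 P (const_mx 1)) // => [|i]; last by rewrite mxE.
rewrite !hs_conj_diagB //.
apply: ler_sum => i _; rewrite !mxE ler_pXn2r ?nnegrE //.
have -> : d 0 i - 1 = (s i - 1) * (s i + 1) by rewrite -ss; ring.
rewrite normrM -[leLHS]mulr1 ler_wpM2l //.
by rewrite ger0_norm ?addr_ge0 ?ltW // ltrDr.
Qed.

(** Take U = X |X|^-1. Then X - U = U (|X| - 1) has the Hilbert-Schmidt norm of |X| - 1, and |X| is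
    at least as close to 1 as its square. *)
Lemma polar_unit X : X \in unitmx ->
  exists2 U, U \is unitarymx & hs (X - U) <= hs (X ^t* *m X - 1%:M).
Proof.
move=> Xu; have [||| S [S' [SSH S'S S'H hsS]]] := @sqrt_unit (X ^t* *m X).
- by rewrite adjmxM trmxCK.
- move=> P i; have -> : P *m (X ^t* *m X) *m P ^t* = (P *m X ^t*) *m (P *m X
  ^t*) ^t*.
    by rewrite adjmxM trmxCK !mulmxA.
  exact: gram_diag_ge0.
- by rewrite unitmx_mul map_unitmx unitmx_tr Xu.
have SS' : S *m S' = 1%:M by apply: mulmx1C.
have Uu : X *m S' \is unitarymx.
  apply/unitarymxP; apply: mulmx1C;
    rewrite adjmxM S'H -mulmxA (mulmxA (X ^t*)) -SSH.
  by rewrite mulmxA mulmxA S'S mul1mx.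
exists (X *m S') => //.
have -> : X - X *m S' = X *m S' *m (S - 1%:M).
  by rewrite mulmxBr mulmx1 -mulmxA S'S mulmx1.
by rewrite hs_unitaryl.
Qed.

Lemma unitarymx_perm (s : 'S_n) : perm_mx s \is @unitarymx C n n.
Proof.
by apply/unitarymxP; rewrite tr_perm_mx map_perm_mx -perm_mxM mulgV perm_mx1.
Qed.

Lemma trace_conj_diag P (d : 'rV[C]_n) : P \is unitarymx ->
  \tr (P ^t* *m diag_mx d *m P) = \sum_i d 0 i.
Proof.
move=> Pu; rewrite -mulmxA mxtrace_mulC -mulmxA (unitarymxP Pu) mulmx1.
exact: mxtrace_diag.
Qed.

(** [d] and [e] are the eigenvalues of [X] and [Q], and [W] sends an eigenbasis of [X], reordered by
    [s], to one of [Q]. The ordering is left free, to be chosen by counting eigenvalues. *)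
Lemma diag_match Q X : Q ^t* = Q -> Q *m Q = Q -> X ^t* = X ->
  exists d e : 'I_n -> C,
  [/\ forall i, d i \is Num.real, forall i, e i * e i = e i,
      [/\ hs (X *m X - X) = \sum_i `|d i * d i - d i| ^+ 2,
      \tr X = \sum_i d i & \tr Q = \sum_i e i] &
      forall s : 'S_n, exists2 W, W \is unitarymx &
        hs (W *m X *m W ^t* - Q) = \sum_i `|d (s i) - e i| ^+ 2].
Proof.
move=> QH QQ XH.
have [P [d Pu [XE dr]]] := hermitian_diagE XH.
have [R [e Ru [QE _]]] := hermitian_diagE QH.
exists (d 0), (e 0); split => //.
- move=> i; have := congr1 (fun Z => (R *m Z *m R ^t*) i i) QQ.
  by rewrite QE conj_diagM // !diag_of_conj // mxE.
- split; last by rewrite QE trace_conj_diag.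
    by rewrite XE conj_diagM // hs_conj_diagB //; apply: eq_bigr => i _;
      rewrite mxE.
  by rewrite XE trace_conj_diag.
move=> s; exists (R ^t* *m (perm_mx s *m P)).
  by rewrite !mul_unitarymx ?trmxC_unitary ?unitarymx_perm.
pose d' := \row_i d 0 (s i).
have -> : R ^t* *m (perm_mx s *m P) *m X *m (R ^t* *m (perm_mx s *m P)) ^t* =
    R ^t* *m diag_mx d' *m R.
  rewrite XE !adjmxM trmxCK !mulmxA.
  rewrite -(mulmxA _ P (P ^t*)) (unitarymxP Pu) mulmx1.
  rewrite -(mulmxA _ P (P ^t*)) (unitarymxP Pu) mulmx1.
  congr (_ *m _); rewrite -!mulmxA; congr (_ *m _).
  rewrite tr_perm_mx map_perm_mx mulmxA -row_permE -col_permE.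
  by apply/matrixP => i j; rewrite !mxE (inj_eq perm_inj).
by rewrite QE hs_conj_diagB //; apply: eq_bigr => i _; rewrite mxE.
Qed.

End ComplexMatrix.

(** * Conditional expectation onto a matrix level *)

Section Expectation.
Variables (K : realType) (A : tracial_vNa K) (xi : A).
Hypothesis tauE : forall x, @vN K A x -> tau x = dot (x xi) xi.
Variables (n : nat) (phi : 'M[K[i]]_n -> vn A) (phiP : is_mxrep phi).
Hypothesis n_gt0 : (0 < n)%N.
Local Notation C := K[i].
Implicit Types X Y Z : 'M[C]_n.

(** The vectors obtained by applying the [phi (delta_mx i j)] to [xi] are orthogonal of squared norm
    1/n, so these are the coefficients of the orthogonal projection of [v] to their span. *)
Definition proj_mx (v : A) : 'M[C]_n :=
  \matrix_(i, j) (n%:R * dot v (sval (phi (delta_mx i j)) xi)).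

Definition proj v : A := sval (phi (proj_mx v)) xi.

Let n0 : n%:R != 0 :> C. Proof. by rewrite pnatr_eq0 -lt0n. Qed.

Lemma dot_mxrep X Y :
  dot (sval (phi X) xi) (sval (phi Y) xi) = \tr (Y ^t* *m X) / n%:R.
Proof. by rewrite -(vn_tau_dot tauE) -(mxrep_adj phiP) -(mxrepM phiP)
  (mxrep_tau phiP). Qed.

Lemma n2_mxrep X : n2 (phi X) ^+ 2 = complex.Re (\tr (X ^t* *m X) / n%:R).
Proof. by rewrite (n2E tauE) hnorm_sqr dot_mxrep. Qed.

Lemma proj_orth v Y : dot (v - proj v) (sval (phi Y) xi) = 0.
Proof.
rewrite (mxrep_delta phiP Y) sval_sum dot_sumr big1 // => i _.
rewrite sval_sum dot_sumr big1 // => j _; rewrite svalZ dotZr dotBl dot_mxrep.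
by rewrite adjmx_delta mxtrace_delta_mul mxE [n%:R * _]mulrC mulfK // subrr mulr0.
Qed.

Lemma proj_uniq v Y :
  (forall Z, dot (v - sval (phi Y) xi) (sval (phi Z) xi) = 0) ->
  proj v = sval (phi Y) xi.
Proof.
move=> h; apply/eqP; rewrite -subr_eq0; apply/eqP/hnorm_eq0/eqP.
rewrite -sqrf_eq0 hnorm_sqr -svalB -(mxrepB phiP).
have := h (proj_mx v - Y); have := proj_orth v (proj_mx v - Y).
rewrite !dotBl => /eqP; rewrite subr_eq0 => /eqP ->.
by rewrite -dotBl (mxrepB phiP) svalB => ->.
Qed.

Lemma proj_mxrep X : proj (sval (phi X) xi) = sval (phi X) xi.
Proof. by apply: proj_uniq => Z; rewrite subrr dot0l. Qed.

(** The span is stable under [phi X] and under its adjoint, so the projection commutes with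
    [phi X]. *)
Lemma projMl X v : proj (sval (phi X) v) = sval (phi X) (proj v).
Proof.
rewrite /proj -svalM -(mxrepM phiP); apply: proj_uniq => Z.
rewrite (mxrepM phiP) svalM -vnaB adjE -svalM -(mxrep_adj phiP) -(mxrepM phiP).
exact: proj_orth.
Qed.

Lemma proj_linear : linear proj.
Proof.
move=> a u v; rewrite /proj -svalZ -svalD -(mxrepZ phiP) -(mxrepD phiP).
apply: proj_uniq => Z; rewrite (mxrepD phiP) (mxrepZ phiP) svalD svalZ.
by rewrite opprD addrACA -scalerBr dotDl dotZl !proj_orth mulr0 addr0.
Qed.

Lemma hnorm_proj v : hnorm (proj v) <= hnorm v.
Proof.
rewrite -(@ler_pXn2r _ 2) ?nnegrE ?hnorm_ge0 //.
have : hnorm v ^+ 2 = hnorm (v - proj v) ^+ 2 + hnorm (proj v) ^+ 2.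
  by rewrite -hnormD_orth ?subrK // proj_orth.
by move=> ->; rewrite lerDr sqr_ge0.
Qed.

(** The trace-preserving conditional expectation: the element of the level that sends [xi] to the
    projection of [x xi]. *)
Definition expect (x : vn A) : vn A := phi (proj_mx (sval x xi)).

(* The operator norm of a matrix can be tested on the left regular
   representation, where it is dominated by that of [x]. *)
Lemma expect_op_le c x : 0 <= c -> op_le c x -> op_le c (expect x).
Proof.
move=> c0 xc; rewrite /expect; set Y := proj_mx _.
(* By the trace property [phi Z] moves to the other side, where the claim is the orthogonality of
   [x xi - phi Y xi] to the level. *)
have yx Z W : dot (sval (phi (Y *m Z)) xi) (sval (phi W) xi) =
    dot (sval (x * phi Z) xi) (sval (phi W) xi).
  rewrite (mxrepM phiP) -!(vn_tau_dot tauE) !mulrA vn_tauC [RHS]vn_tauC !mulrA.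
  rewrite -(mxrep_adj phiP) -(mxrepM phiP) -[X in phi X]trmxCK (mxrep_adj phiP).
  rewrite !(vn_tau_dot tauE); apply/eqP; rewrite eq_sym -subr_eq0 -dotBl.
  by rewrite proj_orth.
have c1 Z : hnorm (sval (phi (Y *m Z)) xi) <= c * hnorm (sval (phi Z) xi).
  have [->|v0] := eqVneq (hnorm (sval (phi (Y *m Z)) xi)) 0.
    by rewrite mulr_ge0 ?hnorm_ge0.
  have {}v0 : 0 < hnorm (sval (phi (Y *m Z)) xi).
    by rewrite lt_neqAle eq_sym v0 hnorm_ge0.
  rewrite -(ler_pM2l v0) -expr2 hnorm_sqr yx.
  apply: le_trans (Re_le_cabs _) _; apply: le_trans (cabs_dot _ _) _.
  by rewrite mulrC ler_wpM2l ?hnorm_ge0 // svalM.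
(* The bound means that [X] is positive. Its eigenvalues are nonnegative because [c1] tests them on
   the vectors [phi Z xi]; being a nonnegative combination of elements [R^* R], it is then positive
   on all vectors. *)
pose X := (c ^+ 2)%:C%:M - Y ^t* *m Y.
have Xv v : dot (sval (phi X) v) v = (c ^+ 2 * hnorm v ^+ 2 - hnorm (sval (phi
  Y) v) ^+ 2)%:C.
  rewrite /X (mxrepB phiP) -scalemx1 (mxrepZ phiP) (mxrep1 phiP) svalB svalZ
    sval1.
  rewrite dotBl dotZl (mxrepM phiP) svalM (mxrep_adj phiP) adjE adjK !dot_hnorm.
  by rewrite -rmorphM -rmorphB.
have XX : X ^t* = X.
  rewrite /X linearB /= map_mxB tr_scalar_mx map_scalar_mx trmx_mul map_mxM
    trmxCK.
  congr (_%:M - _); exact: conjc_real.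
have [P [d Pu [XE dr]]] := hermitian_diagE XX.
have d0 i : 0 <= d 0 i.
  pose Z := P ^t* *m delta_mx i i.
  have e : \tr (Z ^t* *m X *m Z) = d 0 i by rewrite {1}XE; exact: tr_conj_diag.
  have := Xv (sval (phi Z) xi); rewrite -svalM -(mxrepM phiP) dot_mxrep mulmxA e.
  rewrite -svalM -(mxrepM phiP) => e'.
  have : 0 <= d 0 i / n%:R.
    rewrite e' ler0c subr_ge0 -exprMn ler_pXn2r ?nnegrE ?mulr_ge0 ?hnorm_ge0 //.
  by rewrite pmulr_lge0 // invr_gt0 ltr0n.
have Xpos v : 0 <= dot (sval (phi X) v) v.
  rewrite XE diag_mx_sum_delta mulmx_sumr mulmx_suml (mxrep_sum phiP) sval_sum
    dot_suml.
  apply: sumr_ge0 => i _; rewrite -scalemxAr -scalemxAl (mxrepZ phiP) svalZ dotZl.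
  apply: mulr_ge0 => //.
  have -> : P ^t* *m delta_mx i i *m P = (delta_mx i i *m P) ^t* *m (delta_mx i
    i *m P).
    by rewrite trmx_mul map_mxM adjmx_delta !mulmxA -[X in _ = X *m _]mulmxA
      mul_delta_mx.
  by rewrite (mxrepM phiP) (mxrep_adj phiP) svalM adjE adjK dot_hnorm ler0c
    sqr_ge0.
move=> v; have := Xpos v; rewrite Xv ler0c subr_ge0 -exprMn.
by rewrite ler_pXn2r ?nnegrE ?mulr_ge0 ?hnorm_ge0.
Qed.

End Expectation.

Lemma nonincreasing_ge0_cauchy (K : realType) (d : nat -> K) :
  (forall n, 0 <= d n) -> (forall m n, (m <= n)%N -> d n <= d m) ->
  forall e, 0 < e -> exists n0 : nat, forall n, (n0 <= n)%N -> d n0 - d n < e.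
Proof.
move=> d0 dm e e0.
have hi : has_inf (range d).
  by split; [exists (d 0%N), 0%N | exists 0 => _ [n _ <-]].
have [_ [n0 _ <-] n0P] := inf_adherent e0 hi; exists n0 => n _.
rewrite ltrBlDl (lt_le_trans n0P) // lerD2r.
by apply: ge_inf; [exact: hi.2 | exists n].
Qed.

(** * Density of the tower in the 2-norm *)

Section TowerDensity.
Variables (K : realType) (A : tracial_vNa K) (xi : A).
Hypothesis tauE : forall x, @vN K A x -> tau x = dot (x xi) xi.
Variable pi : nat -> 'M[K[i]]_2 -> (A -> A).
Hypothesis piP : forall n, unital_star_hom (pi n).
Hypothesis piC : forall m n a b, m != n -> pi m a \o pi n b = pi n b \o pi m a.
Hypothesis vN_gen :
  @vN K A = commutant (commutant [set x | exists n a, x = pi n a]).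

Local Notation rep := (mrep piP vN_gen).
Let repP l : is_mxrep (rep l) := mrep_mxrep piP piC vN_gen l.
Let P l := proj xi (rep l).

(** The levels increase, so by Pythagoras the squared distance [d l] from [v] to level [l] decreases
    by exactly the square of the step between the projections; a decreasing nonnegative sequence is
    Cauchy. *)
Lemma proj_tower_cauchy v e : 0 < e -> exists n0 : nat, forall m n,
  (n0 <= m)%N -> (n0 <= n)%N -> hnorm (P m v - P n v) < e.
Proof.
move=> e0; pose d l := hnorm (v - P l v) ^+ 2.
have pyth m l : (m <= l)%N -> d m = d l + hnorm (P l v - P m v) ^+ 2.
  move=> ml; rewrite /d -hnormD_orth; first by rewrite addrA subrK.
  have [Y Ye] := mrep_nestW piP piC vN_gen (proj_mx xi (rep m) v) ml.
  rewrite /P [proj xi (rep m) v]/proj -Ye -svalB -(mxrepB (repP l)).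
  exact: (proj_orth tauE (repP l) (dim_gt0 l)).
have e2 : 0 < (e / 2) ^+ 2 by rewrite exprn_gt0 //; lra.
have d0 n : 0 <= d n by apply: sqr_ge0.
have dm m n : (m <= n)%N -> d n <= d m by move=> /pyth ->; rewrite lerDl sqr_ge0.
have [n0 n0P] := nonincreasing_ge0_cauchy d0 dm e2.
have h n : (n0 <= n)%N -> hnorm (P n v - P n0 v) < e / 2.
  move=> n0n; rewrite -(@ltr_pXn2r _ 2) ?nnegrE ?hnorm_ge0 //; last by lra.
  by have := n0P _ n0n; rewrite (pyth _ _ n0n); lra.
exists n0 => m n /h hm /h hn.
have -> : P m v - P n v = (P m v - P n0 v) - (P n v - P n0 v).
  by rewrite opprB addrA subrK.
by have := hnormD (P m v - P n0 v) (- (P n v - P n0 v)); rewrite hnormN; lra.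
Qed.

(* The limit of the projections commutes with the generators and fixes [xi],
   so that [x xi] is fixed by it as well. *)
Lemma tower_approx (x : vn A) e : 0 < e -> exists l0 : nat, forall l,
  (l0 <= l)%N -> n2 (x - expect xi (rep l) x) < e.
Proof.
have [Q QP] : exists Q : A -> A, forall v, lim_to (fun n => hnorm (P n v - Q v)).
  suff Qv v : exists w, lim_to (fun n => hnorm (P n v - w)).
    by have [Q QP] := choice Qv; exists Q.
  by apply: hnorm_complete; apply: proj_tower_cauchy.
have Qu v w : lim_to (fun n => hnorm (P n v - w)) -> Q v = w.
  by apply: hnorm_lim_unique (QP v).
have Plin l := proj_linear tauE (repP l) (dim_gt0 l).
have Qlin : linear Q.
  move=> a v w; apply: Qu.
  have := lim_toD (lim_toM (cabs_ge0 a) (QP v)) (QP w).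
  apply: lim_to_le => n; rewrite /P Plin -hnormZ.
  by apply: le_trans (hnormD _ _); rewrite scalerBr opprD addrACA.
have Qb : bounded_op Q.
  split=> //; exists 1 => v; rewrite mul1r !hnormE lecR.
  apply/ler_addgt0Pr => f f0; have [n /(_ _ (leqnn _)) nP] := QP v f f0.
  have := hnorm_proj tauE (repP n) (dim_gt0 n) v.
  by have := hnormD (Q v - P n v) (P n v); rewrite subrK hnormBC /P in nP *; lra.
(* From level [k.+1] on the levels contain [pi k a], and their projections commute with it. *)
have Qc : commutant [set x | exists n a, x = pi n a] Q.
  split=> // _ [k [a ->]]; apply/funext => v /=; apply: Qu.
  have [c c0 cP] := op_bounded (piv piP vN_gen k a).
  move=> f f0; have [n0 n0P] := lim_toM c0 (QP v) f0.
  exists (maxn n0 k.+1) => n; rewrite geq_max => /andP[n0n kn].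
  apply: le_lt_trans (n0P _ n0n).
  have [Y Ye] := mrep_piv piP piC vN_gen a kn.
  have -> : P n (pi k a v) = sval (piv piP vN_gen k a) (P n v).
    by rewrite /P -Ye -(projMl tauE (repP n) (dim_gt0 n)) Ye.
  by rewrite -vnaB.
have Qxi : Q xi = xi.
  apply: Qu => f f0; exists 0%N => n _.
  have := proj_mxrep tauE (repP n) (dim_gt0 n) 1%:M.
  by rewrite (mxrep1 (repP n)) sval1 /P => ->; rewrite subrr hnorm0.
have Qx : Q (sval x xi) = sval x xi.
  have [_ /(_ _ Qc)] : commutant (commutant [set x | exists n a,
    x = pi n a]) (sval x).
    by rewrite -vN_gen; apply: svalP.
  by move=> /(congr1 (fun g => g xi)) /=; rewrite Qxi.
move=> e0; have [l0 l0P] := QP (sval x xi) e e0; exists l0 => l /l0P.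
by rewrite Qx (n2BC tauE) (n2E tauE) svalB.
Qed.

End TowerDensity.

(** If one of [A], [B] contains the other, the identity will do. Otherwise a transposition
    exchanging a point of [A :\: B] with one of [B :\: A] shrinks the former and keeps both
    cardinals. *)
Lemma perm_match n (A B : {set 'I_n}) : exists s : 'S_n,
  (#|[set i | (i \in A) != (s i \in B)]%SET| <= (#|A| - #|B|) + (#|B| - #|A|))%N.
Proof.
have [m] := ubnP #|A :\: B|; elim: m B => // m IH B; rewrite ltnS => AB.
have [AB0|[x]] := finset.set_0Vmem (A :\: B).
  exists 1%g; have sAB : A \subset B by rewrite -finset.setD_eq0 AB0.
  rewrite (_ : [set i | _]%SET = B :\: A) ?finset.cardsDS // ?leq_addl //.
  apply/finset.setP => i; rewrite !inE perm1.
  by have := fintype.subsetP sAB i; case: (i \in A);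
    case: (i \in B) => // /(_ isT).
have [BA0|[y]] := finset.set_0Vmem (B :\: A).
  move=> _; exists 1%g; have sBA : B \subset A by rewrite -finset.setD_eq0 BA0.
  rewrite (_ : [set i | _]%SET = A :\: B) ?finset.cardsDS // ?leq_addr //.
  apply/finset.setP => i; rewrite !inE perm1.
  by have := fintype.subsetP sBA i; case: (i \in A);
    case: (i \in B) => // /(_ isT).
rewrite !inE => /andP[yA yB] /andP[xB xA].
pose B' := tperm x y @^-1: B.
have cB' : #|B'| = #|B| by apply: card_preimset; apply: perm_inj.
have lt : (#|A :\: B'| < m)%N.
  apply: leq_trans AB; apply: proper_card; apply/properP; split.
    apply/fintype.subsetP => i; rewrite !inE => /andP[iB' iA]; rewrite iA andbT.
    apply: contra iB' => iB; case: tpermP => [_|e|//]; first exact: yB.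
    by rewrite -e iA in yA.
  by exists x; rewrite !inE ?xA ?xB // tpermL yB.
have [s sP] := IH _ lt; exists (s * tperm x y)%g.
rewrite -cB'; apply: leq_trans sP; rewrite leq_eqVlt; apply/orP; left.
by apply/eqP/eq_card => i; rewrite !inE permM.
Qed.

(** * An almost projection and a projection of almost the same trace *)

Section HilbertSchmidt.
Variables (K : realType) (n : nat).
Local Notation C := K[i].
Implicit Types X Y P Q W : 'M[C]_n.

Definition hs2 X : K := complex.Re (hs X).

(** The characteristic polynomial [p] has fewer roots than the [size p] candidates e / (i + 1), so
    one of them is not an eigenvalue of [- X]. *)
Lemma perturb_unit X (e : K) : 0 < e ->
  exists2 t : K, 0 < t <= e & X + t%:C%:M \in unitmx.
Proof.
move=> e0; pose p := char_poly (- X).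
pose r := [seq (e / i.+1%:R)%:C : C | i <- iota 0 (size p)].
have p0 : p != 0 by apply: monic_neq0; apply: char_poly_monic.
have : ~~ all (root p) r.
  apply/negP => pr; suff ru : uniq r.
    by have := max_poly_roots p0 pr ru; rewrite size_map size_iota ltnn.
  rewrite map_inj_uniq ?iota_uniq //.
  move=> i j /complexI /(mulfI (lt0r_neq0 e0)) /invr_inj /eqP.
  by rewrite eqr_nat => /eqP [].
move=> /allPn[_ /mapP[i _ ->] npr]; exists (e / i.+1%:R).
  rewrite divr_gt0 // ?ltr0n // ler_pdivrMr ?ltr0n //.
  by rewrite -[leLHS]mulr1 ler_pM2l // ler1n.
move: npr; rewrite -eigenvalue_root_char /eigenvalue negbK /eigenspace.
by rewrite kermx_eq0 row_free_unit -opprD -scaleN1r unitmxZ // unitrN1.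
Qed.

(** Here [x] is rounded to 0 or 1 at the threshold 1/2. Of the factors of x (x - 1) one is the
    rounding error up to sign, and the other has modulus at least 1/2. *)
Lemma real_proj_bound (x : K) :
  ((1/2 < x)%R%:R - x) ^+ 2 <= 4 * (x ^+ 2 - x) ^+ 2 /\
  `|(1/2 < x)%R%:R - x| <= 2 * `|x ^+ 2 - x|.
Proof.
suff h : `|(1/2 < x)%R%:R - x| <= 2 * `|x ^+ 2 - x|.
  split=> //; move: h; set a := _ - x; set b := _ - x => h.
  rewrite -(real_normK (num_real a)) -(real_normK (num_real b)).
  by have := normr_ge0 a; nra.
have -> : x ^+ 2 - x = x * (x - 1) by ring.
rewrite normrM; case: ltP => h /=.
  by rewrite distrC [`|x|]gtr0_norm; have := normr_ge0 (x - 1); nra.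
rewrite sub0r normrN [`|x - 1|]ler0_norm; last by lra.
by have := normr_ge0 x; nra.
Qed.

(** Round the eigenvalues of [X] to 0 or 1 and reorder them so as to differ from those of [Q] only
    as often as the ranks require. The first term is twice the squared rounding error. The second is
    twice the difference of the ranks, at most 3 n delta: 2 n delta from rounding and n delta from
    the traces. *)
Lemma match_projection Q X (delta : K) : 0 < delta ->
  Q ^t* = Q -> Q *m Q = Q -> X ^t* = X ->
  hs2 (X *m X - X) <= n%:R * delta ^+ 2 ->
  `|complex.Re (\tr X) - complex.Re (\tr Q)| <= n%:R * delta ->
  exists2 W, W \is unitarymx &
    hs2 (W *m X *m W ^t* - Q) <= n%:R * (8 * delta ^+ 2 + 6 * delta).
Proof.
move=> dl0 QH QQ XH hX hQ.
have [d [e [dr ee [hsX0 trX0 trQ0] hW]]] := diag_match QH QQ XH.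
pose D i := complex.Re (d i); pose E i := complex.Re (e i).
have DE i : d i = (D i)%:C by rewrite /D RRe_real.
have EE i : e i = (E i == 1)%:R.
  have /eqP := ee i; rewrite -subr_eq0 -{3}[e i]mulr1 -mulrBr mulf_eq0.
  rewrite subr_eq0 /E => /orP[] /eqP -> /=; last by rewrite eqxx.
  by rewrite [0 == 1]eq_sym oner_eq0.
have trX : complex.Re (\tr X) = \sum_i D i by rewrite trX0 raddf_sum.
have trQ : complex.Re (\tr Q) = \sum_i E i by rewrite trQ0 raddf_sum.
have Re_sqr (z : C) : complex.Re (`|z| ^+ 2) = cabs z ^+ 2.
  by rewrite cabsE -rmorphXn.
have hsX : hs2 (X *m X - X) = \sum_i (D i ^+ 2 - D i) ^+ 2.
  rewrite /hs2 hsX0 raddf_sum; apply: eq_bigr => i _.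
  transitivity (cabs (d i * d i - d i) ^+ 2); first exact: Re_sqr.
  rewrite DE.
  by rewrite -rmorphM -rmorphB cabs_real real_normK ?num_real.
pose A : {set 'I_n} := [set i | 1/2 < D i]%SET.
pose B : {set 'I_n} := [set i | E i == 1]%SET.
have [s sP] := perm_match A B.
have [W Wu hsW] := hW (s^-1)%g; exists W => //.
pose a i : K := (i \in A)%:R; pose b i : K := (i \in B)%:R.
have Eb i : E i = b i.
  by rewrite /b inE {1}/E EE; case: (E i == 1).
have sum_card (Z : {set 'I_n}) : \sum_i (i \in Z)%:R = #|Z|%:R :> K.
  by rewrite -natr_sum -big_mkcond /= sum1_card.
have -> : hs2 (W *m X *m W ^t* - Q) = \sum_j (D j - b (s j)) ^+ 2.
  rewrite /hs2 hsW raddf_sum (reindex_inj (@perm_inj _ s)); apply: eq_bigr => j _.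
  transitivity (cabs (d j - e (s j)) ^+ 2); first by rewrite -Re_sqr permK.
  rewrite DE -[e _]RRe_real; last by rewrite EE realn.
  by rewrite -/(E _) Eb -rmorphB cabs_real real_normK ?num_real.
have h1 : \sum_j (D j - b (s j)) ^+ 2 <=
    8 * hs2 (X *m X - X) + 2 * \sum_j ((a j - b (s j)) ^+ 2).
  rewrite hsX !mulr_sumr -big_split /=; apply: ler_sum => j _.
  have [] := real_proj_bound (D j);
    have -> : (1 / 2 < D j)%R%:R = a j by rewrite /a inE.
  move=> + _; move: (a j) (b (s j)) (D j) => u v w;
    have := sqr_ge0 (u - w - (u - v) * (-1));
      have := sqr_ge0 ((u - w) + (u - v)); nra.
have h2 : \sum_j ((a j - b (s j)) ^+ 2) <= `|\sum_j a j - \sum_j b j|.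
  have -> : \sum_j (a j - b (s j)) ^+ 2 =
      #|[set i | (i \in A) != (s i \in B)]%SET|%:R.
    rewrite -sum_card; apply: eq_bigr => j _; rewrite inE /a /b.
    by case: (j \in A); case: (s j \in B) => /=;
       rewrite ?subrr ?subr0 ?sub0r ?sqrrN ?expr0n ?expr1n.
  rewrite !sum_card; apply: (@le_trans _ _ ((#|A| - #|B|) + (#|B| - #|A|))%:R).
    by rewrite ler_nat.
  have [AB|/ltnW AB] := leqP #|A| #|B|; have /eqP -> := AB.
    by rewrite add0n natrB // distrC ler_norm.
  by rewrite addn0 natrB // ler_norm.
have h3 : `|\sum_j a j - \sum_j b j| <= n%:R * (3 * delta).
  have -> : \sum_j a j - \sum_j b j =
      \sum_j (a j - D j) + (\sum_i D i - \sum_i E i).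
    by rewrite sumrB (eq_bigr _ (fun i _ => Eb i)) addrA subrK.
  apply: le_trans (ler_normD _ _) _; rewrite -trX -trQ.
  suff : `|\sum_j (a j - D j)| <= n%:R * (2 * delta) by nra.
  apply: le_trans (ler_norm_sum _ _ _) _.
  (* From squares to absolute values: 2 |y| <= y^2 / delta + delta for each eigenvalue. *)
  have : \sum_i (D i ^+ 2 - D i) ^+ 2 / delta + n%:R * delta <= n%:R * (2 *
    delta).
    rewrite -mulr_suml -hsX.
    suff : hs2 (X *m X - X) / delta <= n%:R * delta by nra.
    by rewrite ler_pdivrMr // -mulrA -expr2.
  apply: le_trans; have -> : n%:R * delta = \sum_(j < n) delta.
    by rewrite sumr_const card_ord mulr_natl.
  rewrite -big_split /=.
  apply: ler_sum => j _; have [_] := real_proj_bound (D j).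
  have -> : (1 / 2 < D j)%R%:R = a j by rewrite /a inE.
  move=> /le_trans -> //; set x := _ - D j.
  rewrite -lerBlDr ler_pdivlMr // -[x ^+ 2]real_normK ?num_real //.
  by have := sqr_ge0 (`|x| - delta); nra.
have n0 : (0 : K) <= n%:R by apply: ler0n.
nra.
Qed.

End HilbertSchmidt.

(** * Approximate matrix units are conjugate *)

Section RowConjugacy.
Variables (K : realType) (A : tracial_vNa K) (xi : A).
Hypothesis tauE : forall x, @vN K A x -> tau x = dot (x xi) xi.
Implicit Types x y u w : vn A.

Lemma tau_adj x : complex.Re (vn_tau (vn_adj x)) = complex.Re (vn_tau x).
Proof.
have := vn_tau_dot tauE x 1; rewrite adj1 mul1r => ->.
have := vn_tau_dot tauE 1 x; rewrite mulr1 => ->.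
by rewrite dotC ReJ.
Qed.

Lemma Re_tau_le x : `|complex.Re (vn_tau x)| <= n2 x.
Proof. exact: le_trans (normr_Re_le _) (cabs_tau tauE x). Qed.

Lemma n2_real (t : K) x : n2 (t%:C *: x) = `|t| * n2 x.
Proof.
by rewrite (n2Z tauE) cabs_real.
Qed.

Section Level.
Variables (N : nat) (phi : 'M[K[i]]_N -> vn A) (phiP : is_mxrep phi).
Hypothesis N_gt0 : (0 < N)%N.

Lemma n2_hs X : n2 (phi X) ^+ 2 = hs2 X / N%:R.
Proof.
rewrite (n2_mxrep tauE phiP) -/(hs X) /hs2.
have : 0 <= hs X.
  have := dot_mxrep tauE phiP X X; rewrite dot_hnorm => /(congr1 ( *%R^~ N%:R)).
  rewrite divfK ?pnatr_eq0 -?lt0n // -/(hs X) => <-.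
  by rewrite mulr_ge0 ?ler0n // ler0c sqr_ge0.
move=> /Re_real_eq <-.
by rewrite -(rmorph_nat (real_complex K)) -fmorphV -rmorphM.
Qed.

Lemma rep_unitary U : U \is unitarymx -> unitary (phi U).
Proof.
move=> Uu; rewrite /unitary -(mxrep_adj phiP) -!(mxrepM phiP).
by rewrite (unitarymxP Uu) unitarymxK // (mxrep1 phiP).
Qed.

(** Polar decomposition is applied to the invertible X + t. The shift costs at most t + 2 t |x|_2 +
    t^2, hence at most [t * c] as t <= 1, and [t * c <= e]. *)
Lemma rep_polar X e : 0 < e -> exists2 u, unitary u &
  n2 (phi X - u) <= n2 (vn_adj (phi X) * phi X - 1) + e.
Proof.
move=> e0; set x := phi X.
pose c := 2 + 2 * n2 x; have c0 : 0 < c by have := n2_ge0 tauE x; rewrite /c; lra.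
pose e' := Num.min 1 (e / c).
have e'0 : 0 < e' by rewrite lt_min ltr01 divr_gt0.
have [t /andP[t0 te] tu] := perturb_unit X e'0.
have t1 : t <= 1 by apply: le_trans te _; rewrite ge_min lexx.
have tc : t * c <= e by rewrite -ler_pdivlMr //; apply: le_trans te _;
  rewrite ge_min lexx orbT.
have [U Uu hU] := polar_unit tu; exists (phi U); first exact: rep_unitary.
set Y := X + _ in hU.
have xt : phi Y = x + t%:C *: 1 by rewrite (mxrepD phiP) (mxrep_scalar phiP).
have h1 : n2 (phi Y - phi U) <= n2 (vn_adj (phi Y) * phi Y - 1).
  rewrite -(@ler_pXn2r _ 2) ?nnegrE ?(n2_ge0 tauE) //.
  rewrite -(mxrep_adj phiP) -(mxrepM phiP) -(mxrep1 phiP) -!(mxrepB phiP) !n2_hs.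
  rewrite ler_pM2r ?invr_gt0 ?ltr0n //.
  by move: hU; rewrite lecE => /andP[].
have h2 : vn_adj (phi Y) * phi Y - 1 =
    (vn_adj x * x - 1) + (t%:C *: vn_adj x + (t%:C *: x + (t * t)%:C *: 1)).
  rewrite xt adjD adjZ adj1 (_ : Num.conj t%:C = t%:C) ?conjc_real //;
    last exact: conjc_real.
  rewrite mulrDl !mulrDr -scalerAr mulr1 -scalerAl mul1r -scalerAr mulr1
    scalerA -rmorphM.
  rewrite [RHS]addrAC; congr (_ - _).
  by rewrite -!addrA.
have h3 := n2D tauE (vn_adj x * x - 1) (t%:C *: vn_adj x + (t%:C *: x + (t *
  t)%:C *: 1)).
have h4 := n2D tauE (t%:C *: vn_adj x) (t%:C *: x + (t * t)%:C *: 1).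
have h5 := n2D tauE (t%:C *: x) ((t * t)%:C *: 1).
have h6 := n2B_tri tauE (phi Y) x (phi U).
have h7 : n2 (x - phi Y) = t.
  by rewrite xt opprD addrA subrr sub0r (n2N tauE) n2_real (n21 tauE) mulr1
    gtr0_norm.
rewrite -h2 in h3.
have r1 : n2 (t%:C *: vn_adj x) = t * n2 x
  by rewrite n2_real (n2_adj tauE) gtr0_norm.
have r2 : n2 (t%:C *: x) = t * n2 x by rewrite n2_real gtr0_norm.
have r3 : n2 ((t * t)%:C *: (1 : vn A)) = t * t.
  by rewrite n2_real (n21 tauE) mulr1 gtr0_norm // mulr_gt0.
rewrite r1 in h4; rewrite r2 r3 in h5.
move: tc; rewrite /c; nra.
Qed.

(** The normalization by [N] cancels, so that the estimate does not depend on the level. *)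
Lemma rep_match Q X delta : 0 < delta ->
  Q ^t* = Q -> Q *m Q = Q -> X ^t* = X ->
  n2 (phi X * phi X - phi X) <= delta ->
  `|complex.Re (vn_tau (phi X)) - complex.Re (vn_tau (phi Q))| <= delta ->
  exists2 W, W \is unitarymx &
    n2 (phi W * phi X * vn_adj (phi W) - phi Q) ^+ 2 <= 8 * delta ^+ 2 + 6 *
      delta.
Proof.
move=> d0 QH QQ XH hX hQ.
have N0 : (0 : K) < N%:R by rewrite ltr0n.
have trE Z : complex.Re (vn_tau (phi Z)) = complex.Re (\tr Z) / N%:R.
  rewrite (mxrep_tau phiP) -(rmorph_nat (real_complex K)) -fmorphV.
  by case: (\tr Z) => a b /=; rewrite mulr0 subr0.
have [||W Wu hW] := match_projection d0 QH QQ XH.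
- rewrite mulrC -ler_pdivrMr // -n2_hs (mxrepB phiP) (mxrepM phiP).
  by rewrite ler_pXn2r ?nnegrE ?(n2_ge0 tauE) // ltW.
- rewrite mulrC -ler_pdivrMr //; apply: le_trans hQ.
  by rewrite !trE -mulrBl normrM [`|_^-1|]gtr0_norm ?invr_gt0.
exists W => //; rewrite -(mxrep_adj phiP) -!(mxrepM phiP) -(mxrepB phiP) n2_hs.
by rewrite ler_pdivrMr // mulrC.
Qed.

Variables (n : nat) (j0 : 'I_n) (E F : 'I_n -> 'M[K[i]]_N).
Let e j := phi (E j).
Let f j := phi (F j).
Hypothesis e1 : forall j, op_le 1 (e j).
Hypothesis f1 : forall j, op_le 1 (f j).
Hypothesis EE : forall i j, E j *m (E i) ^t* = E j0 *+ (i == j).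
Hypothesis E0 : (E j0) ^t* = E j0.
Hypothesis tau_e : complex.Re (vn_tau (e j0)) = n%:R^-1.
Variables (delta rho : K).
Hypotheses (delta0 : 0 < delta <= 1) (rho0 : 0 <= rho) (drho : 152 * delta <=
  rho ^+ 2).
Hypothesis R1 : forall i, n2 (f i * vn_adj (f i) - f j0) <= delta.
Hypothesis R2 : n2 (\sum_i vn_adj (f i) * f i - 1) <= delta.
Hypothesis R3 : forall i j, n2 (f i * f j - f j *+ (i == j0)) <= delta.

Let n0 : (1 : K) <= n%:R.
Proof. by rewrite ler1n (leq_ltn_trans _ (ltn_ord j0)). Qed.

(* With [w] matching [f_0] and [e_0], the element [\sum_i e_i^* w f_i] almost
   intertwines the rows and is almost unitary. *)
Lemma level_conjugacy : exists2 u, unitary u &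
  forall j, n2 (u * f j * vn_adj u - e j) <= n%:R * (2 * rho + 9 * delta).
Proof.
case/andP: delta0 => d0 d1; have nn : (1 : K) <= n%:R := n0.
(* [f j0] is only almost self-adjoint; its real part is a self-adjoint almost projection. *)
pose x := f j0; pose H := 2^-1 *: (F j0 + (F j0) ^t*).
have one_ge0 : (0 : K) <= 1 by [].
have half : Num.conj (2^-1 : K[i]) = 2^-1.
  by apply: CrealP; rewrite realE invr_ge0 ler0n.
have HH : H ^t* = H.
  rewrite /H linearZ /= map_mxZ /= half linearD /= map_mxD trmxCK addrC.
  by [].
have hE : phi H = (2^-1 : K)%:C *: (x + vn_adj x).
  rewrite /H (mxrepZ phiP) (mxrepD phiP) (mxrep_adj phiP) fmorphV rmorph_nat.
  by [].
have xx : n2 (x * vn_adj x - x) <= delta := R1 j0.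
have xx' : n2 (x * vn_adj x - vn_adj x) <= delta.
  by rewrite -(n2_adj tauE) adjB adjM !adjK.
have xsa : n2 (x - vn_adj x) <= 2 * delta.
  have := n2B_tri tauE (x * vn_adj x) x (vn_adj x).
  by rewrite (n2BC tauE x (x * _)); lra.
have h2x (y z : vn A) : (2^-1 : K)%:C *: (y + z) - y = (2^-1 : K)%:C *: (z - y).
  have e2 : y = (2^-1 : K)%:C *: (y + y).
    have -> : y + y = (2%:R : K[i]) *: y by rewrite scaler_nat mulr2n.
    rewrite scalerA fmorphV rmorph_nat.
    by rewrite mulVf ?scale1r // pnatr_eq0.
  by rewrite {2}e2 -scalerBr opprD addrACA subrr add0r.
have hx : n2 (phi H - x) <= delta.
  by rewrite hE h2x n2_real (n2BC tauE) gtr0_norm ?invr_gt0 ?ltr0n //; lra.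
have hx' : n2 (phi H - vn_adj x) <= delta.
  by rewrite hE [x + _]addrC h2x n2_real gtr0_norm ?invr_gt0 ?ltr0n //; lra.
have h1 : op_le 1 (phi H).
  move=> v; rewrite hE svalZ hnormZ svalD.
  have -> : cabs (2^-1 : K)%:C = 2^-1.
    by rewrite cabs_real gtr0_norm ?invr_gt0 ?ltr0n.
  have := hnormD (sval x v) (sval (vn_adj x) v).
  by have := f1 j0 v; have := op_le_adj one_ge0 (f1 j0) v; rewrite -/x; lra.
have hh : n2 (phi H * phi H - phi H) <= 4 * delta.
  have -> : phi H * phi H - phi H = phi H * (phi H - vn_adj x)
      + ((phi H - x) * vn_adj x + ((x * vn_adj x - x) + (x - phi H))).
    by rewrite mulrBr mulrBl;
      rewrite addrA [_ - _ + (_ - _)]addrA subrK subrKA addrA subrK.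
  have a1 := n2Ml tauE (phi H - vn_adj x) h1.
  have a2 := n2Mr tauE (phi H - x) one_ge0 (op_le_adj one_ge0 (f1 j0)).
  have a3 := n2D tauE (phi H * (phi H - vn_adj x)) ((phi H - x) * vn_adj x +
    ((x * vn_adj x - x) + (x - phi H))).
  have a4 := n2D tauE ((phi H - x) * vn_adj x) ((x * vn_adj x - x) + (x - phi H)).
  have a5 := n2D tauE (x * vn_adj x - x) (x - phi H).
  by rewrite (n2BC tauE x (phi H)) in a5; rewrite -/x in a2; lra.
(* The sum of the [f i * vn_adj (f i)] and that of the [vn_adj (f i) * f i] have the same trace; the
   former is near n copies of [x], the latter near 1. *)
have tx : `|complex.Re (vn_tau x) - n%:R^-1| <= 2 * delta.
  have s1 : complex.Re (vn_tau (\sum_i vn_adj (f i) * f i)) =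
     \sum_i complex.Re (vn_tau (f i * vn_adj (f i))).
    by rewrite !raddf_sum; apply: eq_bigr => i _; rewrite /= vn_tauC.
  have s2 : `|complex.Re (vn_tau (\sum_i vn_adj (f i) * f i)) - 1| <= delta.
    have -> : 1 = complex.Re (vn_tau (1 : vn A)) :> K by rewrite vn_tau1.
    by rewrite -!raddfB; apply: le_trans (Re_tau_le _) R2.
  have s3 : `|\sum_i complex.Re (vn_tau (f i * vn_adj (f i))) - n%:R *
    complex.Re (vn_tau x)|
      <= n%:R * delta.
    have nE (z : K) : n%:R * z = \sum_(i < n) z
      by rewrite sumr_const card_ord mulr_natl.
    rewrite !nE -sumrB; apply: le_trans (ler_norm_sum _ _ _) _;
      apply: ler_sum => i _.
    by rewrite -!raddfB; apply: le_trans (Re_tau_le _) (R1 i).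
  rewrite -s1 in s3; move: s2 s3;
    set S := complex.Re (vn_tau (\sum_i _)) => s2 s3.
  have n00 : n%:R != 0 :> K by apply: lt0r_neq0; lra.
  rewrite -(@ler_pM2l _ n%:R); last by lra.
  rewrite -[X in X * `|_|]ger0_norm -?normrM; last by lra.
  rewrite mulrBr divff //.
  have -> : n%:R * complex.Re (vn_tau x) - 1 =
     (S - 1) - (S - n%:R * complex.Re (vn_tau x)) by ring.
  by have := ler_normB (S - 1) (S - n%:R * complex.Re (vn_tau x)); nra.
have tH : complex.Re (vn_tau (phi H)) = complex.Re (vn_tau x).
  rewrite hE linearZ /= raddfD /= -/vn_tau.
  have := tau_adj x; case: (vn_tau x) => a b;
    case: (vn_tau (vn_adj x)) => a' b' /= ->.
  by rewrite mul0r subr0; field.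
have QQ : E j0 *m E j0 = E j0.
  by have := EE j0 j0; rewrite E0 eqxx.
(* The defect [4 * delta] comes from [hh], and the matching bound 8 (4 delta)^2 + 6 (4 delta) is at
   most 152 delta since delta <= 1: this is the constant in [drho]. *)
have d4 : 0 < 4 * delta by lra.
have [||W Wu hW] := rep_match d4 E0 QQ HH.
- exact: hh.
- by rewrite tH -/(e j0) tau_e; lra.
set w := phi W in hW; have wu : unitary w by apply: rep_unitary.
have {}hW : n2 (w * phi H * vn_adj w - e j0) <= rho.
  rewrite -(@ler_pXn2r _ 2) ?nnegrE ?(n2_ge0 tauE) //.
  apply: le_trans hW _;
    have dd : delta ^+ 2 <= delta by rewrite expr2 -[leRHS]mulr1 ler_wpM2l // ltW.
  have := drho; rewrite exprMn; lra.
have wx : n2 (vn_adj w * e j0 * w - x) <= rho + delta.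
  have -> : vn_adj w * e j0 * w - x =
      (phi H - x) - vn_adj w * (w * phi H * vn_adj w - e j0) * w.
    rewrite mulrBr mulrBl !mulrA wu.2 mul1r -[phi H * _ * w]mulrA wu.2 mulr1.
    by rewrite opprB [RHS]addrC addrA subrK.
  have := n2D tauE (phi H - x) (- (vn_adj w * (w * phi H * vn_adj w - e j0) * w)).
  rewrite (n2N tauE) (n2_unitaryr tauE _ wu) (n2_unitaryl tauE _ (unitary_adj
    wu)).
  lra.
pose T := \sum_i (E i) ^t* *m W *m F i.
have TE : phi T = \sum_i vn_adj (e i) * w * f i.
  rewrite (mxrep_sum phiP); apply: eq_bigr => i _.
  by rewrite !(mxrepM phiP) (mxrep_adj phiP).
have ee i j : e j * vn_adj (e i) = e j0 *+ (i == j).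
  rewrite /e -(mxrep_adj phiP) -(mxrepM phiP) EE.
  by case: eqP; rewrite ?mulr1n // !mulr0n (mxrep0 phiP).
have TT : vn_adj (phi T) * phi T = \sum_i vn_adj (f i) * (vn_adj w * e j0 * w)
  * f i.
  rewrite TE adj_sum mulr_suml; apply: eq_bigr => i _.
  rewrite mulr_sumr (bigD1 i) //= [X in _ + X]big1 ?addr0 => [|j ji].
    by rewrite !adjM adjK !mulrA -(mulrA _ (e i)) ee eqxx.
  by rewrite !adjM adjK !mulrA -(mulrA _ (e i)) ee (negPf ji) mulr0n mulr0 !mul0r.
have nsum (G : 'I_n -> vn A) c : (forall i,
  n2 (G i) <= c) -> n2 (\sum_i G i) <= n%:R * c.
  move=> Gc; apply: le_trans (n2_sum tauE _ _ _) _.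
  have -> : n%:R * c = \sum_(i < n) c by rewrite sumr_const card_ord mulr_natl.
  exact: ler_sum.
have f1' j := op_le_adj one_ge0 (f1 j); have e1' j := op_le_adj one_ge0 (e1 j).
(* The middle factor is replaced by [x] and absorbed by [f i]; the errors are n (rho + delta), n
   delta and, from the comparison with 1, delta. *)
have TT1 : n2 (vn_adj (phi T) * phi T - 1) <= n%:R * (rho + 3 * delta).
  have -> : vn_adj (phi T) * phi T - 1 =
      \sum_i vn_adj (f i) * (vn_adj w * e j0 * w - x) * f i
      + (\sum_i vn_adj (f i) * (x * f i - f i) + (\sum_i vn_adj (f i) * f i - 1)).
    rewrite addrA addrA -!big_split /= TT; congr (_ - _); apply: eq_bigr => i _.
    by rewrite !mulrBr mulrBl !mulrA subrKA subrK.
  have b1 : n2 (\sum_i vn_adj (f i) * (vn_adj w * e j0 * w - x) * f i) <= n%:R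
    * (rho + delta).
    apply: nsum => i; apply: le_trans (n2Mr tauE _ one_ge0 (f1 i)) _.
    by rewrite mul1r; apply: le_trans (n2Ml tauE _ (f1' i)) _; rewrite mul1r.
  have b2 : n2 (\sum_i vn_adj (f i) * (x * f i - f i)) <= n%:R * delta.
    apply: nsum => i; apply: le_trans (n2Ml tauE _ (f1' i)) _; rewrite mul1r.
    by have := R3 j0 i; rewrite eqxx.
  have b3 := n2D tauE (\sum_i vn_adj (f i) * (vn_adj w * e j0 * w - x) * f i)
    (\sum_i vn_adj (f i) * (x * f i - f i) + (\sum_i vn_adj (f i) * f i - 1)).
  have b4 := n2D tauE (\sum_i vn_adj (f i) * (x * f i - f i)) (\sum_i vn_adj (f
    i) * f i - 1).
  have nd : delta <= n%:R * delta by rewrite ler_peMl // ltW.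
  apply: le_trans b3 _; have := le_trans b4 (lerD b2 R2); move: b1.
  rewrite !mulrDr; lra.
have [u uu hu] := rep_polar T d0; exists u => // j.
have -> : u * f j * vn_adj u - e j = (u * f j - e j * u) * vn_adj u.
  by rewrite mulrBl -[e j * u * _]mulrA uu.1 mulr1.
rewrite (n2_unitaryr tauE _ (unitary_adj uu)).
have Tf : n2 (phi T * f j - e j * phi T) <= n%:R * delta.
  have -> : phi T * f j - e j * phi T =
      \sum_i vn_adj (e i) * w * (f i * f j - f j *+ (i == j0)).
    rewrite TE mulr_suml mulr_sumr [RHS](eq_bigr (fun i =>
      vn_adj (e i) * w * (f i * f j) - vn_adj (e i) * w * (f j *+ (i == j0))));
        last first.
      by move=> i _; rewrite mulrBr.
    rewrite sumrB; congr (_ - _).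
      by apply: eq_bigr => i _; rewrite mulrA.
    rewrite [RHS](bigD1 j0) //= [X in _ = _ + X]big1 ?addr0 => [|i ij];
      last first.
      by rewrite (negPf ij) mulr0n mulr0.
    rewrite (bigD1 j) //= [X in _ + X]big1 ?addr0 => [|i ij]; last first.
      by rewrite !mulrA ee (negPf ij) mulr0n !mul0r.
    by rewrite !mulrA ee !eqxx /e -(mxrep_adj phiP) E0.
  apply: nsum => i; have ow : op_le 1 (vn_adj (e i) * w).
    by rewrite -[1]mulr1; apply: op_leM => //; apply: unitary_op_le.
  by apply: le_trans (n2Ml tauE _ ow) _; rewrite mul1r; apply: R3.
(* [phi T] is within n (rho + 3 delta) + delta of [u], which is used twice, and intertwines up to n
   delta; as n >= 1 this makes n (2 rho + 9 delta). *)
have -> : u * f j - e j * u =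
   (u - phi T) * f j + ((phi T * f j - e j * phi T) + e j * (phi T - u)).
  by rewrite mulrBl mulrBr subrKA addrA subrK.
have c1 := n2Mr tauE (u - phi T) one_ge0 (f1 j).
have c2 := n2Ml tauE (phi T - u) (e1 j).
have c3 := n2D tauE ((u - phi T) * f j) ((phi T * f j - e j * phi T) + e j *
  (phi T - u)).
have c4 := n2D tauE (phi T * f j - e j * phi T) (e j * (phi T - u)).
rewrite (n2BC tauE u) in c1.
have nd : delta <= n%:R * delta by rewrite ler_peMl // ltW.
apply: le_trans c3 _; move: c4 c1 c2 hu Tf TT1; rewrite !mulrDr; lra.
Qed.

End Level.
End RowConjugacy.

Section Rows.
Variables (K : realType) (A : tracial_vNa K) (n : nat).
Variables (phi : 'M[K[i]]_n -> vn A) (phiP : is_mxrep phi).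

(** Matrix entries are traces of products with matrix units. This carries relations in the algebra
    back to matrices. *)
Lemma mxrep_inj : injective phi.
Proof.
move=> X Y XY; apply/matrixP => i j.
have n0 : n%:R != 0 :> K[i]
  by rewrite pnatr_eq0 -lt0n (leq_ltn_trans _ (ltn_ord i)).
apply: (mulIf (invr_neq0 n0));
  rewrite -[X i j]mxtrace_delta_mul -[Y i j]mxtrace_delta_mul.
by rewrite -!(mxrep_tau phiP) !(mxrepM phiP) XY.
Qed.

(** The square of |e_ij v| is <e_jj v, v>, one of the nonnegative summands <e_kk v, v> of |v|^2. *)
Lemma mxrep_delta_op i j : op_le 1 (phi (delta_mx i j)).
Proof.
have e i' j' v : hnorm (sval (phi (delta_mx i' j')) v) ^+ 2 =
    complex.Re (dot (sval (phi (delta_mx j' j')) v) v).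
  rewrite hnorm_sqr adjE dotC ReJ -svalM (mxrep_delta_adj phiP).
  by rewrite (mxrep_deltaM phiP) eqxx.
move=> v; rewrite mul1r -(@ler_pXn2r _ 2) ?nnegrE ?hnorm_ge0 // e.
have -> : hnorm v ^+ 2 = \sum_k complex.Re (dot (sval (phi (delta_mx k k)) v) v).
  rewrite hnorm_sqr -raddf_sum -dot_suml -sval_sum -(mxrep_sum phiP)
    -mx1_sum_delta.
  by rewrite (mxrep1 phiP).
by rewrite (bigD1 j) //= lerDl sumr_ge0 // => k _; rewrite -(e k) sqr_ge0.
Qed.

End Rows.

(** * First rows of matrix units in the tower *)

Section RowConjugacyTower.
Variables (K : realType) (A : tracial_vNa K) (xi : A).
Hypothesis tauE : forall x, @vN K A x -> tau x = dot (x xi) xi.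
Variable pi : nat -> 'M[K[i]]_2 -> (A -> A).
Hypothesis piP : forall n, unital_star_hom (pi n).
Hypothesis piC : forall m n a b, m != n -> pi m a \o pi n b = pi n b \o pi m a.
Hypothesis vN_gen :
  @vN K A = commutant (commutant [set x | exists n a, x = pi n a]).

Local Notation rep := (mrep piP vN_gen).
Let repP l : is_mxrep (rep l) := mrep_mxrep piP piC vN_gen l.

Definition row0 l : 'I_(dim l) := Ordinal (dim_gt0 l).
Definition row_unit l (j : 'I_(dim l)) : vn A := rep l (delta_mx (row0 l) j).

(** At [delta = 0] these are the relations of a first row e_0j: the [f i] are partial isometries
    with range projection [f (row0 l)] and initial projections summing to 1. *)
Definition row_relations l (f : 'I_(dim l) -> vn A) (delta : K) :=
  [/\ forall i, n2 (f i * vn_adj (f i) - f (row0 l)) <= delta,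
      n2 (\sum_i vn_adj (f i) * f i - 1) <= delta &
      forall i j, n2 (f i * f j - f j *+ (i == row0 l)) <= delta].

Lemma row_unit_exact l delta : 0 <= delta -> row_relations (@row_unit l) delta.
Proof.
move=> d0; have P := repP l; split=> [i||i j]; rewrite /row_unit.
- by rewrite (mxrep_delta_adj P) (mxrep_deltaM P) eqxx subrr (n20 tauE).
- rewrite (eq_bigr (fun i => rep l (delta_mx i i))) => [|i _].
    by rewrite -(mxrep_sum P) -mx1_sum_delta (mxrep1 P) subrr (n20 tauE).
  by rewrite (mxrep_delta_adj P) (mxrep_deltaM P) eqxx.
- by rewrite (mxrep_deltaM P) subrr (n20 tauE).
Qed.

Lemma row_unit_op l j : op_le 1 (@row_unit l j).
Proof. exact: mxrep_delta_op. Qed.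

Lemma row_unit_adjM l i j : vn_adj (@row_unit l i) * row_unit j = rep l
  (delta_mx i j).
Proof. by rewrite /row_unit (mxrep_delta_adj (repP l)) (mxrep_deltaM (repP l))
  eqxx. Qed.

(** A product of two contractions moves by at most [2 * delta]. The first term of the constant is
    the sum of [dim l] such products, the second covers the changes in a single relation. *)
Lemma row_relations_approx l (f g : 'I_(dim l) -> vn A) delta :
  (forall j, op_le 1 (f j)) -> (forall j, op_le 1 (g j)) ->
  (forall j, n2 (f j - g j) <= delta) -> row_relations f delta ->
  row_relations g ((dim l)%:R * 2 * delta + 4 * delta).
Proof.
move=> f1 g1 fg [r1 r2 r3]; have one0 : (0 : K) <= 1 by [].
have d0 : 0 <= delta by apply: le_trans (fg (row0 l)); apply: (n2_ge0 tauE).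
have gf j : n2 (g j - f j) <= delta by rewrite (n2BC tauE).
have prod (x y x' y' : vn A) : op_le 1 x -> op_le 1 y' ->
    n2 (x' - x) <= delta -> n2 (y' - y) <= delta -> n2 (x' * y' - x * y) <= 2 *
      delta.
  move=> x1 y1 xx yy; have -> : x' * y' - x * y = (x' - x) * y' + x * (y' - y).
    by rewrite mulrBl mulrBr addrA subrK.
  have := n2D tauE ((x' - x) * y') (x * (y' - y)).
  have := n2Mr tauE (x' - x) one0 y1; have := n2Ml tauE (y' - y) x1; lra.
have f1' j := op_le_adj one0 (f1 j); have g1' j := op_le_adj one0 (g1 j).
have gf' j : n2 (vn_adj (g j) - vn_adj (f j)) <= delta
  by rewrite -adjB (n2_adj tauE).
have N0 : 0 <= (dim l)%:R * 2 * delta by rewrite !mulr_ge0 ?ler0n.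
split=> [i||i j].
- have := n2B_tri tauE (f i * vn_adj (f i)) (g i * vn_adj (g i)) (g (row0 l)).
  have := n2B_tri tauE (f (row0 l)) (f i * vn_adj (f i)) (g (row0 l)).
  have := prod _ _ _ _ (f1 i) (g1' i) (gf i) (gf' i).
  by have := r1 i; have := fg (row0 l); lra.
- have := n2B_tri tauE (\sum_i vn_adj (f i) * f i) (\sum_i vn_adj (g i) * g i) 1.
  have : n2 (\sum_i vn_adj (g i) * g i - \sum_i vn_adj (f i) * f i) <= (dim
    l)%:R * (2 * delta).
    rewrite -sumrB; apply: le_trans (n2_sum tauE _ _ _) _.
    have -> : (dim l)%:R * (2 * delta) = \sum_(i < dim l) (2 * delta).
      by rewrite sumr_const card_ord mulr_natl.
    by apply: ler_sum => i _; apply: prod.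
  by rewrite mulrA; lra.
- have := n2B_tri tauE (f i * f j) (g i * g j) (g j *+ (i == row0 l)).
  have := n2B_tri tauE (f j *+ (i == row0 l)) (f i * f j) (g j *+ (i == row0 l)).
  have := prod _ _ _ _ (f1 i) (g1 j) (gf i) (gf j).
  have : n2 (f j *+ (i == row0 l) - g j *+ (i == row0 l)) <= delta.
    by case: eqP; rewrite ?mulr1n // !mulr0n subrr (n20 tauE).
  by have := r3 i j; lra.
Qed.

(** [delta] depends on [l] and [eta] only. The level [L] to which the [f j] are compressed depends
    on [f], but the conjugacy estimate at that level does not involve [L]. *)
Lemma row_conjugacy l eta : 0 < eta -> exists2 delta : K, 0 < delta &
  forall f : 'I_(dim l) -> vn A, (forall j,
    op_le 1 (f j)) -> row_relations f delta ->
  exists2 u, unitary u & forall j, n2 (u * f j * vn_adj u - row_unit j) < eta.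
Proof.
move=> eta0; set n := dim l.
have n1 : (1 : K) <= n%:R by rewrite ler1n dim_gt0.
(* The conjugacy error n (2 rho + 9 dt) is at most 11 n rho and compression adds at most rho; 13
   leaves room for a strict inequality. [delta] is [dt] divided by the loss in
   [row_relations_approx]. *)
pose rho := Num.min 1 (eta / (13 * n%:R)).
have n0 : (0 : K) < n%:R by lra.
have rho0 : 0 < rho by rewrite lt_min ltr01 divr_gt0 // mulr_gt0.
have rho1 : rho <= 1 by rewrite ge_min lexx.
have rhon : rho * (13 * n%:R) <= eta.
  by rewrite -ler_pdivlMr ?mulr_gt0 // ge_min lexx orbT.
pose dt := rho ^+ 2 / 152; have dt0 : 0 < dt by rewrite divr_gt0 ?exprn_gt0.
have dtr : dt <= rho.
  by rewrite /dt ler_pdivrMr // expr2 ler_pM2l //; lra.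
pose delta := dt / (n%:R * 2 + 4).
have nn0 : 0 < n%:R * 2 + 4 :> K by lra.
have de0 : 0 < delta by rewrite divr_gt0.
have dE : n%:R * 2 * delta + 4 * delta = dt.
  by rewrite -mulrDl mulrC divfK //; apply: lt0r_neq0.
have ded : delta <= dt by rewrite /delta ler_pdivrMr // ler_peMr ?ltW //; lra.
exists delta => // f f1 fR.
have /choice[l0 l0P] : forall j, exists l0 : nat, forall L, (l0 <= L)%N ->
    n2 (f j - expect xi (rep L) (f j)) < delta.
  by move=> j; exact: (tower_approx tauE piP piC vN_gen (f j) de0).
pose L := maxn l (\max_j l0 j).
have lL : (l <= L)%N by apply: leq_maxl.
have jL j : (l0 j <= L)%N by apply: leq_trans (leq_maxr _ _); apply: leq_bigmax.
have /choice[E EP] : forall j : 'I_n, exists Y : 'M[K[i]]_(dim L),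
  rep L Y = @row_unit l j.
  by move=> j; exact: (mrep_nestW piP piC vN_gen (delta_mx (row0 l) j) lL).
have RL := repP L; have Rl := repP l.
pose F j := proj_mx xi (rep L) (sval (f j) xi).
have g1 j : op_le 1 (rep L (F j)) :=
  expect_op_le tauE RL (dim_gt0 L) ler01 (f1 j).
have gR : row_relations (fun j => rep L (F j)) dt.
  by rewrite -dE; apply: row_relations_approx fR => // j; apply/ltW/l0P.
have one0 : (0 : K) <= 1 by [].
have [g_1 g_2 g_3] := gR.
have [|||||||u uu hu] :=
  @level_conjugacy _ _ _ tauE _ _ RL (dim_gt0 L) n (row0 l) E F
   _ g1 _ _ _ dt rho _ _ _ g_1 g_2 g_3.
- by move=> j; rewrite EP; apply: row_unit_op.
- move=> i j; apply: (mxrep_inj RL); rewrite (mxrepM RL) (mxrep_adj RL) !EP.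
  rewrite /row_unit (mxrep_delta_adj Rl) (mxrep_deltaM Rl) eq_sym.
  by case: eqP => _; rewrite ?mulr1n ?EP // !mulr0n (mxrep0 RL).
- by apply: (mxrep_inj RL); rewrite (mxrep_adj RL) EP (mxrep_delta_adj Rl).
- rewrite EP (mxrep_tau_delta Rl) eqxx mul1r -(rmorph_nat (real_complex K))
  -fmorphV.
  by [].
- by rewrite dt0; lra.
- exact: ltW.
- by rewrite /dt; lra.
exists u => // j; have := hu j; rewrite EP => h.
have -> : u * f j * vn_adj u - row_unit j =
   u * (f j - rep L (F j)) * vn_adj u + (u * rep L (F j) * vn_adj u - row_unit j).
  by rewrite mulrBr mulrBl addrA subrK.
apply: le_lt_trans (n2D tauE _ _) _.
rewrite (n2_unitaryr tauE _ (unitary_adj uu)) (n2_unitaryl tauE _ uu).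
have := l0P j L (jL j); rewrite -/(rep L (F j)) => h2.
have h3 : n%:R * (2 * rho + 9 * dt) <= n%:R * (11 * rho).
  by rewrite ler_pM2l //; lra.
have h4 : rho <= n%:R * rho by rewrite ler_peMl // ltW.
rewrite /expect -/(F j) in h2; nra.
Qed.

Lemma ratr_dense (x : K) e : 0 < e -> exists q : rat, `|x - ratr q| < e.
Proof.
move=> e0; have [q] := @rat_in_itvoo K (x - e) (x + e) ltac:(lra).
by rewrite in_itv /= => /andP[h1 h2]; exists q; rewrite ltr_norml; lra.
Qed.

Lemma gauss_dense (z : K[i]) e : 0 < e -> exists q : gauss,
  cabs (z - gaussC K q) < e.
Proof.
move=> e0; have e2 : 0 < e / 2 by lra.
have [p hp] := ratr_dense (complex.Re z) e2;
  have [q hq] := ratr_dense (complex.Im z) e2.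
exists (p, q).
have ci : cabs 'i%C = 1 :> K
  by rewrite /cabs normc_def /= expr0n expr1n add0r sqrtr1.
have -> : z - gaussC K (p,
  q) = (complex.Re z - ratr p)%:C + 'i%C * (complex.Im z - ratr q)%:C.
  by rewrite /gaussC /=; case: z {hp hq} => a b; simpc.
have := cabsD (complex.Re z - ratr p)%:C ('i%C * (complex.Im z - ratr q)%:C).
by rewrite cabsM ci mul1r !cabs_real; lra.
Qed.

(** For a genuine row [f_i^* f_j] is the unit e_ij, so these are the matrices with Gaussian rational
    entries, the only scalars of the language, written in terms of the row alone. *)
Definition row_comb l (q : 'I_(dim l) -> 'I_(dim l) -> gauss) (f : 'I_(dim l)
  -> vn A) :=
  \sum_i \sum_j gaussC K (q i j) *: (vn_adj (f i) * f j).

Lemma rational_approx (x : vn A) e : 0 < e -> exists l0 : nat, forall l,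
  (l0 <= l)%N ->
  exists q, n2 (x - row_comb q (@row_unit l)) < e.
Proof.
move=> e0; have e2 : 0 < e / 2 by lra.
have [l0 l0P] := tower_approx tauE piP piC vN_gen x e2; exists l0 => l /l0P h.
have P := repP l; move: h; rewrite /expect; set X := proj_mx _ _ _ => h.
set n := dim l; have n1 : (1 : K) <= n%:R by rewrite ler1n dim_gt0.
have n0 : (0 : K) < n%:R by lra.
have e3 : 0 < e / (4 * n%:R ^+ 2) by rewrite divr_gt0 // mulr_gt0 // exprn_gt0.
have [q qP] : exists q : 'I_n -> 'I_n -> gauss, forall i j,
    cabs (X i j - gaussC K (q i j)) < e / (4 * n%:R ^+ 2).
  have /choice[q qP] : forall ij : 'I_n * 'I_n, exists q : gauss,
      cabs (X ij.1 ij.2 - gaussC K q) < e / (4 * n%:R ^+ 2).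
    by move=> ij; apply: gauss_dense.
  by exists (fun i j => q (i, j)) => i j; apply: (qP (i, j)).
exists q; have := n2B_tri tauE (rep l X) x (row_comb q (@row_unit l)).
suff : n2 (rep l X - row_comb q (@row_unit l)) <= e / 4 by lra.
rewrite /row_comb (mxrep_delta P) -sumrB.
have sumc (c : K) : n%:R * c = \sum_(i < n) c
  by rewrite sumr_const card_ord mulr_natl.
have -> : e / 4 = \sum_(i < n) \sum_(j < n) e / (4 * n%:R ^+ 2).
  by rewrite -!sumc; field; apply: lt0r_neq0.
apply: le_trans (n2_sum tauE _ _ _) _; apply: ler_sum => i _.
rewrite -sumrB; apply: le_trans (n2_sum tauE _ _ _) _; apply: ler_sum => j _.
rewrite row_unit_adjM -scalerBl (n2Z tauE) -[leRHS]mulr1; apply: ler_pM.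
- exact: cabs_ge0.
- exact: (n2_ge0 tauE).
- exact/ltW/qP.
by apply: (n2_op_le tauE); apply: mxrep_delta_op.
Qed.

End RowConjugacyTower.

(** * Formulas and continuity *)

Definition embedding (K : realType) (M N : prestructure K)
    (f : forall k, M k -> N k) :=
  (forall k (x y : M k), sdist N (f k x) (f k y) = sdist M x y) /\
  f _ (szero M) = szero N /\
  f _ (sone M) = sone N /\
  (forall k l (x : M k) (y : M l), f _ (sadd M x y) = sadd N (f k x) (f l y)) /\
  (forall k l (x : M k) (y : M l), f _ (smul M x y) = smul N (f k x) (f l y)) /\
  (forall k (x : M k), f _ (sadj M x) = sadj N (f k x)) /\
  (forall q k m (h : scal_dom q k m) (x : M k),
     f _ (sscal M q h x) = sscal N q h (f k x)) /\
  (forall k l (h : (radius k <= radius l)%N) (x : M k),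
     f _ (sincl M h x) = sincl N h (f k x)) /\
  (forall k (x : M k), sretr N (f k x) = sretr M x) /\
  (forall k (x : M k), simtr N (f k x) = simtr M x).

Section Formulas.
Variables (K : realType) (S : connectives K).

(** The support of a term appears only as a list outside which assignments may differ, the same for
    all structures. This is what makes constants fresh. *)
Lemma term_val_eq (I : eqType) (s : I -> positive) k (t : term s k) :
  exists l : seq I, forall (M : prestructure K) (a b : forall i, M (s i)),
    (forall i, i \in l -> a i = b i) -> term_val a t = term_val b t.
Proof.
elim: t => [i|||k1 k2 t [l IH] u [l' IH']|k1 k2 t [l IH] u [l' IH']|k1 t [l IH]
           |q k1 k2 h t [l IH]|k1 k2 h t [l IH]].
- by exists [:: i] => M a b ab; apply: ab; rewrite mem_head.
- by exists [::].
- by exists [::].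
- exists (l ++ l') => M a b ab /=; rewrite (IH _ a b) ?(IH' _ a b) // => i il;
    by apply: ab; rewrite mem_cat il ?orbT.
- exists (l ++ l') => M a b ab /=; rewrite (IH _ a b) ?(IH' _ a b) // => i il;
    by apply: ab; rewrite mem_cat il ?orbT.
- by exists l => M a b ab /=; rewrite (IH _ a b).
- by exists l => M a b ab /=; rewrite (IH _ a b).
- by exists l => M a b ab /=; rewrite (IH _ a b).
Qed.

Lemma atomic_val_eq (I : eqType) (s : I -> positive) (phi : atomic s) :
  exists l : seq I, forall (M : prestructure K) (a b : forall i, M (s i)),
    (forall i, i \in l -> a i = b i) -> atomic_val a phi = atomic_val b phi.
Proof.
case: phi => [k t u|k t|k t].
- have [l lP] := term_val_eq t; have [l' lP'] := term_val_eq u.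
  exists (l ++ l') => M a b ab /=; rewrite (lP _ a b) ?(lP' _ a b) // => i il;
    by apply: ab; rewrite mem_cat il ?orbT.
- by have [l lP] := term_val_eq t; exists l => M a b ab /=; rewrite (lP _ a b).
- by have [l lP] := term_val_eq t; exists l => M a b ab /=; rewrite (lP _ a b).
Qed.

Lemma qf_val_eq (I : eqType) (s : I -> positive) (phi : qf_formula S s) :
  exists l : seq I, forall (M : prestructure K) (a b : forall i, M (s i)),
    (forall i, i \in l -> a i = b i) -> qf_val a phi = qf_val b phi.
Proof.
elim: phi => [phi|c args IH]; first exact: atomic_val_eq.
have [l lP] := choice IH; exists (flatten [seq l i | i : 'I_(carity c)]).
move=> M a b ab /=; congr (cfun _); apply/rowP => j; rewrite !mxE.
apply: lP => i il; apply: ab; apply/flattenP; exists (l j) => //.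
by apply: map_f; rewrite mem_enum.
Qed.

Lemma term_val_emb (M N : prestructure K) f (I : Type) (s : I -> positive)
    (a : forall i, M (s i)) k (t : term s k) : @embedding K M N f ->
  term_val (fun i => f _ (a i)) t = f _ (term_val a t).
Proof.
case=> _ [f0 [f1 [fadd [fmul [fadj [fscal [fincl _]]]]]]].
elim: t => //= [k1 k2 t -> u ->|k1 k2 t -> u ->|k1 t ->|q k1 k2 h t ->|k1 k2 h
  t ->].
- by rewrite fadd.
- by rewrite fmul.
- by rewrite fadj.
- by rewrite fscal.
- by rewrite fincl.
Qed.

Lemma qf_val_emb (M N : prestructure K) f (I : Type) (s : I -> positive)
    (a : forall i, M (s i)) (phi : qf_formula S s) : @embedding K M N f ->
  qf_val (fun i => f _ (a i)) phi = qf_val a phi.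
Proof.
move=> fP; have [fd [_ [_ [_ [_ [_ [_ [_ [fre fim]]]]]]]]] := fP.
elim: phi => [[k t u|k t|k t]|c args IH] /=.
- by rewrite !term_val_emb.
- by rewrite !term_val_emb.
- by rewrite !term_val_emb.
- by congr (cfun _); apply/rowP => j; rewrite !mxE.
Qed.

Variables (M : prestructure K) (Ms : is_structure M).

Lemma sdist_ge0 k (x y : M k) : 0 <= sdist M x y.
Proof.
have := st_dist_triangle Ms x y x; rewrite (st_dist_sym Ms y x).
by rewrite (proj2 (st_dist0 Ms x x) erefl); lra.
Qed.

Lemma sdistxx k (x : M k) : sdist M x x = 0.
Proof. exact: (proj2 (st_dist0 Ms x x) erefl). Qed.

Section Convergence.
Variables (I : Type) (s : I -> positive).
Variables (a : nat -> forall i, M (s i)) (b : forall i, M (s i)).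
Hypothesis ab : forall i, lim_to (fun n => sdist M (a n i) (b i)).

Lemma term_val_lim k (t : term s k) :
  lim_to (fun n => sdist M (term_val (a n) t) (term_val b t)).
Proof.
have l0 : lim_to (fun=> 0 : K) by move=> e e0; exists 0%N.
elim: t => [i|||k1 k2 t IH u IH'|k1 k2 t IH u IH'|k1 t IH|q k1 k2 h t IH|k1 k2
  h t IH] /=.
- exact: ab.
- by apply: lim_to_le l0 => n; rewrite sdistxx.
- by apply: lim_to_le l0 => n; rewrite sdistxx.
- by apply: lim_to_le (lim_toD IH IH') => n; apply: st_add.
- by apply: lim_to_le (lim_toD (lim_toM (ler0n _ _) IH) (lim_toM (ler0n _ _)
  IH')) => n;
    apply: st_mul.
- by apply: lim_to_le IH => n; apply: st_adj.
- by apply: lim_to_le (lim_toM (sqrtr_ge0 _) IH) => n; apply: st_scal.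
- by apply: lim_to_le IH => n; apply: st_incl.
Qed.

Lemma atomic_val_lim (phi : atomic s) :
  lim_to (fun n => `|atomic_val (a n) phi - atomic_val b phi|).
Proof.
case: phi => [k t u|k t|k t] /=.
- apply: lim_to_le (lim_toD (term_val_lim t) (term_val_lim u)) => n.
  set x := term_val (a n) t; set x' := term_val b t.
  set y := term_val (a n) u; set y' := term_val b u.
  have := st_dist_triangle Ms x x' y; have := st_dist_triangle Ms x' y' y.
  have := st_dist_triangle Ms x' x y'; have := st_dist_triangle Ms x y y'.
  by rewrite (st_dist_sym Ms x' x) (st_dist_sym Ms y' y) ler_norml; lra.
- by apply: lim_to_le (term_val_lim t) => n; apply: st_retr.
- by apply: lim_to_le (term_val_lim t) => n; apply: st_imtr.
Qed.

Lemma cvg_row m (u : nat -> 'I_m -> K) (l : 'I_m -> K) :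
  (forall i, (fun n => u n i) @ \oo --> l i) ->
  (fun n => \row_i u n i) @ \oo --> \row_i l i.
Proof.
move=> ul; apply/cvg_ballP => e e0.
have : \forall n \near \oo, forall i, ball (l i) e (u n i).
  by apply: filter_forall => i; move/cvg_ballP: (ul i); apply.
by apply: filterS => n nP; split=> // i j; rewrite !mxE; apply: nP.
Qed.

(** Connectives are merely continuous, so the Lipschitz estimates end with atomic formulas and
    convergence is topological from there on. *)
Lemma qf_val_cvg (phi : qf_formula S s) :
  (fun n => qf_val (a n) phi) @ \oo --> qf_val b phi.
Proof.
elim: phi => [phi|c args IH] /=.
  apply/cvgrPdist_lt => e e0; have [n nP] := atomic_val_lim phi e0.
  by exists n => // m /= /nP; rewrite distrC.
apply: continuous_cvg; first exact: cfun_continuous.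
exact: cvg_row.
Qed.

End Convergence.
End Formulas.

(** * From a model of the universal theory back to the structure itself *)

Section Substitution.
Variables (K : realType) (S : connectives K).
Variables (I J : Type) (s : I -> positive) (s' : J -> positive).
Variable sigma : forall i, term s' (s i).

Fixpoint term_subst k (t : term s k) : term s' k :=
  match t in term _ k return term s' k with
  | TVar i => sigma i
  | TZero => TZero s'
  | TOne => TOne s'
  | TAdd _ _ t u => TAdd (term_subst t) (term_subst u)
  | TMul _ _ t u => TMul (term_subst t) (term_subst u)
  | TAdj _ t => TAdj (term_subst t)
  | TScal q _ _ h t => TScal h (term_subst t)
  | TIncl _ _ h t => TIncl h (term_subst t)
  end.

Definition atomic_subst (phi : atomic s) : atomic s' :=
  match phi with
  | ADist _ t u => ADist (term_subst t) (term_subst u)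
  | AReTr _ t => AReTr (term_subst t)
  | AImTr _ t => AImTr (term_subst t)
  end.

(** The image uses [all_connectives] because universal sentences are built from all continuous
    connectives, not only from those in [S]. *)
Fixpoint qf_subst (phi : qf_formula S s) : qf_formula (all_connectives K) s' :=
  match phi with
  | QAtom phi => QAtom _ (atomic_subst phi)
  | QConn c args =>
      @QConn _ (all_connectives K) _ _
        (existT _ (carity c) (exist _ (@cfun _ _ c) (@cfun_continuous _ _ c)))
        (fun i => qf_subst (args i))
  end.

Variables (M : prestructure K) (b : forall j, M (s' j)).
Let a i : M (s i) := term_val b (sigma i).

Lemma term_val_subst k (t : term s k) : term_val b (term_subst t) = term_val a t.
Proof.
by elim: t => //= [k1 k2 t -> u ->|k1 k2 t -> u ->|k1 t ->|q k1 k2 h t ->|k1 k2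
  h t ->].
Qed.

Lemma qf_val_subst (phi : qf_formula S s) : qf_val b (qf_subst phi) = qf_val a
  phi.
Proof.
elim: phi => [[k t u|k t|k t]|c args IH] /=; rewrite ?term_val_subst //.
by congr (cfun _); apply/rowP => j; rewrite !mxE.
Qed.

Definition cap_fun (r : K) (x : 'rV[K]_2) : K :=
  Num.min (Num.max 0 (r - x 0 0)) (x 0 1).

Lemma cap_fun_continuous r : continuous (cap_fun r).
Proof.
move=> x; have := (@continuous_min K _ (fun x : 'rV[K]_2 =>
  Num.max 0 (r - x 0 0)) (fun x : 'rV[K]_2 => x 0 1) x). apply.
  apply: (@continuous_max K _ (fun=> 0) (fun x : 'rV[K]_2 => r - x 0 0)).
    exact: cst_continuous.
  apply: (@continuousB K K^o _ (fun=> r) (fun x : 'rV[K]_2 => x 0 0)).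
    exact: cst_continuous.
  exact: coord_continuous.
exact: coord_continuous.
Qed.

Lemma cst1_continuous : continuous (fun _ : 'rV[K]_0 => 1 : K).
Proof. by move=> x; apply: cst_continuous. Qed.

(* Positive exactly when all the conditions of [p] hold.  It is capped at 1 so
   that its supremum is over a bounded set in every structure. *)
Fixpoint sat_formula (p : seq (qf_formula S s * K)) : qf_formula
  (all_connectives K) s' :=
  if p is (phi, r) :: p' then
    @QConn _ (all_connectives K) _ _
      (existT _ 2%N (exist _ (cap_fun r) (@cap_fun_continuous r)))
      (fun i : 'I_2 => if i == 0 then qf_subst phi else sat_formula p')
  else @QConn _ (all_connectives K) _ _
      (existT _ 0%N (exist _ _ cst1_continuous)) (fun=> QAtom _ (AReTr (TZero
        s'))).

Lemma sat_formulaP p :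
  [/\ 0 <= qf_val b (sat_formula p), qf_val b (sat_formula p) <= 1 &
      (0 < qf_val b (sat_formula p)) = all (fun e => qf_val a e.1 < e.2) p].
Proof.
elim: p => [|[phi r] p [h0 h1 hp]]; first by rewrite /= ltr01 lexx ler01.
have -> : qf_val b (sat_formula ((phi, r) :: p)) =
    Num.min (Num.max 0 (r - qf_val a phi)) (qf_val b (sat_formula p)).
  by rewrite /= /cap_fun !mxE /= qf_val_subst.
split.
- by rewrite le_min le_max lexx.
- by rewrite ge_min h1 orbT.
- by rewrite lt_min lt_max ltxx /= subr_gt0 hp.
Qed.

End Substitution.

Definition const_code (c : const) : nat * nat := (Pos.to_nat c.1, c.2).
Definition const_decode (x : nat * nat) : const := (Pos.of_nat x.1, x.2).
Lemma const_codeK : cancel const_code const_decode.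
Proof. by case=> k n; rewrite /const_decode /= Pos2Nat.id. Qed.
HB.instance Definition _ := Countable.copy const (can_type const_codeK).

Section Transfer.
Variables (K : realType) (S : connectives K) (M : prestructure K).

Lemma radius_ge1 k : (radius 1%positive <= radius k)%N.
Proof. by rewrite /radius; have := Pos2Nat.is_pos k; move/ssrnat.ltP. Qed.

Definition zero_term (I : Type) (s : I -> positive) k : term s k :=
  TIncl (radius_ge1 k) (TZero s).

(** The constants in [l] become variables of a universal sentence. Any other constant becomes 0; the
    formulas to which this is applied do not depend on it. *)
Definition tuple_subst (l : seq const) (c : const) :
    term (fun i : 'I_(size l) =>
      const_sort (tnth (in_tuple l) i)) (const_sort c) :=
  match pselect (exists i, tnth (in_tuple l) i = c) with
  | left h => eq_rect _ (fun c => term _ (const_sort c))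
                (TVar _ (sval (cid h))) c (svalP (cid h))
  | right _ => zero_term _ _
  end.

Lemma tuple_subst_val (N : prestructure K) (a : forall c,
  N (const_sort c)) (l : seq const) c :
  c \in l -> term_val (fun i => a (tnth (in_tuple l) i)) (tuple_subst l c) = a c.
Proof.
move=> cl; rewrite /tuple_subst; case: pselect => [h|]; last first.
  by case; have /tnthP[i ->] : c \in in_tuple l by []; exists i.
by move: (svalP (cid h)); move: (sval (cid h)) => i e; destruct e.
Qed.

(* Otherwise the universal sentence [sup sat_formula = 0] would hold in [M],
   hence in the model that witnesses the condition. *)
Lemma condition_sat (p : set (expr S)) : condition (Th_forall M) p ->
  exists a : forall c, M (const_sort c), forall phi r, p (phi,
    r) -> qf_val a phi < r.
Proof.
case=> [/(@finite_seqP {classic expr S})[q pq] [N [Ns NT Np]]].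
have /choice[sup supP] := fun phi : qf_formula S const_sort => qf_val_eq phi.
pose l := flatten [seq sup e.1 | e <- (q : seq {classic expr S})].
have lP e : e \in q -> {subset sup e.1 <= l}.
  by move=> eq c ce; apply/flattenP; exists (sup e.1) => //;
    exact: (@map_f {classic (expr S)} _ (fun e => sup e.1)).
have supl e (N' : prestructure K) (a b : forall c, N' (const_sort c)) : e \in q ->
    (forall c, c \in l -> a c = b c) -> qf_val a e.1 = qf_val b e.1.
  by move=> eq ab; apply: supP => c /(lP _ eq); apply: ab.
pose sigma : universal_sentence K := {|
  uvars := size l;
  usort := fun i => const_sort (tnth (in_tuple l) i);
  umatrix := sat_formula (tuple_subst l) q;
  umatrix_ge0 := fun M' _ a =>
    let: And3 h _ _ := sat_formulaP (tuple_subst l) a q in h |}.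
apply: contrapT => na.
have val0 (b : forall i, M (usort (u := sigma) i)) : qf_val b (umatrix sigma) = 0.
  have [h0 _ h] := sat_formulaP (tuple_subst l) b q; apply/eqP.
  rewrite eq_le h0 andbT leNgt [X in ~~ X]h;
    apply/negP => /(@allP {classic (expr S)}) allq.
  apply: na; exists (fun c => term_val b (tuple_subst l c)) => phi r.
  rewrite pq => /= /allq; exact.
have TM : Th_forall M sigma.
  rewrite /Th_forall /= /universal_val (_ : [set r | _] = [set 0]) ?sup1 //.
  apply/seteqP; split => [r [a ->]|r ->]; first exact: val0.
  (* An assignment is needed to see that the set is not empty; each variable gets the zero of its
     sort. *)
  by exists (fun i => term_val (fun c : void =>
    match c with end) (zero_term (fun c : void => 1%positive) _)).
have := NT _ TM; rewrite /universal_val; set V := [set r | _] => V0.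
pose b (i : 'I_(size l)) := cst N (tnth (in_tuple l) i).
have [_ b1 bq] := sat_formulaP (tuple_subst l) b q.
have : qf_val b (umatrix sigma) <= 0.
  rewrite -V0; apply: ub_le_sup; last by exists b.
  by exists 1 => r [a ->]; case: (sat_formulaP (tuple_subst l) a q).
apply/negP; rewrite -ltNge [X in is_true X]bq;
  apply/(@allP {classic (expr S)}) => e eq /=.
rewrite (supl e N _ (@cst K N)) //; last by move=> c cl; apply: tuple_subst_val.
by case: e eq => phi r eq; apply: Np; rewrite pq.
Qed.

End Transfer.

(** * Enumeration of atomic sentences *)

Section CountableTerms.

Let sterm := {k : positive & term const_sort k}.
Let T := GenTree.tree nat.

(** The sorts of subterms and the side conditions are not recorded: the former are recovered
    together with the subterm, the latter are propositions. *)
Fixpoint term_code k (t : term const_sort k) : T :=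
  match t with
  | TVar i => GenTree.Node 0 [:: GenTree.Leaf (pickle i)]
  | TZero => GenTree.Node 1 [::]
  | TOne => GenTree.Node 2 [::]
  | TAdd _ _ t u => GenTree.Node 3 [:: term_code t; term_code u]
  | TMul _ _ t u => GenTree.Node 4 [:: term_code t; term_code u]
  | TAdj _ t => GenTree.Node 5 [:: term_code t]
  | TScal q _ m _ t =>
      GenTree.Node 6 [:: GenTree.Leaf (pickle (q : rat * rat));
                         GenTree.Leaf (Pos.to_nat m); term_code t]
  | TIncl _ l _ t => GenTree.Node 7 [:: GenTree.Leaf (Pos.to_nat l); term_code t]
  end.

Let pack k (t : term const_sort k) : sterm := existT _ k t.

Let add_code (x y : sterm) : sterm := pack (TAdd (projT2 x) (projT2 y)).
Let mul_code (x y : sterm) : sterm := pack (TMul (projT2 x) (projT2 y)).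
Let adj_code (x : sterm) : sterm := pack (TAdj (projT2 x)).
Let scal_code q m (x : sterm) : sterm :=
  if @idP (scal_dom q (projT1 x) m) is ReflectT h then pack (TScal h (projT2
    x)) else x.
Let incl_code l (x : sterm) : sterm :=
  if @idP (radius (projT1 x) <= radius l)%N is ReflectT h
  then pack (TIncl h (projT2 x)) else x.

Lemma term_code_inj k (t : term const_sort k) l (u : term const_sort l) :
  term_code t = term_code u -> existT _ k t = existT _ l u :> sterm.
Proof.
have scalE q k' m (h : scal_dom q k' m) (v : term const_sort k') :
    pack (TScal h v) = scal_code q m (pack v).
  rewrite /scal_code; case: {-}_ / idP => [h'|/(_ h)//] /=.
  by rewrite (Prop_irrelevance h h').
have inclE k' l' (h : (radius k' <= radius l')%N) (v : term const_sort k') :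
    pack (TIncl h v) = incl_code l' (pack v).
  rewrite /incl_code; case: {-}_ / idP => [h'|/(_ h)//] /=.
  by rewrite (Prop_irrelevance h h').
elim: t l u => [i|||k1 k2 t1 IH1 t2 IH2|k1 k2 t1 IH1 t2 IH2|k1 t1 IH1
  |q k1 m h t1 IH1|k1 k2 h t1 IH1] l [j|||l1 l2 u1 u2|l1 l2 u1 u2|l1 u1
  |q' l1 m' h' u1|l1 l2 h' u1] //=.
- by case=> /(pcan_inj pickleK) ->.
- by case=> /IH1 e1 /IH2 e2; exact: (congr2 add_code e1 e2).
- by case=> /IH1 e1 /IH2 e2; exact: (congr2 mul_code e1 e2).
- by case=> /IH1 e1; exact: (congr1 adj_code e1).
- case=> /(pcan_inj pickleK) qq /Pos2Nat.inj mm /IH1 e1; subst q' m'.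
  rewrite -/(pack _) scalE -/(pack _) [RHS]scalE.
  exact: (congr1 (scal_code q m) e1).
- case=> /Pos2Nat.inj mm /IH1 e1; subst l2.
  rewrite -/(pack _) inclE -/(pack _) [RHS]inclE.
  exact: (congr1 (incl_code k2) e1).
Qed.

Lemma term_enum : exists e : nat -> sterm, forall x, exists n, e n = x.
Proof.
pose e n := if pselect (exists x : sterm,
  pickle (term_code (projT2 x)) = n) is left h
            then sval (cid h) else pack (TZero const_sort).
exists e => x; exists (pickle (term_code (projT2 x))); rewrite /e.
case: pselect => [h|[]]; last by exists x.
move: (svalP (cid h)) => /(pcan_inj pickleK) /term_code_inj.
have eta (z : sterm) : z = existT _ (projT1 z) (projT2 z) by case: z.
by move=> exy; rewrite [LHS]eta [RHS]eta.
Qed.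

Lemma atomic_enum : exists e : nat -> atomic const_sort, forall phi, exists n,
  e n = phi.
Proof.
have [e eP] := term_enum.
pose mk (c : nat * (nat * nat)) : atomic const_sort :=
  let x := e c.2.1 in let y := e c.2.2 in
  match c.1 with
  | 0 => match pselect (projT1 y = projT1 x) with
         | left h => ADist (projT2 x) (eq_rect _ (term const_sort) (projT2 y) _ h)
         | right _ => AReTr (projT2 x)
         end
  | 1 => AReTr (projT2 x)
  | _ => AImTr (projT2 x)
  end.
exists (fun n => mk (odflt (0, (0, 0))%N (unpickle n))) => phi.
suff [c cP] : exists c, mk c = phi by exists (pickle c); rewrite pickleK.
case: phi => [k t u|k t|k t].
- have [n nP] := eP (existT _ k t); have [m mP] := eP (existT _ k u).
  exists (0, (n, m))%N; rewrite /mk /= nP mP /=; case: pselect => // h.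
  by rewrite (Prop_irrelevance h erefl).
- by have [n nP] := eP (existT _ k t); exists (1, (n, n))%N; rewrite /mk /= nP.
- by have [n nP] := eP (existT _ k t); exists (2, (n, n))%N; rewrite /mk /= nP.
Qed.

End CountableTerms.

(** * Negation by restricted connectives *)

Section Negation.
Variables (K : realType) (S : connectives K).
Hypothesis dense_S : countable_dense S.

Fixpoint qf_comp n (I : Type) (s : I -> positive) (g : composition S n)
    (args : 'I_n -> qf_formula S s) : qf_formula S s :=
  match g with
  | CProj i => args i
  | CComp c h => QConn (fun i => qf_comp (h i) args)
  end.

Lemma qf_val_comp n (I : Type) (s : I -> positive) (g : composition S n)
    (args : 'I_n -> qf_formula S s) (M : prestructure K) (a : forall i, M (s i)) :
  qf_val a (qf_comp g args) = comp_val g (\row_i qf_val a (args i)).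
Proof.
elim: g => [i|c h IH] /=; first by rewrite mxE.
by congr (cfun _); apply/rowP => j; rewrite !mxE.
Qed.

Lemma compact_interval_row (B : K) : compact [set x : 'rV[K]_1 | `|x 0 0| <= B].
Proof.
have := @rV_compact K 1 (fun=> `[- B,
  B]%classic) (fun=> @segment_compact K (- B) B).
congr compact; apply/seteqP; split => x /= h.
  by have := h 0; rewrite /= in_itv /= ler_norml.
by move=> i; rewrite /= in_itv /= -ler_norml (ord1 i).
Qed.

(** Atomic values are bounded in terms of the sort only, so an approximation of x |-> - x on one
    compact interval serves all structures. It lets a condition, which has only upper bounds, bound
    an atomic value from below. *)
Lemma neg_formula (phi : atomic const_sort) (e : K) : 0 < e ->
  exists psi : qf_formula S const_sort,
  forall (M : prestructure K) (a : forall c, M (const_sort c)), is_structure M ->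
    `|qf_val a psi + atomic_val a phi| < e.
Proof.
move=> e0; have [B BP] : exists B : K, forall (M : prestructure K)
    (a : forall c, M (const_sort c)), is_structure M -> `|atomic_val a phi| <= B.
  case: phi => [k t u|k t|k t].
  - exists (2 * (radius k)%:R) => M a Ms /=.
    by rewrite ger0_norm ?sdist_ge0 // st_dist_bound.
  - by exists (radius k)%:R => M a Ms /=; apply: st_retr_bound.
  - by exists (radius k)%:R => M a Ms /=; apply: st_imtr_bound.
have cf : continuous (fun x : 'rV[K]_1 => - x 0 0 : K).
  move=> x; apply: (@continuousN K K^o _ (fun x : 'rV[K]_1 => x 0 0)).
  exact: coord_continuous.
have [g gP] := dense_S.2 0%N _ cf _ (@compact_interval_row B) e e0.
exists (qf_comp g (fun=> QAtom S phi)) => M a Ms.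
have := gP (\row__ atomic_val a phi); rewrite /= mxE opprK qf_val_comp.
by apply; apply: BP.
Qed.

End Negation.

(** * Rigidity of named matrix units *)

Section Update.
Variables (I : eqType) (T : I -> Type) (n : nat) (cs : 'I_n -> I).
Variables (v : forall j, T (cs j)) (a : forall i, T i).

Definition update i : T i :=
  match pselect (exists j, cs j = i) with
  | left h => eq_rect _ T (v (sval (cid h))) i (svalP (cid h))
  | right _ => a i
  end.

Lemma update_notin i : (forall j, cs j != i) -> update i = a i.
Proof.
by move=> ni; rewrite /update; case: pselect => // -[j ji]; have := ni j;
  rewrite ji eqxx.
Qed.

Lemma update_in j : injective cs -> update (cs j) = v j.
Proof.
move=> csi; rewrite /update; case: pselect => [h|[]]; last by exists j.
move: (svalP (cid h)); move: (sval (cid h)) => j' e; have ej := csi _ _ e;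
  subst j'.
by rewrite (Prop_irrelevance e erefl).
Qed.
End Update.

Lemma seq_bound (K : realType) (I : eqType) (f : I -> K) (s : seq I) :
  exists2 B : K, 0 <= B & forall i, i \in s -> f i <= B.
Proof.
elim: s => [|i s [B B0 BP]]; first by exists 0.
exists (Num.max (f i) B); first by rewrite le_max B0 orbT.
move=> j; rewrite inE => /orP[/eqP ->|/BP h]; rewrite le_max ?lexx // h orbT.
by [].
Qed.

Lemma seq_nat_bound (I : eqType) (f : I -> nat) (s : seq I) :
  exists B : nat, forall i, i \in s -> (f i <= B)%N.
Proof.
elim: s => [|i s [B BP]]; first by exists 0%N.
exists (maxn (f i) B) => j; rewrite inE => /orP[/eqP ->|/BP h];
  first exact: leq_maxl.
exact: leq_trans h (leq_maxr _ _).
Qed.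

Section Definable.
Variables (K : realType) (A : tracial_vNa K) (xi : A).
Hypothesis tauE : forall x, @vN K A x -> tau x = dot (x xi) xi.
Local Notation M := (structure_of A).
Definition assignment := forall c : const, M (const_sort c).

(** Forgetting the sort of the term allows elements to be combined as in the algebra; the sorts
    return in [definable_dist], where inclusions bring both sides into one ball. *)
Definition definable (g : assignment -> vn A) :=
  exists k, exists t : term const_sort k, forall a, vn_of (term_val a t) = g a.

Lemma definable_var c : definable (fun a => vn_of (a c)).
Proof. by exists (const_sort c), (TVar const_sort c). Qed.

Lemma definable0 : definable (fun=> 0).
Proof. by exists 1%positive, (TZero const_sort) => a; rewrite /= vn_ofE. Qed.

Lemma definable1 : definable (fun=> 1).
Proof. by exists 1%positive, (TOne const_sort) => a; rewrite /= vn_ofE. Qed.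

Lemma definableD g h : definable g -> definable h -> definable (fun a =>
  g a + h a).
Proof.
by case=> k [t tg] [l [u uh]]; exists (Pos.add k l), (TAdd t u) => a;
  rewrite /= vn_ofE tg uh.
Qed.

Lemma definableM g h : definable g -> definable h -> definable (fun a =>
  g a * h a).
Proof.
by case=> k [t tg] [l [u uh]]; exists (Pos.mul k l), (TMul t u) => a;
  rewrite /= vn_ofE tg uh.
Qed.

Lemma definable_adj g : definable g -> definable (fun a => vn_adj (g a)).
Proof. by case=> k [t tg]; exists k, (TAdj t) => a; rewrite /= vn_ofE tg. Qed.

Lemma scal_dom_exists q k : exists m, scal_dom q k m.
Proof.
pose x := gauss_norm2 q * (radius k)%:R ^+ 2.
have x0 : 0 <= x by rewrite mulr_ge0 ?sqr_ge0 // addr_ge0 ?sqr_ge0.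
pose n := Num.bound x; have xn : x < n%:R by apply: archi_boundP.
exists (Pos.of_nat n.+1); rewrite /scal_dom -/x /radius Nat2Pos.id //.
apply: le_trans (ltW xn) _; rewrite -natrX ler_nat expnS expn1.
by apply: leq_trans (leqnSn n) _; rewrite leq_pmulr.
Qed.

Lemma definableZ q g : definable g -> definable (fun a => gaussC K q *: g a).
Proof.
case=> k [t tg]; have [m h] := scal_dom_exists q k.
by exists m, (TScal h t) => a; rewrite /= vn_ofE tg.
Qed.

Lemma definable_sum (I : Type) (r : seq I) (g : I -> assignment -> vn A) :
  (forall i, definable (g i)) -> definable (fun a => \sum_(i <- r) g i a).
Proof.
move=> gd; elim: r => [|i r IH].
  by case: definable0 => k [t tP]; exists k, t => a; rewrite tP big_nil.
by case: (definableD (gd i) IH) => k [t tP]; exists k, t => a;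
  rewrite tP big_cons.
Qed.

Lemma definable_dist g h : definable g -> definable h ->
  exists phi : atomic const_sort, forall a : assignment,
    atomic_val a phi = n2 (g a - h a).
Proof.
case=> k [t tg] [l [u uh]].
have kl : (radius k <= radius (Pos.add k l))%N.
  by rewrite /radius Pos2Nat.inj_add; apply: leq_addr.
have lk : (radius l <= radius (Pos.add k l))%N.
  by rewrite /radius Pos2Nat.inj_add; apply: leq_addl.
by exists (ADist (TIncl kl t) (TIncl lk u)) => a;
  rewrite [LHS]sdistE !vn_of_incl tg uh.
Qed.

Definition sat (S : connectives K) (a : assignment) (p : set (expr S)) :=
  forall phi r, p (phi, r) -> qf_val a phi < r.

Variable pi : nat -> 'M[K[i]]_2 -> (A -> A).
Hypothesis piP : forall n, unital_star_hom (pi n).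
Hypothesis piC : forall m n a b, m != n -> pi m a \o pi n b = pi n b \o pi m a.
Hypothesis vN_gen :
  @vN K A = commutant (commutant [set x | exists n a, x = pi n a]).
Local Notation row_unit := (row_unit piP vN_gen).

Lemma op_le_conj u (x : vn A) c : 0 <= c -> unitary u -> op_le c x -> op_le c
  (u * x * vn_adj u).
Proof.
move=> c0 uu xc; rewrite -[c]mulr1; apply: op_leM => //;
  last exact: unitary_op_le (unitary_adj uu).
by rewrite -[c]mul1r; apply: op_leM => //; apply: unitary_op_le.
Qed.

Lemma row_comb_conj l q (f : 'I_(dim l) -> vn A) u : unitary u ->
  u * row_comb q f * vn_adj u = row_comb q (fun j => u * f j * vn_adj u).
Proof.
move=> uu; rewrite /row_comb mulr_sumr mulr_suml; apply: eq_bigr => i _.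
rewrite mulr_sumr mulr_suml; apply: eq_bigr => j _.
rewrite -scalerAr -scalerAl !adjM adjK !mulrA; congr (_ *: (_ * _ * _)).
by rewrite -(mulrA _ (vn_adj u) u) uu.2 mulr1.
Qed.

Lemma row_comb_dist l q (f g : 'I_(dim l) -> vn A) eta :
  (forall j, op_le 1 (f j)) -> (forall j, op_le 1 (g j)) ->
  (forall j, n2 (f j - g j) <= eta) ->
  n2 (row_comb q f - row_comb q g) <= (\sum_i \sum_j cabs (gaussC K (q i j))) *
    (2 * eta).
Proof.
move=> f1 g1 fg; rewrite /row_comb -sumrB mulr_suml.
apply: le_trans (n2_sum tauE _ _ _) _; apply: ler_sum => i _.
rewrite -sumrB mulr_suml; apply: le_trans (n2_sum tauE _ _ _) _;
  apply: ler_sum => j _.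
rewrite -scalerBr (n2Z tauE) ler_wpM2l ?cabs_ge0 //.
have -> : vn_adj (f i) * f j - vn_adj (g i) * g j =
    (vn_adj (f i) - vn_adj (g i)) * f j + vn_adj (g i) * (f j - g j).
  by rewrite mulrBl mulrBr addrA subrK.
have := n2D tauE ((vn_adj (f i) - vn_adj (g i)) * f j) (vn_adj (g i) * (f j - g
  j)).
have := n2Mr tauE (vn_adj (f i) - vn_adj (g i)) ler01 (f1 j).
have := n2Ml tauE (f j - g j) (op_le_adj ler01 (g1 i)).
by rewrite -adjB (n2_adj tauE); have := fg i; have := fg j; lra.
Qed.

(* Naming the matrix units of a large enough matrix algebra by fresh constants
   pins down the tuple up to an inner automorphism. *)
Lemma rigidity (S : connectives K) (a : assignment) (F B : seq const) eps :
  0 < eps -> {subset F <= B} -> exists a' : assignment, exists P : set (expr S),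
  [/\ forall c, c \in B -> a' c = a c, finite_set P, sat a' P &
      forall b, sat b P -> exists2 u, unitary u &
        forall c, c \in F -> n2 (u * vn_of (b c) * vn_adj u - vn_of (a c)) < eps].
Proof.
move=> eps0 FB; have eps4 : 0 < eps / 4 by lra.
have /choice[l0 l0P] := fun c : const =>
  rational_approx tauE piP piC vN_gen (vn_of (a c)) eps4.
have [l lP] := seq_nat_bound l0 F.
have /choice[q qP] : forall c, exists q,
  c \in F -> n2 (vn_of (a c) - row_comb q (@row_unit l)) < eps / 4.
  move=> c; case: (boolP (c \in F)) => cF; last by exists (fun _ _ => (0, 0)).
  by have [q qP] := l0P c l (lP c cF); exists q.
pose L c := \sum_i \sum_j cabs (gaussC K (q c i j)).
have [L0 L00 L0P] := seq_bound L F.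
(* A combination whose coefficients have total modulus at most [L0] moves by at most 2 L0 eta <= eps
   / 4; adding 1 avoids a division by 0. *)
have eta0 : 0 < eps / (8 * (L0 + 1)) by rewrite divr_gt0 // mulr_gt0 //; lra.
have [delta delta0 dP] := row_conjugacy tauE piP piC vN_gen l eta0.
have [N NP] := seq_nat_bound (fun c : const => c.2) B.
(* Fresh constants: their indices exceed those of all constants in [B]. *)
pose cs (j : 'I_(dim l)) : const := (1%positive, N.+1 + j)%N.
have csi : injective cs by move=> i j [] /eqP; rewrite eqn_add2l => /eqP;
  apply: val_inj.
have csB c : c \in B -> forall j, cs j != c.
  move=> cB j; apply/eqP => e; have := NP c cB; rewrite -e /= leqNgt.
  by rewrite ltnS leq_addr.
have r1 : (radius 1%positive)%:R = 1 :> K by [].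
have ro j : op_le (radius 1%positive)%:R (@row_unit l j) by rewrite r1;
  apply: row_unit_op.
pose a' : assignment := @update _ (fun c => M (const_sort c)) _ cs (fun j =>
  ball_of (ro j)) a.
have a'cs j : vn_of (a' (cs j)) = row_unit j.
  by rewrite /a' update_in // vn_of_ball.
have fvar j : definable (fun a => vn_of (a (cs j))) by apply: definable_var.
have fb (b : assignment) j : op_le 1 (vn_of (b (cs j))).
  by have := vn_of_op (b (cs j)); rewrite r1.
have /choice[p1 p1P] : forall i, exists phi : atomic const_sort,
  forall b : assignment,
    atomic_val b phi = n2 (vn_of (b (cs i)) * vn_adj (vn_of (b (cs i))) - vn_of
      (b (cs (row0 l)))).
  by move=> i; apply: definable_dist => //; apply: definableM => //;
    apply: definable_adj.
have [p2 p2P] : exists phi : atomic const_sort, forall b : assignment,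
    atomic_val b phi = n2 (\sum_i vn_adj (vn_of (b (cs i))) * vn_of (b (cs i))
      - 1).
  apply: definable_dist; last exact: definable1.
  apply: definable_sum => i; apply: definableM => //; exact: definable_adj.
have /choice[p3 p3P] : forall ij : 'I_(dim l) * 'I_(dim l),
    exists phi : atomic const_sort, forall b : assignment,
    atomic_val b phi = n2 (vn_of (b (cs ij.1)) * vn_of (b (cs ij.2))
                           - vn_of (b (cs ij.2)) *+ (ij.1 == row0 l)).
  move=> [i j]; apply: definable_dist; first exact: definableM.
  by rewrite /=; case: eqP => _; [apply: fvar | apply: definable0].
have /choice[p4 p4P] : forall c, exists phi : atomic const_sort,
  forall b : assignment,
    atomic_val b phi = n2 (vn_of (b c) - row_comb (q c) (fun j =>
      vn_of (b (cs j)))).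
  move=> c; apply: definable_dist; first exact: definable_var.
  apply: definable_sum => i; apply: definable_sum => j; apply: definableZ.
  by apply: definableM => //; apply: definable_adj.
pose P : set (expr S) := range (fun i => (QAtom S (p1 i), delta)) `|`
  ([set (QAtom S p2, delta)] `|` (range (fun ij => (QAtom S (p3 ij), delta)) `|`
  ((fun c => (QAtom S (p4 c), eps / 4)) @` [set` F]))).
exists a', P; split.
- by move=> c cB; rewrite /a' update_notin //; apply: csB.
- rewrite /P !finite_setU; split; first exact: finite_image.
  split; first exact: finite_set1.
  by split; apply: finite_image => //; apply: finite_seq.
- have [h1 h2 h3] := row_unit_exact tauE piP piC vN_gen l (lexx 0).
  move=> phi r [[i _ [<- <-]]|[[-> ->]|[[ij _ [<- <-]]|[c cF [<- <-]]]]] /=.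
  + by rewrite p1P !a'cs; apply: le_lt_trans (h1 i) _.
  + rewrite p2P (eq_bigr (fun i => vn_adj (@row_unit l i) * row_unit i));
    last by move=> i _; rewrite !a'cs.
    exact: le_lt_trans h2 _.
  + by rewrite p3P !a'cs; apply: le_lt_trans (h3 _ _) _.
  + rewrite p4P (_ : (fun j => _) = @row_unit l); last by apply/funext => j;
    rewrite a'cs.
    by rewrite /a' update_notin; [apply: qP | apply/csB/FB].
move=> b bP; pose f j := vn_of (b (cs j)).
have fR : row_relations f delta.
  split=> [i||i j].
  - by rewrite -p1P; apply/ltW/(bP (QAtom S (p1 i))); left; exists i.
  - by rewrite -p2P; apply/ltW/(bP (QAtom S p2)); right; left.
  - by rewrite -(p3P (i, j)); apply/ltW/(bP (QAtom S (p3 (i, j)))); right;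
    right; left; exists (i, j).
have [u uu hu] := dP f (fb b) fR; exists u => // c cF.
have hc : n2 (vn_of (b c) - row_comb (q c) f) < eps / 4.
  by rewrite -p4P; apply: (bP (QAtom S (p4 c))); do 3 right; exists c.
set g := fun j => u * f j * vn_adj u.
have g1 j : op_le 1 (g j) by apply: op_le_conj => //; apply: fb.
have hg := row_comb_dist (q c) g1 (row_unit_op piP piC vN_gen (l :=
  l)) (fun j => ltW (hu j)).
have hL : L c * (2 * (eps / (8 * (L0 + 1)))) <= eps / 4.
  apply: (@le_trans _ _ (L0 * (2 * (eps / (8 * (L0 + 1)))))).
    by rewrite ler_wpM2r ?L0P // mulr_ge0 // ltW.
  have -> : eps / 4 = (L0 + 1) * (2 * (eps / (8 * (L0 + 1)))) by field; lra.
  by rewrite ler_wpM2r //; [rewrite mulr_ge0 // ltW | lra].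
(* Three errors of eps / 4: the conjugated value against its combination, the combination of the
   conjugated row against that of the true row, and the latter against [a c]. *)
have h1 := n2B_tri tauE (row_comb (q c) g) (u * vn_of (b c) * vn_adj u) (vn_of
  (a c)).
have h2 := n2B_tri tauE (row_comb (q c) (@row_unit l)) (row_comb (q c) g)
  (vn_of (a c)).
have h3 := qP c cF; rewrite (n2BC tauE) in h3.
have h4 : n2 (u * vn_of (b c) * vn_adj u - row_comb (q c) g) < eps / 4.
  rewrite -row_comb_conj // -mulrBl -mulrBr (n2_unitaryr tauE _ (unitary_adj uu)).
  by rewrite (n2_unitaryl tauE _ uu).
have h5 := le_trans hg hL; lra.
Qed.

(** A rational matrix close to an element of a ball may leave the ball. A code therefore stands for
    a chosen element of the ball within 1/(m + 1) of a rational matrix, if there is one. *)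
Lemma ball_separable : exists D : nat -> {k : positive & M k},
  forall k (x : M k) e, 0 < e ->
  exists i y, D i = existT _ k y /\ sdist M y x < e.
Proof.
pose code := (nat * {l : nat & 'M[(rat * rat)%type]_(dim l)} * nat)%type.
pose comb (w : {l : nat & 'M[(rat * rat)%type]_(dim l)}) : vn A :=
  row_comb (fun i j => projT2 w i j) (@row_unit (projT1 w)).
pose near (c : code) (y : M (Pos.of_nat c.1.1)) :=
  n2 (vn_of y - comb c.1.2) < c.2.+1%:R^-1.
pose dec (c : code) : {k : positive & M k} :=
  if pselect (exists y, near c y) is left h then existT _ _ (sval (cid h))
  else existT _ _ (szero M).
pose c0 : code := (0%N, existT _ 0%N (const_mx (0, 0)), 0%N).
exists (fun n => dec (odflt c0 (unpickle n))) => k x e e0.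
have e2 : 0 < e / 2 by lra.
pose m := Num.bound (e / 2)^-1.
have me : m.+1%:R^-1 < e / 2.
  rewrite -[ltRHS]invrK ltf_pV2 ?posrE ?invr_gt0 ?ltr0n //.
  apply: lt_le_trans (archi_boundP _) _; first by rewrite invr_ge0 ltW.
  by rewrite ler_nat leqnSn.
have m0 : (0 : K) < m.+1%:R^-1 by rewrite invr_gt0 ltr0n.
have [l /(_ l (leqnn l)) [q qP]] :=
  rational_approx tauE piP piC vN_gen (vn_of x) m0.
pose w : {l : nat & 'M[(rat * rat)%type]_(dim l)} :=
  existT _ l (\matrix_(i, j) q i j).
pose c : code := (Pos.to_nat k, w, m).
exists (pickle c); rewrite pickleK -[odflt _ _]/c.
have wq : comb w = row_comb q (@row_unit l).
  by rewrite /comb /row_comb /=; apply: eq_bigr => i _; apply: eq_bigr => j _;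
    rewrite mxE.
have [y [yD yx]] : exists y : M (Pos.of_nat (Pos.to_nat k)),
  dec c = existT _ _ y /\ n2 (vn_of y - comb w) < m.+1%:R^-1.
  rewrite /dec; case: pselect => [h|[]].
    by exists (sval (cid h)); split=> //; exact: (svalP (cid h)).
  rewrite /near /c /= Pos2Nat.id; exists x; by rewrite wq.
move: y yD yx; rewrite Pos2Nat.id => y yD yx; exists y; split=> //.
rewrite sdistE; have := n2B_tri tauE (comb w) (vn_of y) (vn_of x).
have := qP; rewrite -wq (n2BC tauE) => h1 h2; apply: le_lt_trans h2 _.
by rewrite [e]splitr; apply: ltrD;
  [exact: lt_trans yx me | exact: lt_trans h1 me].
Qed.

End Definable.

(** * The strategy *)

Lemma pow2_lim (K : realType) : lim_to (fun n => (2 ^+ n)^-1 : K).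
Proof.
move=> e e0; have ei : 0 <= e^-1 by rewrite invr_ge0 ltW.
exists (Num.bound e^-1) => n bn;
  rewrite -[ltRHS]invrK ltf_pV2 ?posrE ?invr_gt0 ?exprn_gt0 //.
apply: lt_le_trans (archi_boundP ei) _; rewrite -natrX ler_nat.
by apply: leq_trans bn _; apply: ltnW; apply: ltn_expl.
Qed.

Lemma pow2_gt0 (K : realType) n : 0 < (2 ^+ n)^-1 :> K.
Proof. by rewrite invr_gt0 exprn_gt0. Qed.

Lemma pow2S (K : realType) n : (2 ^+ n)^-1 = 2 * (2 ^+ n.+1)^-1 :> K.
Proof. by rewrite exprS invfM mulrA divff ?mul1r // pnatr_eq0. Qed.

(** With n + 1 = 2^i (2 m + 1) the odd factor makes n large and leaves the valuation unchanged. *)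
Lemma logn2_recurrent i m : exists2 n, (m <= n)%N & logn 2 n.+1 = i.
Proof.
exists (2 ^ i * m.*2.+1).-1.
  rewrite -ltnS prednK ?muln_gt0 ?expn_gt0 //; apply: (@leq_trans m.*2.+1).
    by rewrite ltnS -addnn leq_addr.
  by rewrite leq_pmull // expn_gt0.
rewrite prednK ?muln_gt0 ?expn_gt0 // lognM ?expn_gt0 // pfactorK //.
by rewrite lognE /= dvdn2 /= odd_double addn0.
Qed.

Section Conjugation.
Variables (K : realType) (A : tracial_vNa K) (xi : A).
Hypothesis tauE : forall x, @vN K A x -> tau x = dot (x xi) xi.
Local Notation M := (structure_of A).
Variables (u : vn A) (uu : unitary u).

Definition conj_ball k (x : M k) : M k :=
  ball_of (op_le_conj (ler0n K (radius k)) uu (vn_of_op x)).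

Lemma vn_of_conj k (x : M k) : vn_of (conj_ball x) = u * vn_of x * vn_adj u.
Proof. exact: vn_of_ball. Qed.

Lemma conj_embedding : embedding conj_ball.
Proof.
have u1 := uu.1; have u2 := uu.2; do !split.
- move=> k x y; rewrite !sdistE !vn_of_conj -mulrBl -mulrBr.
  by rewrite (n2_unitaryr tauE _ (unitary_adj uu)) (n2_unitaryl tauE _ uu).
- by apply: vn_of_inj; rewrite vn_of_conj !vn_ofE mulr0 mul0r.
- by apply: vn_of_inj; rewrite vn_of_conj !vn_ofE mulr1 u1.
- by move=> k l x y; apply: vn_of_inj;
  rewrite !vn_ofE !vn_of_conj !vn_ofE mulrDr mulrDl.
- move=> k l x y; apply: vn_of_inj; rewrite !vn_ofE !vn_of_conj !vn_ofE !mulrA.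
  by rewrite -(mulrA _ (vn_adj u) u) u2 mulr1.
- by move=> k x; apply: vn_of_inj;
  rewrite !vn_ofE !vn_of_conj !vn_ofE !adjM adjK mulrA.
- by move=> q k m h x; apply: vn_of_inj;
  rewrite !vn_ofE !vn_of_conj !vn_ofE -scalerAr -scalerAl.
- by move=> k l h x; apply: vn_of_inj; rewrite !vn_ofE !vn_of_conj !vn_ofE.
- by move=> k x; rewrite !sretrE vn_of_conj vn_tauC mulrA u2 mul1r.
- by move=> k x; rewrite !simtrE vn_of_conj vn_tauC mulrA u2 mul1r.
Qed.

End Conjugation.

Section GameProof.
Variables (K : realType) (A : tracial_vNa K) (xi : A).
Hypothesis tauE : forall x, @vN K A x -> tau x = dot (x xi) xi.
Hypothesis cyclic : closure [set x xi | x in @vN K A] = setT.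
Variable pi : nat -> 'M[K[i]]_2 -> (A -> A).
Hypothesis piP : forall n, unital_star_hom (pi n).
Hypothesis piC : forall m n a b, m != n -> pi m a \o pi n b = pi n b \o pi m a.
Hypothesis vN_gen :
  @vN K A = commutant (commutant [set x | exists n a, x = pi n a]).
Variables (S : connectives K) (dense_S : countable_dense S).
Local Notation M := (structure_of A).
Local Notation T := (Th_forall M).
Local Notation assignment := (assignment A).

Let Ms : is_structure M := structure_of_is_structure tauE cyclic.

Variables (D : nat -> {k : positive & M k}) (E : nat -> atomic const_sort).

(** [controlled] lists the constants whose values are to be determined by [played] up to a unitary
    and a small error; only these are compared from one state to the next. *)
Record state := State {
  interp : assignment; played : set (expr S); controlled : seq const }.

Definition rigid (s : state) e :=
  forall b, sat b (played s) -> exists2 u, unitary u &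
  forall c, c \in controlled s -> n2 (u * vn_of (b c) * vn_adj u - vn_of
    (interp s c)) < e.

(* The index [logn 2 n.+1] takes every value infinitely often. *)
Definition answer n (s : state) (q : set (expr S)) (s' : state) :=
  [/\ [/\ q `<=` played s', finite_set (played s'), sat (interp s') (played s') &
          rigid s' (2 ^+ n.+1)^-1],
      forall c, c \in controlled s ->
        n2 (vn_of (interp s' c) - vn_of (interp s c)) < (2 ^+ n)^-1,
      forall phi r, q (phi, r) -> exists2 r', r' < r & played s' (phi, r'),
      exists v, forall (N : LC_structure K), is_structure N ->
        (forall phi r, played s' (phi, r) -> qf_val (@cst K N) phi < r) ->
        `|atomic_val (@cst K N) (E (logn 2 n.+1)) - v| < 2 * (2 ^+ n)^-1 &
      [/\ {subset controlled s <= controlled s'},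
          forall c, (pickle c < n)%N -> c \in controlled s' &
          let d := D (logn 2 n.+1) in
          exists2 i, (projT1 d, i) \in controlled s' & interp s' (projT1 d,
            i) = projT2 d]].

Lemma sat_condition (a : assignment) (p : set (expr S)) : finite_set p -> sat a
  p -> condition T p.
Proof.
move=> fp ap; split=> //; exists (@LCStructure K M a); split=> //.
Qed.

(** A realization of [q] in [M] is conjugated so as to agree nearly with the previous state on the
    controlled constants; [q] still holds, its values being invariant. All that is added concerns
    fresh constants or records, with some margin, what already holds. *)
Lemma answer_exists n s q : rigid s (2 ^+ n)^-1 -> condition T q -> played s
  `<=` q ->
  exists s', answer n s q s'.
Proof.
move=> rs cq sq; have fq := cq.1.
have [b bq] := condition_sat cq.
have [u uu hu] : exists2 u, unitary u & forall c, c \in controlled s ->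
    n2 (u * vn_of (b c) * vn_adj u - vn_of (interp s c)) < (2 ^+ n)^-1.
  by apply: rs => phi r /sq /bq.
pose a1 : assignment := fun c => conj_ball uu (b c).
have a1q : sat a1 q.
  by move=> phi r /bq; rewrite /a1 (qf_val_emb _ _ (conj_embedding tauE uu)).
have /(@finite_seqP {classic expr S})[ql qE] := fq.
have /choice[sup supP] := fun phi : qf_formula S const_sort => qf_val_eq phi.
pose supq := flatten [seq sup e.1 | e <- (ql : seq {classic expr S})].
have supqP e : e \in ql -> {subset sup e.1 <= supq}.
  move=> eq c ce; apply/flattenP; exists (sup e.1) => //.
  exact: (@map_f {classic (expr S)} _ (fun e => sup e.1)).
have sat_ext (a a' : assignment) : (forall c,
  c \in supq -> a' c = a c) -> sat a q -> sat a' q.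
  move=> aa' aq phi r qpr; have := aq phi r qpr;
    rewrite (supP phi M a' a) // => c cs.
  by apply: aa'; apply: (supqP (phi, r)) => //; move: qpr; rewrite qE.
pose B0 := controlled s ++ supq.
have [N NP] := seq_nat_bound (fun c : const => c.2) B0.
(* A constant unknown to [q] and to the state names the next element of the dense sequence. *)
pose d := D (logn 2 n.+1); pose cd : const := (projT1 d, N.+1).
have cdB c : c \in B0 -> cd != c.
  by move=> cB; apply/eqP => e; have := NP c cB; rewrite -e ltnn.
pose a2 : assignment := @update _ (fun c =>
  M (const_sort c)) 1 (fun=> cd) (fun=> projT2 d) a1.
have a2d : a2 cd = projT2 d.
  by apply: (@update_in _ (fun c =>
    M (const_sort c)) 1 (fun=> cd) (fun=> projT2 d) a1 0) => i j _; rewrite !ord1.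
have a2B c : c \in B0 -> a2 c = a1 c.
  by move=> cB; apply: update_notin => j; apply: cdB.
pose F := cd :: controlled s ++ pmap unpickle (iota 0 n).
have [a3 [P [a3F fP a3P rP]]] :=
  @rigidity _ _ _ tauE _ piP piC vN_gen S a2 F (F ++ supq) _ (pow2_gt0 K n.+1)
    (fun c cF => ltac:(by rewrite mem_cat cF)).
have cF c : c \in controlled s -> c \in F by move=> h; rewrite inE mem_cat h orbT.
have a3q : sat a3 q.
  apply: sat_ext a1q => c cs.
  by rewrite a3F ?a2B // /B0 mem_cat cs orbT.
pose phi := E (logn 2 n.+1); pose v := atomic_val a3 phi;
  pose e := (2 ^+ n)^-1 : K.
have e0 : 0 < e by apply: pow2_gt0.
have [psi psiP] := neg_formula dense_S phi e0.
(* The new bound is midway between the present value and the old bound, so it holds at [a3] and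
   leaves a margin. *)
pose p1 : set (expr S) := (fun x : expr S =>
  (x.1, (qf_val a3 x.1 + x.2) / 2)) @` q.
(* As psi + phi has modulus below e, these give v - 2 e < phi < v + e, whence the factor 2 in
   [answer]. *)
pose p2 : set (expr S) := [set (QAtom S phi, v + e)] `|` [set (psi, - v + e)].
exists (State a3 (q `|` (P `|` (p1 `|` p2))) F); split => /=.
- split.
  + by move=> x; left.
  + rewrite !finite_setU; do 2 (split; first by []); split;
    first exact: finite_image.
    by split; apply: finite_set1.
  + move=> f r [|[|[[[g t] gq [<- <-]]|[[-> ->]|[-> ->]]]]] /=.
    * exact: a3q.
    * exact: a3P.
    * by have := a3q g t gq; lra.
    * by rewrite -/v; lra.
    * by have := psiP M a3 Ms; rewrite -/v ltr_norml; lra.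
  + move=> b' b'p; have [|w wu hw] := rP b'; first by move=> f r fP';
    apply: b'p; right; left.
    by exists w => // c cF'; rewrite [interp _]/= a3F ?mem_cat ?cF' //; apply: hw.
- move=> c cs; rewrite a3F ?mem_cat ?cF // a2B; last by rewrite /B0 mem_cat cs.
  by rewrite vn_of_conj; apply: hu.
- move=> f r fq'; exists ((qf_val a3 f + r) / 2); first by have := a3q f r fq';
  lra.
  by right; right; left; exists (f, r).
- exists v => N' N's N'p;
  have h1 := N'p (QAtom S phi) (v + e) ltac:(by do 3 right; left).
  have h2 := N'p psi (- v + e) ltac:(by do 4 right).
  have h3 := psiP N' (@cst K N') N's.
  by move: h1 h2 h3; rewrite /= -/phi -/e !ltr_norml; lra.
split.
- exact: cF.
- move=> c cn; rewrite inE mem_cat; apply/orP; right; apply/orP; right.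
  by rewrite mem_pmap; apply/mapP; exists (pickle c);
    rewrite ?pickleK // mem_iota.
exists N.+1; first exact: mem_head.
have a3cd : a3 cd = a2 cd by apply: a3F; rewrite mem_cat mem_head.
exact: etrans a3cd a2d.
Qed.

(** A strategy has to reply at every position, also after earlier replies other than its own, where
    an answer need not exist. Then [q] is repeated, which is still legal. *)
Definition next n (s : state) (q : set (expr S)) : state :=
  if pselect (exists s', answer n s q s') is left h then sval (cid h)
  else State (interp s) q (controlled s).

Lemma nextP n s q : (exists s', answer n s q s') -> answer n s q (next n s q).
Proof. by move=> h; rewrite /next; case: pselect => // h';
  exact: (svalP (cid h')). Qed.

Lemma next_condition n s q : condition T q ->
  condition T (played (next n s q)) /\ q `<=` played (next n s q).
Proof.
move=> cq; rewrite /next; case: pselect => [h|_]; last by split=> //= x.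
have [[qs fs ss _] _ _ _ _] := svalP (cid h); split=> //.
exact: sat_condition ss.
Qed.

Definition start : state :=
  State (fun c => sincl M (radius_ge1 (const_sort c)) (szero M)) set0 [::].

Lemma start_rigid e : rigid start e.
Proof.
by move=> b _; exists 1 => //; split; rewrite adj1 mulr1.
Qed.

(** The history of a play contains no states; they are recomputed from the moves [q] of the first
    player. *)
Fixpoint run (q : nat -> set (expr S)) n : state :=
  next n (if n is m.+1 then run q m else start) (q n).

Lemma run_eq q q' n : (forall i, (i <= n)%N -> q i = q' i) -> run q n = run q' n.
Proof.
elim: n => [|n IH] qq /=; first by rewrite qq.
by rewrite qq // IH // => i /leqW; apply: qq.
Qed.

Definition answers (h : seq (set (expr S))) : set (expr S) :=
  played (run (fun i => nth set0 h i.*2) (size h)./2).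

Lemma answers_strategy : strategy T answers.
Proof.
move=> h [hc _] oh; rewrite -nth_last.
have sh : size h = ((size h)./2).*2.+1 by rewrite -[LHS]odd_double_half oh.
rewrite /answers; set n := (size h)./2 in sh *; rewrite sh /=.
have cn : condition T (nth set0 h n.*2) by apply: hc; rewrite sh.
by case: n {sh} cn => [|n] cn /=; apply: next_condition.
Qed.

(** * The limit of a play *)

Section Play.
Variable p : nat -> set (expr S).
Hypothesis pP : play_following T answers p.

Let st n := run (fun i => p i.*2) n.

Lemma played_st n : played (st n) = p n.*2.+1.
Proof.
have [_ _ ->] := pP; rewrite /answers size_mkseq /= uphalf_double.
congr played; apply: run_eq => i ni.
by rewrite nth_mkseq // ltnS leq_double.
Qed.

Lemma p_le m n : (m <= n)%N -> p m `<=` p n.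
Proof.
have [_ pS _] := pP; elim: n => [|n IH]; first by rewrite leqn0 => /eqP ->.
rewrite leq_eqVlt => /orP[/eqP -> //|]; rewrite ltnS => /IH h.
exact: subset_trans h (pS n).
Qed.

(** The rigidity 2^-(n+1) obtained at stage n is exactly what stage n + 1 requires. [start] is rigid
    because it controls nothing. *)
Lemma st_answer n :
  answer n (if n is m.+1 then st m else start) (p n.*2) (st n).
Proof.
have [pc pS _] := pP.
elim: n => [|n IH]; apply: nextP; apply: answer_exists => //.
- exact: start_rigid.
- by have [[_ _ _ +] _ _ _ _] := IH.
- by rewrite played_st; apply: p_le; rewrite doubleS.
Qed.

Lemma st_sat n : sat (interp (st n)) (p n.*2.+1).
Proof. by rewrite -played_st; have [[_ _ + _] _ _ _ _] := st_answer n. Qed.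

Lemma controlled_le m n : (m <= n)%N -> {subset controlled (st m) <= controlled
  (st n)}.
Proof.
elim: n => [|n IH]; first by rewrite leqn0 => /eqP ->.
rewrite leq_eqVlt => /orP[/eqP -> //|]; rewrite ltnS => /IH h c /h.
by have [_ _ _ _ [+ _ _]] := st_answer n.+1; apply.
Qed.

Lemma st_step n c : c \in controlled (st n) ->
  sdist M (interp (st n.+1) c) (interp (st n) c) < (2 ^+ n.+1)^-1.
Proof. by move=> cn; rewrite sdistE; have [_ + _ _ _] := st_answer n.+1;
  apply. Qed.

(** The bound is a difference so that the steps, each below 2^-(n+1), telescope. *)
Lemma st_dist m n c : (m <= n)%N -> c \in controlled (st m) ->
  sdist M (interp (st n) c) (interp (st m) c) <= (2 ^+ m)^-1 - (2 ^+ n)^-1.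
Proof.
move=> + cm; elim: n => [|n IH].
  by rewrite leqn0 => /eqP ->; rewrite (sdistxx Ms) subrr.
rewrite leq_eqVlt => /orP[/eqP ->|]; first by rewrite (sdistxx Ms) subrr.
rewrite ltnS => mn; have := IH mn; have := st_step (controlled_le mn cm).
have := st_dist_triangle Ms (interp (st n.+1) c) (interp (st n) c) (interp (st
  m) c).
by rewrite (pow2S K n); lra.
Qed.

Lemma st_dist_le m n c : (m <= n)%N -> c \in controlled (st m) ->
  sdist M (interp (st n) c) (interp (st m) c) <= (2 ^+ m)^-1.
Proof. by move=> mn /(st_dist mn); have := pow2_gt0 K n; lra. Qed.

Lemma controlled_pickle c : c \in controlled (st (pickle c).+1).
Proof. by have [_ _ _ _ [_ + _]] := st_answer (pickle c).+1; apply. Qed.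

Lemma limit_interp : exists b : assignment,
  forall c, lim_to (fun n => sdist M (interp (st n) c) (b c)).
Proof.
suff h c : exists y, lim_to (fun n => sdist M (interp (st n) c) y).
  by exists (fun c => sval (cid (h c))) => c; exact: (svalP (cid (h c))).
apply: (st_complete Ms) => e e0; have e2 : 0 < e / 2 by lra.
have [n0 n0P] := pow2_lim e2; pose m0 := maxn n0 (pickle c).+1.
have cm : c \in controlled (st m0).
  exact: controlled_le (leq_maxr _ _) _ (controlled_pickle c).
have em : (2 ^+ m0)^-1 < e / 2 by apply: n0P; apply: leq_maxl.
exists m0 => m n mm mn; have := st_dist_le mm cm; have := st_dist_le mn cm.
have := st_dist_triangle Ms (interp (st m) c) (interp (st m0) c) (interp (st n)
  c).
by rewrite (st_dist_sym Ms (interp (st m0) c)); lra.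
Qed.

(** The margins make the limit interpretation a model of the whole play. Any other model lies, at
    stages that recur for each atomic sentence, near the same [v] as the limit does, hence has the
    same atomic values. *)
Lemma play_definitive_compiled :
  (forall phi, exists n, E n = phi) ->
  (forall k (x : M k) e, 0 < e ->
     exists i y, D i = existT _ k y /\ sdist M y x < e) ->
  definitive T (\bigcup_n p n) /\
  exists2 N : LC_structure K, compiled T (\bigcup_n p n) N & reduct N = M.
Proof.
move=> EP DP; have [b bP] := limit_interp.
pose N := @LCStructure K M b.
(* From stage n on the interpretations satisfy the stronger bound r', which passes to the limit as a
   weak inequality. *)
have bsat phi r n : p n (phi, r) -> exists2 r', r' < r & forall m,
  (n <= m)%N -> qf_val (interp (st m)) phi < r'.
  move=> pn; have pn2 : p n.*2 (phi, r) by apply: p_le pn;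
    rewrite -addnn leq_addr.
  have [_ _ /(_ _ _ pn2) [r' r'r pr'] _ _] := st_answer n; exists r' => // m nm.
  have pm : p m.*2.+1 (phi, r').
    by rewrite played_st in pr'; apply: p_le pr'; rewrite ltnS leq_double.
  by have := @st_sat m; apply.
have Nmod : models T N (\bigcup_n p n).
  split=> // phi r [n _ /bsat[r' r'r h]]; apply: le_lt_trans r'r.
  have hc : (fun m => qf_val (interp (st m)) phi) @ \oo --> qf_val b phi.
    exact: (qf_val_cvg Ms bP).
  rewrite -(cvg_lim _ hc) //; apply: limr_le; first by apply/cvg_ex;
    exists (qf_val b phi).
  by exists n => // m /= nm; apply/ltW/h.
have Nval N' phi : models T N' (\bigcup_n p n) ->
    atomic_val (@cst K N') phi = atomic_val b phi.
  move=> N'mod; have [i Ei] := EP phi.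
  have N'close (N'' : LC_structure K) n : models T N'' (\bigcup_n p n) ->
      forall f r, played (st n) (f, r) -> qf_val (@cst K N'') f < r.
    move=> [_ _ h] f r fr; apply: h; exists n.*2.+1 => //.
    by rewrite -played_st.
  apply/eqP; rewrite -subr_eq0 -normr_eq0; apply/eqP.
  apply: lim_to_const => // e e0.
  have e4 : 0 < e / 4 by lra.
  (* Among the stages that deal with [phi] one is chosen so late that the two errors 2 * 2^-n add up
     to less than e. *)
  have [n0 n0P] := pow2_lim e4; have [n n0n ni] := logn2_recurrent i n0.
  have [_ _ _ [v vP] _] := st_answer n; exists 0%N => _ _.
  have h1 := vP N' (let: And3 h _ _ := N'mod in h) (N'close N' n N'mod).
  have h2 := vP N Ms (N'close N n Nmod).
  have h3 := n0P n n0n; move: h1 h2; rewrite ni Ei /=.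
  by move: (atomic_val _ phi) (atomic_val b phi) => x y; rewrite !ltr_norml; lra.
split.
  move=> phi; exists (atomic_val b phi); split; first by move=> N' /Nval.
  by move=> r /(_ N Nmod).
exists N => //; split=> //.
  by move=> phi r; apply.
move=> k x e e0; have e2 : 0 < e / 2 by lra.
have [i [y [Di yx]]] := DP k x _ e2.
have e4 : 0 < e / 4 by lra.
have [n0 n0P] := pow2_lim e4; have [n n0n ni] := logn2_recurrent i n0.
have [_ _ _ _ [_ _]] := st_answer n; rewrite ni Di /= => -[j jn jy].
(* This constant was given the value [y] at stage n and moves by at most 2^-n afterwards. *)
exists (TVar const_sort (k, j)).
suff : sdist M (b (k, j)) x < e by [].
have [m mP] := bP (k, j) _ e4; have hm := mP (maxn m n) (leq_maxl _ _).
have hn := st_dist_le (leq_maxr m n) jn; rewrite jy in hn.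
have t1 := st_dist_triangle Ms (b (k, j)) (interp (st (maxn m n)) (k, j)) x.
have t2 := st_dist_triangle Ms (interp (st (maxn m n)) (k, j)) y x.
rewrite (st_dist_sym Ms (b (k, j)) (interp _ _)) in t1; have := n0P n n0n.
by move: t1 t2 hm hn yx; lra.
Qed.

End Play.
End GameProof.

Theorem theorem5p1 (K : realType) (S : connectives K) (R : tracial_vNa K) :
  countable_dense S -> is_hyperfinite_R R ->
  enforceable_model S (Th_forall (structure_of R)) (structure_of R).
Proof.
move=> dense_S [pi [xi [piP piC vN_gen tauE cyclic]]].
have [E EP] := atomic_enum.
have [D DP] := ball_separable tauE piP piC vN_gen.
exists (answers D E); first exact: (answers_strategy tauE cyclic D E).
move=> p pP.
have [pd [N Nc NR]] := play_definitive_compiled tauE cyclic piP piC vN_gen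
  dense_S pP EP DP.
split=> //; exists N => //; rewrite NR.
by exists (fun k x => x); do !split=> //; move=> k; exists id.
Qed.
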